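(* Fix the parameters, and hence $b_n^x$. If two cell modules $W^{n,m}_{\epsilon_1,\epsilon_2}$ and $W^{n,t}_{\eta_1,\eta_2}$ are in the same block of $b_n^x$, then $\alpha^{(n,m)}_{\epsilon_1,\epsilon_2}=\alpha^{(n,t)}_{\eta_1,\eta_2}$.
   Context: \textbf{The algebra $b_n^x$.} Fix $n\ge1$, a field $k$ and $(\delta,\delta_L,\delta_R,\kappa_L,\kappa_R,\kappa_{LR})\in k^6$. Consider planar Temperley--Lieb diagrams in a rectangle with $n$ top and $n$ bottom nodes (strings are top arcs, bottom arcs, propagating lines, and possibly closed loops), up to isotopy, whose strings may carry left blobs $L$ (which can be deformed to touch the left wall) and right blobs $R$ (right wall), obtained by stacking copies of: $e_0$ (identity diagram with one $L$ on the first string), $e_i$ for $1\le i\le n-1$ (top arc $\{i,i+1\}$, bottom arc $\{i,i+1\}$, all other strings vertical), $e_n$ (identity diagram with one $R$ on the last string). Straightening relations: undecorated loop $\to\delta$; consecutive $LL$ on a string $\to\delta_L\,L$; consecutive $RR\to\delta_R\,R$; loop with one $L$ $\to\kappa_L$; loop with one $R$ $\to\kappa_R$; loop with one $L$ and one $R$ $\to\kappa_{LR}$; consecutive $LRL$ on a string $\to\kappa_{LR}L$; consecutive $RLR\to\kappa_{LR}R$; and the topological relation: a diagram without propagating lines having a top arc and a bottom arc each decorated with one $L$ and one $R$ is $\kappa_{LR}$ times the diagram obtained by replacing these two arcs by two vertical propagating lines joining their left endpoints and their right endpoints, the left one carrying one $L$ and the right one carrying one $R$. The symplectic blob algebra $b_n^x$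 is the $k$-algebra with basis the diagrams to which no relation applies; $dd'$ is obtained by stacking $d$ over $d'$ and straightening until no relation applies (the result is well defined). \textbf{Cell modules.} A label for $n$ is $(m,\epsilon_1,\epsilon_2)$ with $0\le m\le n-1$, $m\equiv n-1 \pmod 2$, $\epsilon_i\in\{\pm1\}$ (written $\pm$), where $m=0$ is allowed only with $\epsilon_1=\epsilon_2=+1$, and $(1,-1,-1)$ is not allowed. The left $b_n^x$-module $W^{n,m}_{\epsilon_1,\epsilon_2}$ has as basis the (reduced) upper half-diagrams on $n$ nodes with exactly $m+1$ propagating lines, the leftmost carrying one $L$ iff $\epsilon_1=-1$, the rightmost carrying one $R$ iff $\epsilon_2=-1$, propagating lines being otherwise undecorated, and each arc exposed to the left (resp. right) wall carrying at most one $L$ (resp. $R$). Diagrams act by stacking on top and straightening; the result is $0$ if it has fewer propagating lines or its propagating lines carry a decoration not of this type. All composition factors of a cell module lie in one block; two cell modules are in the same block if their composition factors are. \textbf{Parameters.} $q,Q_1,Q_2\in k^\times$ with $q^2\ne1$, and $Q_i$ is written $q^{w_i}$, so that $[a+b_1w_1+b_2w_2]=\dfrac{q^aQ_1^{b_1}Q_2^{b_2}-q^{-a}Q_1^{-b_1}Q_2^{-b_2}}{q-q^{-1}}$ for integers $a,b_1,b_2$; assume $[w_1+1],[w_2+1]\neq0$. Set $\delta=[2]$, $\delta_L=[w_1]/[w_1+1]$, $\delta_R=[w_2]/[w_2+1]$, $\kappa_L=\kappa_R=1$, $\kappa_{LR}\in k$ arbitrary. \textbf{The scalars.} $\alpha^{(n,m)}_{\epsilon_1,\epsilon_2}=[n]\dfrac{[2(-m+\epsilon_1w_1+\epsilon_2w_2)]}{[-m+\epsilon_1w_1+\epsilon_2w_2]}=[n]\left(q^{-m}Q_1^{\epsilon_1}Q_2^{\epsilon_2}+q^{m}Q_1^{-\epsilon_1}Q_2^{-\epsilon_2}\right)$.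 *)

(* Defs.v *)
From HB Require Import structures.
From mathcomp Require Import all_boot all_order all_algebra all_field.
From mathcomp Require Import boolp.
Set Implicit Arguments.
Unset Strict Implicit.
Unset Printing Implicit Defensive.
Import GRing.Theory.
Local Open Scope ring_scope.

Variant blob := L | R.

Definition bool_of_blob (x : blob) : bool := if x is L then true else false.
Definition blob_of_bool (b : bool) : blob := if b then L else R.
Lemma bool_of_blobK : cancel bool_of_blob blob_of_bool. Proof. by case. Qed.
HB.instance Definition _ := Finite.copy blob (can_type bool_of_blobK).

(* Nodes of a rectangle with n top nodes ([inl]) and t bottom nodes ([inr]),
   both rows being numbered from 0, left to right. *)
Definition node (n t : nat) : finType := ('I_n + 'I_t)%type.

(* Place of a node on the boundary of the rectangle, travelled along the top
   from left to right and then along the bottom from right to left. *)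
Definition pos n t (x : node n t) : nat :=
  match x with inl i => i | inr j => (n + (t.-1 - j))%N end.

(* The combinatorial data of a diagram up to isotopy: [mate d x] is the other
   end of the open string ending at [x], [word d x] is the sequence of blobs met
   on that string when it is followed from [x], and [loops d] lists, for each
   closed string, its blobs read once around.  Blobs on distinct strings can be
   moved independently of each other, so that nothing else has to be recorded. *)
Record diagram (n t : nat) := Diagram {
  mate : {ffun node n t -> node n t};
  word : {ffun node n t -> seq blob};
  loops : seq (seq blob) }.

Definition diagram_data n t (d : diagram n t) := (mate d, word d, loops d).
Definition diagram_of_data n t
  (x : {ffun node n t -> node n t} * {ffun node n t -> seq blob} * seq (seq blob))
  : diagram n t := Diagram x.1.1 x.1.2 x.2.
Lemma diagram_dataK n t : cancel (@diagram_data n t) (@diagram_of_data n t).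
Proof. by case. Qed.
HB.instance Definition _ n t :=
  Equality.copy (diagram n t) (can_type (@diagram_dataK n t)).

Section Stacking.
Variables (n s t : nat) (d : diagram n s) (d' : diagram s t).

(* String ends of the two stacked pieces: [inl] for the upper piece [d] and
   [inr] for the lower piece [d']. *)
Definition strand_end : finType := (node n s + node s t)%type.

Definition across (e : strand_end) : strand_end :=
  match e with inl x => inl (mate d x) | inr y => inr (mate d' y) end.

Definition read (e : strand_end) : seq blob :=
  match e with inl x => word d x | inr y => word d' y end.

(* Bottom node j of [d] is identified with top node j of [d']; the remaining
   ends are fixed by [glue], and they are the ends on the outer boundary. *)
Definition glue (e : strand_end) : strand_end :=
  match e with
  | inl (inr j) => inr (inl j)
  | inr (inl j) => inl (inr j)
  | _ => e
  end.

Definition outer_end (x : node n t) : strand_end :=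
  match x with inl i => inl (inl i) | inr j => inr (inr j) end.

Definition walk_step (p : strand_end * seq blob) : strand_end * seq blob :=
  if glue p.1 == p.1 then p
  else (across (glue p.1), p.2 ++ read (glue p.1)).

(* An open string crosses each of the s middle nodes at most once, so that s
   steps lead from the outer end [x] to the other outer end. *)
Definition walk (x : node n t) : strand_end * seq blob :=
  iter s walk_step (across (outer_end x), read (outer_end x)).

Definition stack_mate (x : node n t) : node n t :=
  match (walk x).1 with
  | inl (inl i) => inl i
  | inr (inr j) => inr j
  | _ => x (* never reached *)
  end.

(* The ends from which a string of [d] or [d'] is entered when one leaves the
   middle node j upwards; the orbit avoids the outer boundary exactly when j
   lies on a closed string. *)
Definition circuit (j : 'I_s) : seq strand_end :=
  orbit (fun e => glue (across e)) (inl (inr j)).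

(* j is the leftmost middle node of a closed string *)
Definition starts_loop (j : 'I_s) : bool :=
  all (fun e : strand_end =>
         match e with
         | inl (inr i) => (j <= i)%N
         | inr (inl i) => (j <= i)%N
         | _ => false
         end) (circuit j).

Definition new_loops : seq (seq blob) :=
  [seq flatten [seq read e | e <- circuit j] | j <- enum 'I_s & starts_loop j].

Definition stack : diagram n t :=
  Diagram [ffun x => stack_mate x] [ffun x => (walk x).2]
          (loops d ++ loops d' ++ new_loops).

End Stacking.

Section Generators.
Variable n : nat.

Definition vertical (x : node n n) : node n n :=
  match x with inl i => inr i | inr i => inl i end.

Definition abscissa (x : node n n) : nat :=
  match x with inl i => i | inr i => i end.

Definition id_diagram : diagram n n :=
  Diagram [ffun x => vertical x] [ffun => [::]] [::].

Definition left_diagram : diagram n n :=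
  Diagram [ffun x => vertical x]
          [ffun x => if abscissa x == 0%N then [:: L] else [::]] [::].

Definition right_diagram : diagram n n :=
  Diagram [ffun x => vertical x]
          [ffun x => if abscissa x == n.-1 then [:: R] else [::]] [::].

Definition hook_mate (i j : 'I_n) (x : node n n) : node n n :=
  match x with
  | inl a => if a == i then inl j else if a == j then inl i else inr a
  | inr a => if a == i then inr j else if a == j then inr i else inl a
  end.

Definition hook_diagram (i j : 'I_n) : diagram n n :=
  Diagram [ffun x => hook_mate i j x] [ffun => [::]] [::].

Inductive generator : diagram n n -> Prop :=
| gen_left : generator left_diagram
| gen_hook (i j : 'I_n) : j = i.+1 :> nat -> generator (hook_diagram i j)
| gen_right : generator right_diagram.

Inductive obtained : diagram n n -> Prop :=
| obtained_id : obtained id_diagram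
| obtained_stack g d : generator g -> obtained d -> obtained (stack g d).

End Generators.

Record blob_scalars (k : Type) := BlobScalars {
  delta : k; delta_L : k; delta_R : k;
  kappa_L : k; kappa_R : k; kappa_LR : k }.

Definition no_propagating n t (d : diagram n t) : bool :=
  [forall i : 'I_n, if mate d (inl i) is inl _ then true else false]
  && [forall j : 'I_t, if mate d (inr j) is inr _ then true else false].

(* The end nodes, left one first, of a top (bottom) arc decorated with one L and
   one R.  A planar diagram has at most one such top arc and one such bottom
   arc. *)
Definition top_LR n t (d : diagram n t) : option ('I_n * 'I_n) :=
  [pick p : 'I_n * 'I_n | [&& (p.1 < p.2)%N, mate d (inl p.1) == inl p.2
                            & perm_eq (word d (inl p.1)) [:: L; R]]].
Definition bottom_LR n t (d : diagram n t) : option ('I_t * 'I_t) :=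
  [pick p : 'I_t * 'I_t | [&& (p.1 < p.2)%N, mate d (inr p.1) == inr p.2
                            & perm_eq (word d (inr p.1)) [:: L; R]]].

Definition LR_arcs n t (d : diagram n t) : option (('I_n * 'I_n) * ('I_t * 'I_t)) :=
  if no_propagating d then
    match top_LR d, bottom_LR d with
    | Some p, Some p' => Some (p, p')
    | _, _ => None
    end
  else None.

Definition reduced_word (w : seq blob) : bool :=
  all (fun r => ~~ infix r w)
      [:: [:: L; L]; [:: R; R]; [:: L; R; L]; [:: R; L; R]].

Definition reduced n t (d : diagram n t) : bool :=
  [&& loops d == [::], [forall x, reduced_word (word d x)] & LR_arcs d == None].

Section Straightening.
Variables (k : fieldType) (P : blob_scalars k).

Definition push (x : blob) (cw : k * seq blob) : k * seq blob :=
  let: (c, w) := cw in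
  match x, w with
  | L, L :: _ => (delta_L P * c, w)
  | R, R :: _ => (delta_R P * c, w)
  | L, R :: L :: w' => (kappa_LR P * c, L :: w')
  | R, L :: R :: w' => (kappa_LR P * c, R :: w')
  | _, _ => (c, x :: w)
  end.

Definition straighten_word (w : seq blob) : k * seq blob :=
  foldr push (1, [::]) w.

(* On a planar loop the L's are consecutive and so are the R's: the loop reduces
   by LL -> delta_L L and RR -> delta_R R to one with at most one blob of each
   kind.  The relations LRL and RLR are not meant to be read around a loop. *)
Definition loop_value (w : seq blob) : k :=
  match count_mem L w, count_mem R w with
  | 0%N, 0%N => delta P
  | a.+1, 0%N => delta_L P ^+ a * kappa_L P
  | 0%N, b.+1 => delta_R P ^+ b * kappa_R P
  | a.+1, b.+1 => delta_L P ^+ a * delta_R P ^+ b * kappa_LR P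
  end.

(* straightening of all the strings; each open string is counted once, at its
   end with the smaller position *)
Definition straighten_strings n t (d : diagram n t) : k * diagram n t :=
  ((\prod_(w <- loops d) loop_value w) *
   \prod_(x : node n t | (pos x < pos (mate d x))%N) (straighten_word (word d x)).1,
   Diagram (mate d) [ffun x => (straighten_word (word d x)).2] [::]).

(* [d] with the arcs {i, i'} (top) and {j, j'} (bottom) replaced by the lines
   {i, j}, decorated with L, and {i', j'}, decorated with R *)
Definition reconnect n t (d : diagram n t) (p : ('I_n * 'I_n) * ('I_t * 'I_t))
  : diagram n t :=
  let: ((i, i'), (j, j')) := p in
  Diagram
    [ffun x : node n t =>
       if x == inl i then inr j else if x == inr j then inl i
       else if x == inl i' then inr j' else if x == inr j' then inl i'
       else mate d x]
    [ffun x : node n t =>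
       if (x == inl i) || (x == inr j) then [:: L]
       else if (x == inl i') || (x == inr j') then [:: R]
       else word d x]
    (loops d).

Definition straighten n t (d : diagram n t) : k * diagram n t :=
  let: (c, d1) := straighten_strings d in
  if LR_arcs d1 is Some p then (c * kappa_LR P, reconnect d1 p) else (c, d1).

End Straightening.

(* A reduced word has at most two letters, so that every reduced diagram is of
   this form; this makes the set of reduced diagrams a finite type. *)
Definition small_diagram (n t : nat) : finType :=
  ({ffun node n t -> node n t} * {ffun node n t -> 2.-bseq blob})%type.

Definition dia n t (d : small_diagram n t) : diagram n t :=
  Diagram d.1 [ffun x => d.2 x : seq blob] [::].

Definition basis_diagram (n : nat) : finType :=
  {d : small_diagram n n | reduced (dia d) && `[< obtained (dia d) >]}.

Definition bdia n (d : basis_diagram n) : diagram n n := dia (val d).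

(* [b] presents the k-algebra A as the symplectic blob algebra: it is a basis
   indexed by the reduced diagrams, and basis elements are multiplied by
   stacking and straightening.  The sum has a single term, namely the basis
   element of the straightened diagram.  This determines A up to a unique
   isomorphism compatible with the bases. *)
Definition symplectic_blob_algebra (k : fieldType) (P : blob_scalars k) (n : nat)
    (A : falgType k) (b : basis_diagram n -> A) : Prop :=
  basis_of fullv (codom b) /\
  forall d d' : basis_diagram n,
    let: (c, e) := straighten P (stack (bdia d) (bdia d')) in
    b d * b d' = c *: \sum_(x : basis_diagram n | bdia x == e) b x.

Definition label (n m : nat) (e1 e2 : int) : bool :=
  [&& (m < n)%N, odd m == odd n.-1,
      (e1 == 1) || (e1 == -1), (e2 == 1) || (e2 == -1),
      (m == 0%N) ==> ((e1 == 1) && (e2 == 1)) &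
      ~~ [&& m == 1%N, e1 == -1 & e2 == -1]].

Section HalfDiagrams.
Variables (n m : nat) (e1 e2 : int).

(* An upper half-diagram with m+1 propagating lines is encoded as a diagram with
   n top nodes and m+1 bottom nodes, the bottom nodes being the cut ends of the
   propagating lines. *)
Variable d : diagram n m.+1.

Definition planar_matching : bool :=
  [forall x, (mate d x != x) && (mate d (mate d x) == x)] &&
  [forall x, [forall y,
     ~~ [&& (pos x < pos y)%N, (pos y < pos (mate d x))%N
          & (pos (mate d x) < pos (mate d y))%N]]].

Definition all_propagating : bool :=
  [forall j : 'I_m.+1, if mate d (inr j) is inl _ then true else false].

Definition line_word (j : 'I_m.+1) : seq blob :=
  (if (j == 0%N :> nat) && (e1 == -1) then [:: L] else [::]) ++
  (if (j == m :> nat) && (e2 == -1) then [:: R] else [::]).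

(* every node to the left of a (right of a) belongs to an arc lying entirely to
   the left of a (right of a) *)
Definition left_exposed (a : 'I_n) : bool :=
  [forall i : 'I_n, (i < a)%N ==>
     (if mate d (inl i) is inl i' then (i' < a)%N else false)].
Definition right_exposed (a : 'I_n) : bool :=
  [forall i : 'I_n, (a < i)%N ==>
     (if mate d (inl i) is inl i' then (a < i')%N else false)].

(* As there is a propagating line, an arc is exposed to at most one wall. *)
Definition arc_words : bool :=
  [forall a : 'I_n, forall a' : 'I_n,
     (mate d (inl a) == inl a') && (a < a')%N ==>
     [|| word d (inl a) == [::],
         (word d (inl a) == [:: L]) && left_exposed a |
         (word d (inl a) == [:: R]) && right_exposed a']].

Definition half_diagram : bool :=
  [&& planar_matching, all_propagating, loops d == [::],
      [forall x, word d (mate d x) == rev (word d x)],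
      [forall j : 'I_m.+1, word d (inr j) == line_word j] & arc_words].

End HalfDiagrams.

Definition half_basis (n m : nat) (e1 e2 : int) : finType :=
  {d : small_diagram n m.+1 | half_diagram e1 e2 (dia d)}.

Definition hdia n m e1 e2 (v : half_basis n m e1 e2) : diagram n m.+1 := dia (val v).

Definition cell_module (k : fieldType) (n m : nat) (e1 e2 : int) : vectType k :=
  {ffun half_basis n m e1 e2 -> k^o}.

Section CellAction.
Variables (k : fieldType) (P : blob_scalars k) (n : nat).

(* When the straightened stack has fewer propagating lines, or lines decorated
   otherwise, it is not [hdia w] for any w and the result is 0. *)
Definition stack_action m e1 e2 (d : basis_diagram n) (v : half_basis n m e1 e2)
  : cell_module k n m e1 e2 :=
  let: (c, e) := straighten P (stack (bdia d) (hdia v)) in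
  [ffun w => if hdia w == e then c else 0].

Variables (A : falgType k) (b : basis_diagram n -> A).

(* bilinear extension of [stack_action]; [coord] gives the coordinates in the
   basis [b] *)
Definition cell_action m e1 e2 (a : A) (f : cell_module k n m e1 e2)
  : cell_module k n m e1 e2 :=
  \sum_(d : basis_diagram n) \sum_(v : half_basis n m e1 e2)
    (coord (codom_tuple b) (enum_rank d) a * f v) *: stack_action d v.

End CellAction.

Section Blocks.
Variables (k : fieldType) (A : falgType k).

Definition central_idempotent (e : A) : Prop :=
  e * e = e /\ forall a : A, e * a = a * e.

(* The blocks of A are the A e for e a primitive central idempotent. *)
Definition primitive_central_idempotent (e : A) : Prop :=
  [/\ central_idempotent e, e != 0 &
      forall f g : A, central_idempotent f -> central_idempotent g ->
        f * g = 0 -> e = f + g -> f = 0 \/ g = 0].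

Section Module.
Variables (W : vectType k) (act : A -> W -> W).

Definition submodule (U : {vspace W}) : Prop :=
  forall a v, v \in U -> act a v \in U.

Definition composition_factor (U U' : {vspace W}) : Prop :=
  [/\ submodule U, submodule U', (U <= U')%VS, U != U' &
      forall X, submodule X -> (U <= X <= U')%VS -> X = U \/ X = U'].

(* The simple module U' / U belongs to the block A e: e acts on it as the
   identity. *)
Definition factor_in_block (e : A) (U U' : {vspace W}) : Prop :=
  forall v, v \in U' -> act e v - v \in U.

Definition in_block (e : A) : Prop :=
  forall U U', composition_factor U U' -> factor_in_block e U U'.

End Module.

Definition same_block (W W' : vectType k)
    (act : A -> W -> W) (act' : A -> W' -> W') : Prop :=
  exists e : A, [/\ primitive_central_idempotent e, in_block act e & in_block act' e].

End Blocks.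

Section Scalars.
Variables (k : fieldType) (q Q1 Q2 : k).

(* [a + b1 w1 + b2 w2], where Qi = q^wi *)
Definition qnum (a b1 b2 : int) : k :=
  (q ^ a * Q1 ^ b1 * Q2 ^ b2 - q ^ (- a) * Q1 ^ (- b1) * Q2 ^ (- b2)) / (q - q^-1).

Definition blob_parameters (kLR : k) : blob_scalars k :=
  {| delta := qnum 2 0 0;
     delta_L := qnum 0 1 0 / qnum 1 1 0;
     delta_R := qnum 0 0 1 / qnum 1 0 1;
     kappa_L := 1;
     kappa_R := 1;
     kappa_LR := kLR |}.

(* The polynomial form of [n] [2x] / [x] with x = -m + e1 w1 + e2 w2, which makes
   sense also when [x] = 0. *)
Definition alpha (n m : nat) (e1 e2 : int) : k :=
  qnum n%:Z 0 0 *
  (q ^ (- m%:Z) * Q1 ^ e1 * Q2 ^ e2 + q ^ m%:Z * Q1 ^ (- e1) * Q2 ^ (- e2)).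

End Scalars.

(* Main.v *)
(* Let C be the element of b_n obtained from a closed string which runs around
   all the strings and both walls, by resolving its crossings.  By the braid-like
   relations of the generators, C is central.  On the cell module W_{e1,e2}^{n,m}
   it acts by the scalar K (x + x^-1) with x = q^-m Q1^e1 Q2^e2, where K <> 0 does
   not depend on the cell module: as W is generated by a single half-diagram, it
   suffices to treat that one, chosen so that its lines come first, on which C is
   evaluated by pulling the closed string successively over the arcs and the
   lines.  Finally, a central element has at most one eigenvalue on a block,
   since the minimal polynomial of C on the block would otherwise split the
   primitive central idempotent.  Hence x + x^-1 is constant on blocks. *)
From HB Require Import structures.
Require Import Defs.
From mathcomp Require Import all_boot all_order all_algebra all_field.
From mathcomp Require Import boolp zify ring.
Set Implicit Arguments.
Unset Strict Implicit.
Unset Printing Implicit Defensive.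
Import GRing.Theory.
Local Open Scope ring_scope.

(** * Stacking a vertical diagram or a hook *)

(** Associativity is never established for stacking; it is borrowed from [A]. Each half-diagram is
    completed by a fixed lower half to a basis diagram, and the cell action becomes multiplication
    in [A], read modulo the span of the degenerate diagrams, a left ideal. The central element is
    then handled through relations between generators alone. The price is that completed
    half-diagrams must be shown to come from generators; the slides of a bare pair which give this
    also generate the module from one half-diagram. Crossings are replaced by elements of [A]:
    [K = u + v E n] winds the last string around the right wall, with u : v dictated by the
    reflection equation, and closed strings arise as partial closures of windings,
    [E i * Y i.+1 * E i = E i * Psum i.+2]. The topological relation threatens the passage to [A],
    since it makes lines out of arcs. Such lines carry one L and one R, and only the excluded label
    (1, -1, -1) has exactly such a pair of lines. *)

Definition valid n t (D : diagram n t) : Prop :=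
  [/\ involutive (mate D), forall x, mate D x != x &
      forall x, word D (mate D x) = rev (word D x)].

Lemma eq_diagram n t (D D' : diagram n t) :
  mate D =1 mate D' -> word D =1 word D' -> loops D = loops D' -> D = D'.
Proof.
case: D D' => [f w l] [f' w' l'] /= ef ew ->.
by congr Diagram; apply/ffunP.
Qed.

Lemma uniq_ord_size n (s : seq 'I_n) : uniq s -> (size s <= n)%N.
Proof. by move/card_uniqP<-; rewrite -[X in (_ <= X)%N]card_ord max_card. Qed.

(** [walk] makes as many steps as there are middle nodes, whereas a given string may end earlier;
    the walk then rests at the outer end. So only the steps up to that end have to be computed. *)
Lemma iter_stop T (f : T -> T) r n p p' :
  (r <= n)%N -> iter r f p = p' -> f p' = p' -> iter n f p = p'.
Proof.
move=> le_rn e1 e2; rewrite -(subnK le_rn) iterD e1.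
by elim: (n - r)%N => //= k ->.
Qed.

Lemma walk_out n s t (d : diagram n s) (d' : diagram s t) p :
  glue p.1 = p.1 -> walk_step d d' p = p.
Proof. by rewrite /walk_step => ->; rewrite eqxx. Qed.

(** A closed string never meets the outer boundary, so a single iterate that lands there is
    enough. *)
Lemma starts_loopN n s t (d : diagram n s) (d' : diagram s t) j r :
  (match iter r (fun e => glue (across d d' e)) (inl (inr j)) with
   | inl (inl _) | inr (inr _) => true | _ => false end) ->
  starts_loop d d' j = false.
Proof.
move=> out; apply/negP => /allP H; move: out.
have /H : iter r (fun e => glue (across d d' e)) (inl (inr j)) \in circuit d d' j.
  by rewrite /circuit -fconnect_orbit; apply: fconnect_iter.
by case: (iter _ _ _) => -[].
Qed.

Lemma new_loops0 n s t (d : diagram n s) (d' : diagram s t) :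
  (forall j, starts_loop d d' j = false) -> new_loops d d' = [::].
Proof.
by move=> H; rewrite /new_loops (eq_filter (a2 := pred0)) ?filter_pred0.
Qed.

Section StackVert.
Variables (n t : nat) (u : 'I_n -> seq blob).

Definition vert : diagram n n :=
  Diagram [ffun x => vertical x]
    [ffun x => u (match x with inl i => i | inr i => i end)] [::].

Definition top_deco (x : node n t) : seq blob := if x is inl i then u i else [::].

(** A string of [D] meets the vertical diagram only at its ends on the top row, where it picks up
    the decoration of the node. A top arc takes two steps; its two distinct ends give 2 <= n. *)
Lemma walk_vert (D : diagram n t) x : valid D ->
  walk vert D x = (match mate D x with inl i => inl (inl i) | inr j => inr (inr j) end,
                   top_deco x ++ word D x ++ top_deco (mate D x)).
Proof.
move=> [inv nofix _]; rewrite /walk.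
case: x => [l|j] /=.
  rewrite !ffunE /=.
  case e: (mate D (inl l)) => [l'|j'] /=.
    have ll' : l != l' by have := nofix (inl l); rewrite e; apply: contraNneq => ->.
    have n2 : (2 <= n)%N by apply: (@uniq_ord_size _ [:: l; l']); rewrite /= inE ll'.
    apply: (iter_stop n2); last exact: walk_out.
    by rewrite /= /walk_step /= e /= !ffunE /= catA.
  have n1 : (1 <= n)%N by exact: leq_ltn_trans (ltn_ord l).
  apply: (iter_stop n1); last exact: walk_out.
  by rewrite /= /walk_step /= e /= cats0.
case e: (mate D (inr j)) => [l'|j'] /=.
  have n1 : (1 <= n)%N by exact: leq_ltn_trans (ltn_ord l').
  apply: (iter_stop n1); last exact: walk_out.
  by rewrite /= /walk_step /= !ffunE.
apply: (@iter_stop _ _ 0) => //; last exact: walk_out.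
by rewrite /= cats0.
Qed.

Lemma new_loops_vert (D : diagram n t) : new_loops vert D = [::].
Proof.
apply: new_loops0 => j; apply: (@starts_loopN _ _ _ _ _ _ 1).
by rewrite /= ffunE.
Qed.

Lemma stack_vert (D : diagram n t) : valid D ->
  stack vert D = Diagram (mate D)
     [ffun x => top_deco x ++ word D x ++ top_deco (mate D x)] (loops D).
Proof.
move=> vD; apply: eq_diagram => [x|x|] /=.
- by rewrite ffunE /stack_mate walk_vert //=; case: (mate D x).
- by rewrite !ffunE walk_vert.
- by rewrite new_loops_vert cats0.
Qed.
End StackVert.

Section StackHook.
Variables (n t : nat) (i j : 'I_n) (D : diagram n t).
Hypotheses (vD : valid D) (ij : i != j).

(** The hook puts a new arc on top and joins the two strings of [D] which ended at i and j; the
    joined word is read from the far end of one string to the far end of the other. *)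
Definition hook_mates (x : node n t) : node n t :=
  if x == inl i then inl j else if x == inl j then inl i
  else if x == mate D (inl i) then mate D (inl j)
  else if x == mate D (inl j) then mate D (inl i) else mate D x.
Definition hook_words (x : node n t) : seq blob :=
  if (x == inl i) || (x == inl j) then [::]
  else if x == mate D (inl i) then word D x ++ word D (inl j)
  else if x == mate D (inl j) then word D x ++ word D (inl i) else word D x.

Let invD := let: And3 h _ _ := vD in h.
Let nofD := let: And3 _ h _ := vD in h.

Let out (y : node n t) : strand_end n n t :=
  match y with inl i => inl (inl i) | inr j => inr (inr j) end.

Lemma hook_tail y w r : y != inl i -> y != inl j ->
  (if y is inl _ then (1 <= r)%N else true) ->
  iter r (walk_step (hook_diagram i j) D) (inr y, w) = (out y, w).
Proof.
case: y => [l|b] yi yj /= hr; last first.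
  by apply: (@iter_stop _ _ 0) => //; apply: walk_out.
apply: (iter_stop hr); last exact: walk_out.
rewrite /= /walk_step /= !ffunE /= cats0.
by rewrite (negPf (_ : l != i)) // (negPf (_ : l != j)).
Qed.

Let tops (s : seq (node n t)) : seq 'I_n :=
  pmap (fun y : node n t => if y is inl a then Some a else None) s.

Lemma mem_tops s a : (a \in tops s) = (inl a \in s).
Proof.
elim: s => //= -[b|b] s IH /=; rewrite !inE IH //.
Qed.

Lemma uniq_tops s : uniq s -> uniq (tops s).
Proof. by elim: s => //= -[b|b] s IH /andP[h1 /IH h2] //=; rewrite mem_tops h1. Qed.

Lemma size_tops_le s : uniq s -> (size (tops s) <= n)%N.
Proof. by move=> us; apply/uniq_ord_size/uniq_tops. Qed.

Lemma mate_neq x y : x != y -> mate D x != mate D y.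
Proof. by apply: contraNneq => /(inv_inj invD) ->. Qed.

Lemma mate_swap x y : (mate D x == y) = (x == mate D y).
Proof. by rewrite -{1}(invD y) (inj_eq (inv_inj invD)). Qed.

(* Once the string has entered [D] through the outer end [x], it is read to its
   other end in [r] steps, where [r] bounds the remaining middle nodes. *)
Lemma hook_run x r : mate D (inl i) != inl j -> x != inl i -> x != inl j ->
  (size (tops [:: hook_mates x]) +
     (if (x == mate D (inl i)) || (x == mate D (inl j)) then 2 else 0) <= r)%N ->
  iter r (walk_step (hook_diagram i j) D) (inr (mate D x), word D x)
  = (out (hook_mates x), hook_words x).
Proof.
move=> nl xi xj; rewrite /hook_mates /hook_words (negPf xi) (negPf xj) /=.
have ji : mate D (inl j) != inl i by rewrite mate_swap eq_sym.
case: ifP => [/eqP ex|xa].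
  move=> /= hr.
  have r2 : (1 < r)%N by lia.
  rewrite -(subnK r2) iterD.
  have -> : iter 2 (walk_step (hook_diagram i j) D) (inr (mate D x), word D x) =
            (inr (mate D (inl j)), word D x ++ word D (inl j)).
    by rewrite ex invD /= /walk_step /= !ffunE /= eqxx cats0.
  apply: hook_tail; rewrite ?ji ?nofD //.
  by case: (mate D (inl j)) hr => //= a; lia.
case: ifP => [/eqP ex|xc].
  move=> /= hr.
  have r2 : (1 < r)%N by lia.
  rewrite -(subnK r2) iterD.
  have -> : iter 2 (walk_step (hook_diagram i j) D) (inr (mate D x), word D x) =
            (inr (mate D (inl i)), word D x ++ word D (inl i)).
    by rewrite ex invD /= /walk_step /= !ffunE /= [j == i]eq_sym (negPf ij) eqxx cats0.
  apply: hook_tail; rewrite ?nl ?nofD //.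
  by case: (mate D (inl i)) hr => //= a; lia.
move=> /= hr; apply: hook_tail; rewrite ?mate_swap ?xa ?xc //.
by case: (mate D x) hr => //= a; lia.
Qed.


Let a := mate D (inl i).
Let c := mate D (inl j).

Let nij : (inl i == inl j :> node n t) = false.
Proof. by rewrite (inj_eq inl_inj) (negPf ij). Qed.
Let nji : (inl j == inl i :> node n t) = false.
Proof. by rewrite eq_sym nij. Qed.
Let nca : (c == a) = false.
Proof. by apply: negPf; apply: mate_neq; rewrite nji. Qed.
Let nac : (a == c) = false.
Proof. by rewrite eq_sym nca. Qed.
Let nai : (a == inl i) = false. Proof. exact: negPf (nofD _). Qed.
Let ncj : (c == inl j) = false. Proof. exact: negPf (nofD _). Qed.

Lemma hook_mates1 : hook_mates (inl i) = inl j.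
Proof. by rewrite /hook_mates eqxx. Qed.
Lemma hook_mates2 : hook_mates (inl j) = inl i.
Proof. by rewrite /hook_mates nji eqxx. Qed.

Section Open.
Hypothesis nl : mate D (inl i) != inl j.
Let naj : (a == inl j) = false. Proof. exact: negPf. Qed.
Let nci : (c == inl i) = false. Proof. by rewrite mate_swap eq_sym naj. Qed.

Lemma hook_mates3 : hook_mates (mate D (inl i)) = mate D (inl j).
Proof. by rewrite /hook_mates -/a nai naj eqxx. Qed.
Lemma hook_mates4 : hook_mates (mate D (inl j)) = mate D (inl i).
Proof. by rewrite /hook_mates -/a -/c nca nci ncj eqxx. Qed.
Lemma hook_matesN x : x \notin [:: inl i; inl j; a; c] -> hook_mates x = mate D x.
Proof. by rewrite !inE !negb_or /hook_mates => /and4P[/negPf-> /negPf-> /negPf-> /negPf->]. Qed.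

Lemma mate_notin x : x \notin [:: inl i; inl j; a; c] ->
  mate D x \notin [:: inl i; inl j; a; c].
Proof.
rewrite !inE !negb_or !mate_swap /a /c !invD => /and4P[-> -> -> ->] //.
Qed.

Lemma hook_matesK : involutive hook_mates.
Proof.
move=> x; have [|nx] := boolP (x \in [:: inl i; inl j; a; c]); last first.
  by rewrite (hook_matesN nx) hook_matesN ?invD ?mate_notin.
rewrite !inE => /or4P[] /eqP->;
by rewrite /a /c ?(hook_mates1, hook_mates2, hook_mates3, hook_mates4).
Qed.

Lemma hook_mates_nofix x : hook_mates x != x.
Proof.
have [|nx] := boolP (x \in [:: inl i; inl j; a; c]); last first.
  by rewrite (hook_matesN nx) nofD.
rewrite !inE => /or4P[] /eqP->;
by rewrite /a /c ?(hook_mates1, hook_mates2, hook_mates3, hook_mates4) ?nij ?nji -/a -/c ?nca ?nac.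
Qed.

Lemma walk_hook x : x != inl i -> x != inl j ->
  walk (hook_diagram i j) D x = (out (hook_mates x), hook_words x).
Proof.
move=> xi xj.
(* The top nodes among these four ends are the middle nodes that the string can cross; being
   distinct, they number at most n, so that the walk is long enough. *)
have u : uniq [:: x; hook_mates x; inl i; inl j].
  rewrite /= !inE !negb_or xi xj eq_sym hook_mates_nofix /= nij !andbT.
  by rewrite -hook_mates2 -[X in _ && (_ != X)]hook_mates1 !(inj_eq (inv_inj hook_matesK)) xi xj.
have := size_tops_le u => /=.
rewrite /walk; case: x xi xj {u} => [l|b] xi xj /= hs; last first.
  by apply: hook_run => //=; move: hs; case: (_ || _); case: (hook_mates _) => ? /=; clear; lia.
rewrite !ffunE /=.
rewrite (negPf (_ : l != i)) // (negPf (_ : l != j)) //.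
rewrite -[X in iter X](prednK (leq_ltn_trans (leq0n _) (ltn_ord i))) iterSr.
rewrite {2}/walk_step /=.
by apply: hook_run => //=; move: hs; case: (_ || _); case: (hook_mates _) => ? /=; clear; lia.
Qed.

Lemma new_loops_open : new_loops (hook_diagram i j) D = [::].
Proof.
have stop l : l != i -> l != j ->
    glue (across (hook_diagram i j) D (inl (inr l))) = inl (inl l).
  by move=> li lj; rewrite /= ffunE /= (negPf li) (negPf lj).
apply: new_loops0 => l; have [->|li] := eqVneq l i.
  have e1 : glue (across (hook_diagram i j) D (inl (inr i))) = inr (inl j).
    by rewrite /= ffunE /= eqxx.
  have e2 : across (hook_diagram i j) D (inr (inl j)) = inr c by [].
  case ec: c nci ncj => [l'|b] ci cj.
    apply: (@starts_loopN _ _ _ _ _ _ 3); rewrite /iter e1 e2 ec.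
    have -> : glue (inr (inl l') : strand_end n n t) = inl (inr l') by [].
    by rewrite stop // -(inj_eq (@inl_inj _ 'I_t)) ?ci ?cj.
  by apply: (@starts_loopN _ _ _ _ _ _ 2); rewrite /iter e1 e2 ec.
have [->|lj] := eqVneq l j.
  have e1 : glue (across (hook_diagram i j) D (inl (inr j))) = inr (inl i).
    by rewrite /= ffunE /= [j == i]eq_sym (negPf ij) eqxx.
  have e2 : across (hook_diagram i j) D (inr (inl i)) = inr a by [].
  case ea: a nai naj => [l'|b] ai aj.
    apply: (@starts_loopN _ _ _ _ _ _ 3); rewrite /iter e1 e2 ea.
    have -> : glue (inr (inl l') : strand_end n n t) = inl (inr l') by [].
    by rewrite stop // -(inj_eq (@inl_inj _ 'I_t)) ?ai ?aj.
  by apply: (@starts_loopN _ _ _ _ _ _ 2); rewrite /iter e1 e2 ea.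
by apply: (@starts_loopN _ _ _ _ _ _ 1); rewrite /iter stop.
Qed.

Lemma stack_hook_open : stack (hook_diagram i j) D =
  Diagram [ffun x => hook_mates x] [ffun x => hook_words x] (loops D).
Proof.
have w0 l : (l == i) || (l == j) -> walk (hook_diagram i j) D (inl l) = (out (hook_mates (inl l)), [::]).
  move=> h; rewrite /walk; apply: (@iter_stop _ _ 0); rewrite // ?walk_out //=.
    by rewrite !ffunE /=; case/orP: h => /eqP ->; rewrite ?hook_mates1 ?hook_mates2 /= ?eqxx // [j == i]eq_sym (negPf ij).
  by case/orP: h => /eqP ->; rewrite ?hook_mates1 ?hook_mates2.
have W x : walk (hook_diagram i j) D x = (out (hook_mates x), hook_words x).
  have [->|xi] := eqVneq x (inl i); first by rewrite w0 ?eqxx // /hook_words eqxx.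
  have [->|xj] := eqVneq x (inl j); first by rewrite w0 ?eqxx ?orbT // /hook_words eqxx orbT.
  exact: walk_hook.
apply: eq_diagram => [x|x|] /=.
- by rewrite !ffunE /stack_mate W /=; case: (hook_mates x).
- by rewrite !ffunE W.
- by rewrite new_loops_open cats0.
Qed.
End Open.

Section Closed.
Hypothesis cl : mate D (inl i) = inl j.
Hypothesis lt_ij : (i < j)%N.

(** The loop is recorded at its leftmost middle node, which is i because i < j; from there the
    circuit crosses the bare hook to j and reads the arc of [D] from j. *)
Lemma new_loops_closed : new_loops (hook_diagram i j) D = [:: word D (inl j)].
Proof.
have cj : mate D (inl j) = inl i by rewrite -cl invD.
set f := fun e => glue (across (hook_diagram i j) D e).
have f1 : f (inl (inr i)) = inr (inl j) by rewrite /f /= ffunE /= eqxx.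
have f2 : f (inr (inl j)) = inl (inr i) by rewrite /f /= cj.
have f3 : f (inl (inr j)) = inr (inl i).
  by rewrite /f /= ffunE /= [j == i]eq_sym (negPf ij) eqxx.
have orb : circuit (hook_diagram i j) D i = [:: inl (inr i); inr (inl j)].
  have cyc : fcycle f [:: inl (inr i); inr (inl j)] by rewrite /= f1 f2 !eqxx.
  rewrite /circuit -/f /orbit (order_cycle cyc) ?inE ?eqxx //=.
  by rewrite f1.
have si : starts_loop (hook_diagram i j) D i.
  by rewrite /starts_loop orb /= leqnn (ltnW lt_ij).
have sN l : l != i -> starts_loop (hook_diagram i j) D l = false.
  move=> li; have [->|lj] := eqVneq l j; last first.
    by apply: (@starts_loopN _ _ _ _ _ _ 1); rewrite /= ffunE /= (negPf li) (negPf lj).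
  apply/negP => /allP /(_ (inr (inl i))).
  have -> : inr (inl i) \in circuit (hook_diagram i j) D j.
    by rewrite /circuit -fconnect_orbit -/f -f3; apply: fconnect1.
  by move=> /(_ isT); rewrite leqNgt lt_ij.
rewrite /new_loops.
have -> : [seq l <- enum 'I_n | starts_loop (hook_diagram i j) D l] = [:: i].
  rewrite (eq_filter (a2 := pred1 i)) ?filter_pred1_uniq ?enum_uniq ?mem_enum //.
  by move=> l /=; have [->|/sN] := eqVneq l i.
by rewrite /= orb /= ffunE cats0.
Qed.

Lemma stack_hook_closed : stack (hook_diagram i j) D =
  Diagram (mate D) [ffun x => if (x == inl i) || (x == inl j) then [::] else word D x]
    (rcons (loops D) (word D (inl j))).
Proof.
have cj : mate D (inl j) = inl i by rewrite -cl invD.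
have W x : walk (hook_diagram i j) D x = (out (mate D x), if (x == inl i) || (x == inl j) then [::] else word D x).
  have [->|xi] := eqVneq x (inl i).
    rewrite cl; apply: (@iter_stop _ _ 0); rewrite // ?walk_out //=.
    by rewrite !ffunE /= eqxx.
  have [->|xj] := eqVneq x (inl j).
    rewrite cj; apply: (@iter_stop _ _ 0); rewrite // ?walk_out //=.
    by rewrite !ffunE /= [j == i]eq_sym (negPf ij) eqxx.
  have mi : mate D x != inl i by rewrite mate_swap cl.
  have mj : mate D x != inl j by rewrite mate_swap cj.
  rewrite /walk; case: x xi xj mi mj => [l|b] xi xj mi mj.
    rewrite /= !ffunE /= (negPf (_ : l != i)) // (negPf (_ : l != j)) //.
    rewrite -[X in iter X](prednK (leq_ltn_trans (leq0n _) (ltn_ord i))) iterSr.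
    rewrite {2}/walk_step /=; apply: hook_tail => //.
    have : (2 <= n)%N by apply: (@uniq_ord_size n [:: l; i]); rewrite /= inE andbT.
    by case: (mate D _) => //= _; clear; case: n => [|[]].
  apply: hook_tail => //; case: (mate D _) => //= l; exact: leq_ltn_trans (ltn_ord l).
apply: eq_diagram => [x|x|] /=.
- by rewrite !ffunE /stack_mate W /=; case: (mate D x).
- by rewrite !ffunE W.
- by rewrite new_loops_closed cats1.
Qed.
End Closed.

End StackHook.

Lemma hook_diagramC n (i j : 'I_n) : hook_diagram i j = hook_diagram j i.
Proof.
apply: eq_diagram => [[x|x]|x|] //=; rewrite !ffunE //=;
by case: eqVneq => [->|]; case: eqVneq => // ->.
Qed.

Lemma word_mate n t (D : diagram n t) x : valid D -> word D (mate D x) = rev (word D x).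
Proof. by case. Qed.
Lemma mateK n t (D : diagram n t) : valid D -> involutive (mate D).
Proof. by case. Qed.
Lemma mate_nofix n t (D : diagram n t) x : valid D -> mate D x != x.
Proof. by case. Qed.

Lemma word_eq_mate n t (D : diagram n t) x y :
  valid D -> mate D x = y -> word D y = rev (word D x).
Proof. by move=> vD <-; apply: word_mate. Qed.

Lemma valid_vert n t u (D : diagram n t) : valid D ->
  (forall l, rev (u l) = u l) -> valid (stack (vert u) D).
Proof.
move=> vD ru; rewrite stack_vert //; split => [x|x|x] /=.
- exact: mateK.
- exact: mate_nofix.
- have rt y : rev (top_deco u y : seq blob) = top_deco (t := t) u y.
    by case: y => //= l.
  by rewrite !ffunE mateK // word_mate // !rev_cat !rt catA.
Qed.

Lemma valid_hook_open n t i j (D : diagram n t) : valid D -> i != j ->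
  mate D (inl i) != inl j -> valid (stack (hook_diagram i j) D).
Proof.
move=> vD ij nl; rewrite stack_hook_open //; split => [x|x|x] /=; rewrite !ffunE.
- exact: hook_matesK.
- exact: hook_mates_nofix.
set a := mate D (inl i); set c := mate D (inl j).
have [|nx] := boolP (x \in [:: inl i; inl j; a; c]); last first.
  rewrite hook_matesN //.
  have := mate_notin vD nx; move: nx.
  rewrite !inE !negb_or /hook_words => /and4P[/negPf-> /negPf-> /negPf-> /negPf->].
  by move=> /and4P[/negPf-> /negPf-> /negPf-> /negPf->]; rewrite word_mate.
have nij : (inl i == inl j :> node n t) = false by rewrite (inj_eq inl_inj) (negPf ij).
have nji : (inl j == inl i :> node n t) = false by rewrite eq_sym nij.
have nca : (c == a) = false by apply: negPf; apply: mate_neq; rewrite // nji.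
have nac : (a == c) = false by rewrite eq_sym nca.
have nai : (a == inl i) = false by apply: negPf (mate_nofix _ _).
have ncj : (c == inl j) = false by apply: negPf (mate_nofix _ _).
have naj : (a == inl j) = false by apply: negPf.
have nci : (c == inl i) = false by rewrite mate_swap // eq_sym naj.
rewrite !inE => /or4P[] /eqP ->.
- by rewrite hook_mates1 // /hook_words !eqxx ?nij ?nji.
- by rewrite hook_mates2 // /hook_words !eqxx ?nij ?nji.
- rewrite hook_mates3 // /hook_words -/a -/c !eqxx ?nca ?nac ?nai ?naj ?nci ?ncj /=.
  by rewrite rev_cat -!word_mate // /c /a mateK.
- rewrite hook_mates4 // /hook_words -/a -/c !eqxx ?nca ?nac ?nai ?naj ?nci ?ncj /=.
  by rewrite rev_cat -!word_mate // /c /a mateK.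
Qed.

Lemma valid_hook_closed n t (i j : 'I_n) (D : diagram n t) : valid D -> (i < j)%N ->
  mate D (inl i) = inl j -> valid (stack (hook_diagram i j) D).
Proof.
move=> vD lt_ij cl; have ij : i != j by rewrite neq_ltn lt_ij.
rewrite stack_hook_closed //; split => [x|x|x] /=.
- exact: mateK.
- exact: mate_nofix.
have cj : mate D (inl j) = inl i by rewrite -cl mateK.
rewrite !ffunE word_mate // !mate_swap // cl cj orbC.
by case: ifP.
Qed.

Definition at_node n p (x : blob) (l : 'I_n) : seq blob :=
  if l == p :> nat then [:: x] else [::].

Lemma left_vert n : left_diagram n = vert (@at_node n 0 L).
Proof. by apply: eq_diagram => [x|[x|x]|]; rewrite /= ?ffunE. Qed.
Lemma right_vert n : right_diagram n = vert (@at_node n n.-1 R).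
Proof. by apply: eq_diagram => [x|[x|x]|]; rewrite /= ?ffunE. Qed.
Lemma id_vert n : id_diagram n = vert (fun _ => [::]).
Proof. by apply: eq_diagram => [x|[x|x]|]; rewrite /= ?ffunE. Qed.

Lemma rev_at_node n p x (l : 'I_n) : rev (at_node p x l) = at_node p x l.
Proof. by rewrite /at_node; case: ifP. Qed.

Lemma valid_stack_generator n t g (D : diagram n t) :
  generator g -> valid D -> valid (stack g D).
Proof.
case=> [|i j ji|] vD.
- by rewrite left_vert; apply: valid_vert => // l; apply: rev_at_node.
- have lt_ij : (i < j)%N by rewrite ji.
  have ij : i != j by rewrite neq_ltn lt_ij.
  have [cl|nl] := eqVneq (mate D (inl i)) (inl j); first exact: valid_hook_closed.
  exact: valid_hook_open.
- by rewrite right_vert; apply: valid_vert => // l; apply: rev_at_node.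
Qed.

Lemma valid_id n : valid (id_diagram n).
Proof.
split=> [[x|x]|[x|x]|[x|x]]; rewrite /= ?ffunE //= ?ffunE //.
Qed.

Lemma stack_id n t (D : diagram n t) : valid D -> stack (id_diagram n) D = D.
Proof.
move=> vD; rewrite id_vert stack_vert //; apply: eq_diagram => //= x.
by rewrite ffunE /top_deco; case: x => [l|l]; case: (mate D _) => *; rewrite cats0.
Qed.

Lemma obtained_valid n (D : diagram n n) : obtained D -> valid D.
Proof.
by elim=> [|g d gg _ vd]; [apply: valid_id | apply: valid_stack_generator].
Qed.

(** * Sliding a bare pair of nodes past the end of another string *)

Section Slide.
Variables (n t : nat) (i j l : 'I_n) (D : diagram n t).
Hypotheses (vD : valid D) (Dij : mate D (inl i) = inl j) (wi : word D (inl i) = [::]).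
Hypotheses (li : l != i) (lj : l != j).

Let ij : i != j.
Proof. by have := mate_nofix (inl i) vD; rewrite Dij (inj_eq inl_inj) eq_sym. Qed.
Let Dji : mate D (inl j) = inl i. Proof. by rewrite -Dij mateK. Qed.
Let wj : word D (inl j) = [::]. Proof. by rewrite (word_eq_mate vD Dij) wi. Qed.
Let jl : j != l. Proof. by rewrite eq_sym. Qed.
Let nl : mate D (inl j) != inl l. Proof. by rewrite Dji (inj_eq inl_inj) eq_sym. Qed.

Lemma slide_mate x : mate (stack (hook_diagram j l) D) x =
  if x == inl j then inl l else if x == inl l then inl j
  else if x == inl i then mate D (inl l) else if x == mate D (inl l) then inl i
  else mate D x.
Proof. by rewrite stack_hook_open //= ffunE /hook_mates Dji. Qed.

Lemma slide_word x : word (stack (hook_diagram j l) D) x =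
  if (x == inl j) || (x == inl l) then [::] else if x == inl i then word D (inl l)
  else word D x.
Proof.
rewrite stack_hook_open //= ffunE /hook_words Dji wj cats0.
by case: ifP => // _; case: eqVneq => [->|_]; rewrite ?wi // if_same.
Qed.

Lemma slide_loops : loops (stack (hook_diagram j l) D) = loops D.
Proof. by rewrite stack_hook_open. Qed.

Lemma valid_slide : valid (stack (hook_diagram j l) D).
Proof. exact: valid_hook_open. Qed.

(** The hook {j, l} carries the bare pair from {i, j} to {j, l} and the end at l to i; the hook {i,
    j} undoes this. The identity serves three times: for the relations between neighbouring hooks,
    for the reduction of a half-diagram to the standard one, and for moving the last line. *)
Lemma slide_back : stack (hook_diagram i j) (stack (hook_diagram j l) D) = D.
Proof.
set D' := stack (hook_diagram j l) D.
have vD' : valid D' := valid_slide.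
have nij : (inl i == inl j :> node n t) = false by rewrite (inj_eq inl_inj) (negPf ij).
have nil : (inl i == inl l :> node n t) = false by rewrite (inj_eq inl_inj) eq_sym (negPf li).
have nlj : (inl l == inl j :> node n t) = false by rewrite (inj_eq inl_inj) (negPf lj).
have D'i : mate D' (inl i) = mate D (inl l) by rewrite slide_mate nij nil eqxx.
have D'j : mate D' (inl j) = inl l by rewrite slide_mate eqxx.
have open : mate D' (inl i) != inl j by rewrite D'i mate_swap // Dji (inj_eq inl_inj).
rewrite stack_hook_open //; apply: eq_diagram; rewrite ?slide_loops //= => x; rewrite ffunE.
  rewrite /hook_mates D'i D'j.
  have [->|xi] := eqVneq x (inl i); first by rewrite Dij.
  have [->|xj] := eqVneq x (inl j); first by rewrite Dji.
  have [->|xa] := eqVneq x (mate D (inl l)); first by rewrite mateK.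
  have [->|xl] := eqVneq x (inl l); first by [].
  by rewrite slide_mate (negPf xi) (negPf xj) (negPf xl) (negPf xa).
have wD'j : word D' (inl j) = [::] by rewrite slide_word eqxx.
have wD'i : word D' (inl i) = word D (inl l) by rewrite slide_word nij nil eqxx.
rewrite /hook_words D'i D'j wD'i wD'j !cats0 !slide_word.
have [->|xi] := eqVneq x (inl i); first by rewrite wi.
have [->|xj] := eqVneq x (inl j); first by rewrite wj.
rewrite /=.
have [->|xl] := eqVneq x (inl l); last by rewrite if_same.
by rewrite [inl l == _]eq_sym (negPf (mate_nofix _ _)).
Qed.
End Slide.

(** * Reduced words, reduced diagrams and straightening *)

Lemma reduced_word_infix (v w : seq blob) : infix v w -> reduced_word w -> reduced_word v.
Proof.
move=> vw /allP h; apply/allP => r /h; apply: contraNN => rv.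
exact: infix_trans rv vw.
Qed.

Lemma reduced_wordP (w : seq blob) :
  reduced_word w = (w \in [:: [::]; [:: L]; [:: R]; [:: L; R]; [:: R; L]]).
Proof.
case: w => [|[] [|[] [|[] w]]] //=; apply/negbTE/negP => /allP h.
all: by [case/negP: (h [:: L; L] isT); rewrite /= ?prefix0s ?orbT
        | case/negP: (h [:: R; R] isT); rewrite /= ?prefix0s ?orbT
        | case/negP: (h [:: L; R; L] isT); rewrite /= prefix0s
        | case/negP: (h [:: R; L; R] isT); rewrite /= prefix0s].
Qed.

Arguments straighten_word : simpl never.

Section Straight.
Variables (k : fieldType) (P : blob_scalars k).

Lemma straighten_reduced w : reduced_word w -> straighten_word P w = (1, w).
Proof. by rewrite reduced_wordP !inE => /or4P[|||/orP[]] /eqP ->. Qed.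

Lemma straighten_wordE x w :
  straighten_word P (x :: w) = push P x (straighten_word P w).
Proof. by []. Qed.

(** Every rule of [push] keeps the pushed letter in front. Hence a wrong first blob at a bottom node
    survives straightening. *)
Lemma straighten_head w : ohead (straighten_word P w).2 = ohead w.
Proof.
case: w => // x w; rewrite straighten_wordE.
by case: (straighten_word P w) => c [|[] [|[] v]]; case: x.
Qed.
End Straight.

Lemma LR_arcsP n t (D : diagram n t) : reflect
  [/\ no_propagating D,
      exists p : 'I_n * 'I_n, [&& (p.1 < p.2)%N, mate D (inl p.1) == inl p.2
                            & perm_eq (word D (inl p.1)) [:: L; R]] &
      exists p : 'I_t * 'I_t, [&& (p.1 < p.2)%N, mate D (inr p.1) == inr p.2
                            & perm_eq (word D (inr p.1)) [:: L; R]]]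
  (LR_arcs D != None).
Proof.
rewrite /LR_arcs /top_LR /bottom_LR; apply: (iffP idP).
  case: ifP => // np; case: pickP => // p hp; case: pickP => // p' hp' _.
  by split; [|exists p|exists p'].
case=> np [p hp] [p' hp']; rewrite np.
case: pickP => [q _|/(_ p)]; last by rewrite hp.
by case: pickP => [q' _|/(_ p')]; last by rewrite hp'.
Qed.

Lemma reduced_short n t (D : diagram n t) :
  loops D = [::] -> (forall x, (size (word D x) <= 1)%N) -> reduced D.
Proof.
move=> l0 sw; rewrite /reduced l0 eqxx /=; apply/andP; split.
  by apply/forallP => x; have := sw x; case: (word D x) => [|[] []].
rewrite -[_ == _]negbK; apply/negP => /LR_arcsP[_ [p /and3P[_ _ /perm_size]]].
by have := sw (inl p.1) => /[swap] ->.
Qed.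

Section Straight.
Variables (k : fieldType) (P : blob_scalars k).

Lemma straighten_loops n t (D : diagram n t) ls : reduced D ->
  straighten P (Diagram (mate D) (word D) ls) = (\prod_(w <- ls) loop_value P w, D).
Proof.
case/and3P => /eqP l0 /forallP rw /eqP lr.
have e : straighten_strings P (Diagram (mate D) (word D) ls) = (\prod_(w <- ls) loop_value P w, D).
  rewrite /straighten_strings /= [X in _ * X]big1 => [|x _]; last by rewrite straighten_reduced.
  rewrite mulr1; congr pair; apply: eq_diagram => //= x.
  by rewrite ffunE straighten_reduced.
by rewrite /straighten e lr.
Qed.

Lemma straighten_id n t (D : diagram n t) : reduced D -> straighten P D = (1, D).
Proof.
move=> rD; have l0 : loops D = [::] by case/and3P: rD => /eqP.
have := straighten_loops [::] rD; rewrite big_nil => <-.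
by congr straighten; apply: eq_diagram.
Qed.

End Straight.

(** A reduced word has at most two letters, so one that already contains both blobs cannot be
    prolonged. *)
Lemma LR_cat (v w : seq blob) : reduced_word (v ++ w) -> perm_eq v [:: L; R] ->
  perm_eq (v ++ w) [:: L; R].
Proof.
move=> rw pv; suff -> : w = [::] by rewrite cats0.
have sv := perm_size pv.
have : (size (v ++ w) <= 2)%N by move: rw; rewrite reduced_wordP !inE => /or4P[|||/orP[]] /eqP ->.
by rewrite size_cat sv; case: w {rw}.
Qed.

Lemma LR_cat' (v w : seq blob) : reduced_word (v ++ w) -> perm_eq w [:: L; R] ->
  perm_eq (v ++ w) [:: L; R].
Proof.
move=> rw pv; suff -> : v = [::] by [].
have sv := perm_size pv.
have : (size (v ++ w) <= 2)%N by move: rw; rewrite reduced_wordP !inE => /or4P[|||/orP[]] /eqP ->.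
by rewrite size_cat sv addnC; case: v {rw}.
Qed.

Lemma top_LR_exists n t (D : diagram n t) (x y : 'I_n) : valid D ->
  mate D (inl x) = inl y -> perm_eq (word D (inl x)) [:: L; R] ->
  exists p : 'I_n * 'I_n, [&& (p.1 < p.2)%N, mate D (inl p.1) == inl p.2
                            & perm_eq (word D (inl p.1)) [:: L; R]].
Proof.
move=> vD mx px.
have : x != y by apply/eqP => e; have := mate_nofix (inl x) vD; rewrite mx e eqxx.
rewrite neq_ltn => /orP[lt|lt]; [exists (x, y) | exists (y, x)]; rewrite /= lt /=.
  by rewrite mx eqxx px.
by rewrite -mx mateK // eqxx word_mate //= perm_rev.
Qed.

Lemma LR_stack_vert n t u (D : diagram n t) : valid D ->
  (forall l, rev (u l) = u l) -> reduced (stack (vert u) D) -> LR_arcs D == None.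
Proof.
move=> vD ru /and3P[_ /forallP rw /eqP lr]; rewrite -[_ == _]negbK; apply/negP => /LR_arcsP [np [p hp] [p' hp']].
suff : LR_arcs (stack (vert u) D) != None by rewrite lr.
case/and3P: hp hp' => lt1 /eqP m1 w1 /and3P[lt2 /eqP m2 w2].
have rp := rw (inl p.1).
rewrite stack_vert // in rp *; apply/LR_arcsP; split => //.
  exists p; rewrite lt1 /= m1 eqxx ffunE /=; rewrite /= ffunE /= in rp.
  rewrite m1 catA in rp *; apply: LR_cat => //; apply: LR_cat' => //.
  exact: reduced_word_infix (prefix_infix _ _) rp.
by exists p'; rewrite lt2 /= m2 eqxx ffunE /= m2 cats0.
Qed.

(** If the topological relation applied to [D], it would apply to the stack: the decorated top arc
    either survives or becomes part of the joined arc, which by reducedness carries nothing else,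
    and the bottom arc is untouched. *)
Lemma LR_stack_hook n t (i j : 'I_n) (D : diagram n t) : valid D -> i != j ->
  mate D (inl i) != inl j ->
  reduced (stack (hook_diagram i j) D) -> LR_arcs D == None.
Proof.
move=> vD ij nl /and3P[_ /forallP rw /eqP lr]; rewrite -[_ == _]negbK; apply/negP => /LR_arcsP [np [p hp] [p' hp']].
suff : LR_arcs (stack (hook_diagram i j) D) != None by rewrite lr.
case/and3P: hp hp' => lt1 /eqP m1 w1 /and3P[lt2 /eqP m2 w2].
have /andP[/forallP npt /forallP npb] := np.
have vS := valid_hook_open vD ij nl.
have [a ea] : exists a, mate D (inl i) = inl a by have := npt i; case: (mate D _) => // z _; exists z.
have [c ec] : exists c, mate D (inl j) = inl c by have := npt j; case: (mate D _) => // z _; exists z.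
have wa : word D (inl a) = rev (word D (inl i)) by exact: word_eq_mate.
have wc : word D (inl c) = rev (word D (inl j)) by exact: word_eq_mate.
have nai : a != i by have := mate_nofix (inl i) vD; rewrite ea.
have ncj : c != j by have := mate_nofix (inl j) vD; rewrite ec.
have naj : a != j by move: nl; rewrite ea.
have nci : c != i by apply: contraNneq naj => e; rewrite -(inj_eq (@inl_inj _ 'I_t)) -ea -e -ec mateK.
have nca : c != a.
  have := mate_neq vD (x := inl j) (y := inl i); rewrite ea ec (inj_eq inl_inj) eq_sym ij.
  by move/(_ isT).
have rwa := rw (inl a).
rewrite stack_hook_open // in lr vS rwa *.
rewrite /= ffunE /hook_words ea ec eqxx (inj_eq inl_inj) (negPf nai) (inj_eq inl_inj) (negPf naj) /= in rwa.
apply/LR_arcsP; split.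
- apply/andP; split; apply/forallP => x; rewrite /= ffunE /hook_mates ea ec.
    by do 4![case: ifP => //]; have := npt x.
  by have := npb x.
- have key x y : mate D (inl x) = inl y -> perm_eq (word D (inl x)) [:: L; R] ->
     (x == i) || (x == a) || (x == j) || (x == c) ->
     perm_eq (word D (inl a) ++ word D (inl j)) [:: L; R].
    move=> mx px h; have : perm_eq (word D (inl a)) [:: L; R] || perm_eq (word D (inl j)) [:: L; R].
      case/orP: h => [/orP[/orP[]|]|] /eqP e; move: px; rewrite e.
      - by rewrite wa perm_rev => ->.
      - by move=> ->.
      - by move=> ->; rewrite orbT.
      - by rewrite wc perm_rev => ->; rewrite orbT.
    by case/orP => h'; [apply: LR_cat | apply: LR_cat'].
  have [h|] := boolP ((p.1 == i) || (p.1 == a) || (p.1 == j) || (p.1 == c)).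
    have pk := key _ _ m1 w1 h.
    apply: (top_LR_exists (x := a) (y := c)) => //=.
      by rewrite ffunE /hook_mates ea ec eqxx !(inj_eq inl_inj) (negPf nai) (negPf naj).
    by rewrite ffunE /hook_words ea ec eqxx !(inj_eq inl_inj) (negPf nai) (negPf naj).
  rewrite !negb_or => /andP[/andP[/andP[h1 h2] h3] h4].
  exists p; rewrite lt1 /= !ffunE /hook_mates /hook_words ea ec !(inj_eq inl_inj).
  by rewrite (negPf h1) (negPf h2) (negPf h3) (negPf h4) m1 eqxx.
- exists p'; rewrite lt2 /= !ffunE.
  by rewrite /hook_mates /hook_words ea ec /= m2 eqxx.
Qed.

(** Whatever can be straightened in [D] leaves something to straighten in the stack. Hence a reduced
    diagram obtained from generators is built through reduced diagrams only, and in [A] it is a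
    product of generators with no scalar. *)
Lemma reduced_stack_inv n t g (D : diagram n t) : generator g -> valid D ->
  reduced (stack g D) -> reduced D.
Proof.
move=> gg vD; have vert_case p x : reduced (stack (vert (@at_node n p x)) D) -> reduced D.
  move=> rS; have lr := LR_stack_vert vD (rev_at_node p x) rS.
  case/and3P: rS; rewrite stack_vert //= => l0 /forallP rw _.
  rewrite /reduced l0 lr andbT /=; apply/forallP => y; have := rw y.
  by rewrite ffunE; apply: reduced_word_infix; rewrite infix_infix.
case: g / gg => [|i j ji|]; [by rewrite left_vert; apply: vert_case | | by rewrite right_vert; apply: vert_case].
have lt_ij : (i < j)%N by rewrite ji.
have ij : i != j by rewrite neq_ltn lt_ij.
have [cl|nl] := eqVneq (mate D (inl i)) (inl j).
  by rewrite stack_hook_closed // /reduced /=; case: (loops D).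
move=> rS; have lr := LR_stack_hook vD ij nl rS.
case/and3P: rS; rewrite stack_hook_open //= => l0 /forallP rw _.
rewrite /reduced l0 lr andbT /=; apply/forallP => y.
set a := mate D (inl i); set c := mate D (inl j).
have nai : (a == inl i) = false by apply: negPf (mate_nofix _ _).
have naj : (a == inl j) = false by apply: negPf.
have ra : reduced_word (word D a ++ word D (inl j)).
  by have := rw a; rewrite ffunE /hook_words -/a -/c nai naj eqxx.
have ra1 := reduced_word_infix (prefix_infix _ _) ra.
have ra2 := reduced_word_infix (suffix_infix _ _) ra.
have rr w : reduced_word w -> reduced_word (rev w) by rewrite !reduced_wordP !inE => /or4P[|||/orP[]] /eqP ->.
have [->|yi] := eqVneq y (inl i); first by rewrite -(mateK vD (inl i)) word_mate // rr.
have [->|yj] := eqVneq y (inl j); first by [].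
have [->|ya] := eqVneq y a; first by [].
have [->|yc] := eqVneq y c; first by rewrite /c word_mate // rr.
by have := rw y; rewrite ffunE /hook_words -/a -/c (negPf yi) (negPf yj) (negPf ya) (negPf yc).
Qed.

(** * The algebra in terms of reduced diagrams *)

Definition basic n (D : diagram n n) : bool := reduced D && `[< obtained D >].

Lemma dia_exists n t (D : diagram n t) : reduced D ->
  exists x : small_diagram n t, dia x = D.
Proof.
move=> rD; case/and3P: (rD) => /eqP l0 /forallP rw _.
have sz y : (size (word D y) <= 2)%N.
  by have := rw y; rewrite reduced_wordP !inE => /or4P[|||/orP[]] /eqP ->.
exists (mate D, [ffun y => Bseq (sz y)]).
by apply: eq_diagram => //= y; rewrite !ffunE.
Qed.

Lemma basic_exists n (D : diagram n n) : basic D ->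
  exists x : basis_diagram n, bdia x = D.
Proof.
move=> bD; have [rD _] := andP bD; have [y ey] := dia_exists rD.
have hy : reduced (dia y) && `[< obtained (dia y) >] by rewrite ey.
by exists (exist _ y hy).
Qed.

Lemma dia_inj n t : injective (@dia n t).
Proof.
move=> [f w] [f' w'] /(congr1 (fun D => (mate D, word D))) [-> /ffunP e].
by congr pair; apply/ffunP => x; apply: val_inj; have := e x; rewrite !ffunE.
Qed.

Lemma bdia_inj n : injective (@bdia n).
Proof. by move=> x y /dia_inj /val_inj. Qed.

Lemma bdia_basic n (x : basis_diagram n) : basic (bdia x).
Proof. exact: (valP x). Qed.

Lemma basic_valid n (D : diagram n n) : basic D -> valid D.
Proof. by case/andP => _ /asboolP /obtained_valid. Qed.

Lemma basic_stack n g (D : diagram n n) : generator g -> basic D ->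
  reduced (stack g D) -> basic (stack g D).
Proof.
move=> gg /andP[_ /asboolP oD] rS; rewrite /basic rS; apply/asboolP.
exact: obtained_stack.
Qed.

Lemma basic_id n : basic (id_diagram n).
Proof.
rewrite /basic reduced_short //=; first by apply/asboolP; constructor.
by move=> x; rewrite ffunE.
Qed.

Lemma generator_stack_id n (g : diagram n n) : generator g ->
  stack g (id_diagram n) = g.
Proof.
have vert_case u : stack (vert u) (id_diagram n) = vert u.
  rewrite stack_vert ?id_vert; last by rewrite -id_vert; apply: valid_id.
  by apply: eq_diagram => //= -[x|x]; rewrite !ffunE /= ?cats0.
case=> [|i j ji|]; [by rewrite left_vert vert_case | | by rewrite right_vert vert_case].
have lt_ij : (i < j)%N by rewrite ji.
have ij : i != j by rewrite neq_ltn lt_ij.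
rewrite stack_hook_open ?ffunE //; last exact: valid_id.
apply: eq_diagram => //= x; rewrite !ffunE; last first.
  by rewrite /hook_words !ffunE; do !case: ifP.
rewrite /hook_mates !ffunE /=; case: x => x; rewrite /= ?(inj_eq inl_inj) ?(inj_eq inr_inj).
  by case: eqVneq => // _; case: eqVneq.
by [].
Qed.

Lemma generator_short n (g : diagram n n) : generator g ->
  loops g = [::] /\ forall x, (size (word g x) <= 1)%N.
Proof. by case=> [|i j ji|]; split => //= x; rewrite ffunE //; case: ifP. Qed.

Lemma generator_basic n (g : diagram n n) : generator g -> basic g.
Proof.
move=> gg; rewrite -(generator_stack_id gg); apply: basic_stack => //; first exact: basic_id.
by rewrite generator_stack_id //; have [] := generator_short gg; apply: reduced_short.
Qed.

Section Algebra.
Variables (k : fieldType) (P : blob_scalars k) (n : nat) (A : falgType k)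
  (b : basis_diagram n -> A).
Hypothesis A_blob : symplectic_blob_algebra P b.

(** Defined on all diagrams, with value 0 outside the basis, so that membership need not be carried
    along in formulas. *)
Definition elt (D : diagram n n) : A := \sum_(x : basis_diagram n | bdia x == D) b x.

Lemma elt_bdia x : elt (bdia x) = b x.
Proof. by rewrite /elt (eq_bigl (pred1 x)) ?big_pred1_eq // => y; rewrite (inj_eq (@bdia_inj n)). Qed.

Lemma elt_mul D D' : basic D -> basic D' ->
  elt D * elt D' = (straighten P (stack D D')).1 *: elt (straighten P (stack D D')).2.
Proof.
move=> /basic_exists[x <-] /basic_exists[y <-]; rewrite !elt_bdia.
by have := A_blob.2 x y; case: (straighten _ _) => c e ->.
Qed.

Lemma elt_stack g D : generator g -> basic D -> reduced (stack g D) ->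
  elt g * elt D = elt (stack g D).
Proof.
move=> gg bD rS; rewrite elt_mul //; last exact: generator_basic.
by rewrite straighten_id // scale1r.
Qed.

Definition cf (d : basis_diagram n) (a : A) : k := coord (codom_tuple b) (enum_rank d) a.

Lemma cf_sum a : a = \sum_d cf d a *: b d.
Proof.
have bas : basis_of fullv (codom_tuple b) by exact: A_blob.1.
rewrite {1}(coord_basis bas (memvf a)) (reindex (@enum_rank _)) /=; last first.
  by exists enum_val => x _; rewrite ?enum_rankK ?enum_valK.
by apply: eq_bigr => d _; rewrite (nth_codom _ b) enum_rankK.
Qed.

Lemma cf_b d d' : cf d (b d') = (d == d')%:R.
Proof.
have fr : free (codom_tuple b) by case/andP: A_blob.1.
have <- : (codom_tuple b)`_(enum_rank d') = b d' by rewrite (nth_codom _ b) enum_rankK.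
by rewrite /cf coord_free // (inj_eq enum_rank_inj) eq_sym.
Qed.

(** The unit of [A] is not given in terms of the basis; but the identity diagram is a left unit on
    each basis element, hence on the expansion of 1. *)
Lemma elt_id : elt (id_diagram n) = 1.
Proof.
rewrite -[LHS]mulr1 [X in _ * X]cf_sum mulr_sumr [RHS]cf_sum; apply: eq_bigr => d _.
rewrite -scalerAr -elt_bdia; congr (_ *: _).
have bd := bdia_basic d.
rewrite elt_mul ?basic_id // stack_id; last exact: basic_valid.
by rewrite straighten_id ?scale1r //; case/andP: bd.
Qed.

(** Induction on the way a reduced diagram is obtained; [reduced_stack_inv] keeps the intermediate
    diagrams in the basis. *)
Lemma basis_ind (Q : A -> Prop) : Q 1 ->
  (forall g a, generator g -> Q a -> Q (elt g * a)) ->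
  (forall D, basic D -> Q (elt D)).
Proof.
move=> Q1 Qg D /andP[rD /asboolP oD].
elim: oD rD => [|g d gg od IH] rS; first by rewrite elt_id.
have vd := obtained_valid od.
have rd := reduced_stack_inv gg vd rS.
by rewrite -elt_stack //; [apply/Qg/IH | rewrite /basic rd; apply/asboolP].
Qed.

Lemma central_gen z : (forall g, generator g -> z * elt g = elt g * z) ->
  forall a, z * a = a * z.
Proof.
move=> zg a; rewrite [a]cf_sum mulr_sumr mulr_suml; apply: eq_bigr => d _.
rewrite -scalerAr -scalerAl; congr (_ *: _); rewrite -elt_bdia.
apply: (basis_ind (Q := fun a => z * a = a * z)) (bdia_basic d) => [|g c gg IH].
  by rewrite mulr1 mul1r.
by rewrite mulrA zg // -!mulrA IH.
Qed.
End Algebra.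

(** * A central element in terms of generators and relations *)

(* [lincomb] proves an identity of linear combinations in a module by comparing
   the coefficients of the atoms, which it leaves as goals for [ring] or [field]. *)
Section LinearCombinations.
Variables (k : fieldType) (V : lmodType k).

Inductive lin_expr :=
| LinAtom of nat | LinZero | LinAdd of lin_expr & lin_expr
| LinOpp of lin_expr | LinScale of k & lin_expr.

Fixpoint lin_eval (s : seq V) (e : lin_expr) : V :=
  match e with
  | LinAtom i => s`_i | LinZero => 0
  | LinAdd e f => lin_eval s e + lin_eval s f
  | LinOpp e => - lin_eval s e
  | LinScale a e => a *: lin_eval s e
  end.

Fixpoint lin_coef (i : nat) (e : lin_expr) : k :=
  match e with
  | LinAtom j => if PeanoNat.Nat.eqb i j then 1 else 0 | LinZero => 0
  | LinAdd e f => lin_coef i e + lin_coef i f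
  | LinOpp e => - lin_coef i e
  | LinScale a e => a * lin_coef i e
  end.

Lemma lin_evalE s e : lin_eval s e = \sum_(i < size s) lin_coef i e *: s`_i.
Proof.
elim: e => [j||e1 IH1 e2 IH2|e IH|a e IH] /=.
- have [lt|ge] := ltnP j (size s).
    rewrite (bigD1 (Ordinal lt)) //= PeanoNat.Nat.eqb_refl scale1r big1 ?addr0 // => i ne.
    case: PeanoNat.Nat.eqb_spec => [e|_]; last by rewrite scale0r.
    by case/eqP: ne; apply: val_inj.
  rewrite nth_default // big1 // => i _.
  case: PeanoNat.Nat.eqb_spec => [e|_]; last by rewrite scale0r.
  by have := ltn_ord i; rewrite e ltnNge ge.
- by rewrite big1 // => i _; rewrite scale0r.
- by rewrite IH1 IH2 -big_split; apply: eq_bigr => i _; rewrite scalerDl.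
- by rewrite IH -sumrN; apply: eq_bigr => i _; rewrite scaleNr.
- by rewrite IH scaler_sumr; apply: eq_bigr => i _; rewrite scalerA.
Qed.

Fixpoint all_below (m : nat) (Q : nat -> Prop) : Prop :=
  match m with 0%N => True | m'.+1 => Q m' /\ all_below m' Q end.

(** A sufficient criterion only: the atoms may be linearly dependent. *)
Lemma lin_eval_eq s e f :
  all_below (size s) (fun i => lin_coef i e = lin_coef i f) ->
  lin_eval s e = lin_eval s f.
Proof.
move=> H; rewrite !lin_evalE; apply: eq_bigr => -[i /= lt] _; congr (_ *: _).
by elim: (size s) lt H => //= m IH; rewrite ltnS leq_eqVlt => /orP[/eqP->[]|/IH h [_ /h]].
Qed.
End LinearCombinations.

Ltac lin_index x s :=
  match s with
  | ?y :: _ => let _ := constr:(erefl x : x = y) in constr:(0%N)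
  | _ :: ?s' => let i := lin_index x s' in constr:(S i)
  end.
Ltac lin_mem x s :=
  match s with
  | ?y :: _ => let _ := constr:(erefl x : x = y) in constr:(true)
  | _ :: ?s' => lin_mem x s'
  | _ => constr:(false)
  end.
Ltac lin_atoms s t :=
  match t with
  | (?x + ?y)%R => let s' := lin_atoms s x in lin_atoms s' y
  | (- ?x)%R => lin_atoms s x
  | (_ *: ?x)%R => lin_atoms s x
  | 0%R => s
  | ?x => match lin_mem x s with true => s | false => constr:(x :: s) end
  end.
Ltac lin_reify k s t :=
  match t with
  | (?x + ?y)%R => let x' := lin_reify k s x in let y' := lin_reify k s y in
                   constr:(@LinAdd k x' y')
  | (- ?x)%R => let x' := lin_reify k s x in constr:(@LinOpp k x')
  | (?a *: ?x)%R => let x' := lin_reify k s x in constr:(@LinScale k a x')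
  | 0%R => constr:(@LinZero k)
  | ?x => let i := lin_index x s in constr:(@LinAtom k i)
  end.
Ltac lincomb k V :=
  match goal with
  | |- ?l = ?r =>
    let s0 := lin_atoms (@nil V) l in
    let s := lin_atoms s0 r in
    let l' := lin_reify k s l in
    let r' := lin_reify k s r in
    change (@lin_eval k V s l' = @lin_eval k V s r');
    apply: lin_eval_eq; cbn [all_below size lin_coef PeanoNat.Nat.eqb];
    repeat match goal with |- _ /\ _ => split end; try exact: Logic.I
  end.

Ltac noncomm :=
  do 3?[progress rewrite ?(mulrDl, mulrDr, mulNr, mulrN, mul1r, mulr1) -?scalerAl -?scalerAr -?mulrA].

Section Comm.
Variables (k : fieldType) (A : algType k).
Implicit Types x y : A.
Definition comm x y := x * y = y * x.
Lemma commC x y : comm x y -> comm y x. Proof. by []. Qed.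
Lemma commD x y z : comm x z -> comm y z -> comm (x + y) z.
Proof. by rewrite /comm mulrDl mulrDr => -> ->. Qed.
Lemma commN x z : comm x z -> comm (- x) z.
Proof. by rewrite /comm mulNr mulrN => ->. Qed.
Lemma commZ a x z : comm x z -> comm (a *: x) z.
Proof. by rewrite /comm -scalerAl -scalerAr => ->. Qed.
Lemma commM x y z : comm x z -> comm y z -> comm (x * y) z.
Proof. by move=> cx cy; rewrite /comm -mulrA cy mulrA cx mulrA. Qed.
Lemma comm1 z : comm 1 z. Proof. by rewrite /comm mul1r mulr1. Qed.
End Comm.

(** * Windings, closed strings and the central element *)

Section CentralElement.
Variables (k : fieldType) (A : algType k) (E : nat -> A) (n : nat) (q dL dR : k).
Hypotheses (n_gt0 : (0 < n)%N) (q0 : q != 0) (q2 : q ^+ 2 != 1).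
Hypothesis EE : forall i, (0 < i < n)%N -> E i * E i = (q + q^-1) *: E i.
Hypothesis E0E0 : E 0%N * E 0%N = dL *: E 0%N.
Hypothesis EnEn : E n * E n = dR *: E n.
Hypothesis Eup : forall i, (0 < i)%N -> (i.+1 < n)%N -> E i * E i.+1 * E i = E i.
Hypothesis Edown : forall i, (0 < i)%N -> (i.+1 < n)%N -> E i.+1 * E i * E i.+1 = E i.+1.
Hypothesis E101 : (1 < n)%N -> E 1%N * E 0%N * E 1%N = E 1%N.
Hypothesis EnEnEn : (1 < n)%N -> E n.-1 * E n * E n.-1 = E n.-1.
Hypothesis EC : forall i j, (i.+1 < j <= n)%N -> comm (E i) (E j).

(* Up to a scalar, T i is the crossing of the strings i and i+1, K winds the last
   string around the right wall, and Y i winds string i around the right wall. *)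
Let T i := E i - q *: 1.
(** The ratio u : v is forced by the reflection equation, that is, by [T n.-1 * K * T n.-1]
    commuting with [E n]. For the blob parameters the eigenvalues of [K] for [E n] = 0 and for [E n]
    = [dR] are, up to a common factor, Q2^-1 and Q2. *)
Let u := q ^+ 2 * dR - q.
Let v := 1 - q ^+ 2.
(** Value of a closed string around the right wall alone: [E n.-1 * K * E n.-1 = c0 *: E n.-1] for n
    > 1. *)
Let c0 := u * (q + q^-1) + v.
Let K := u *: 1 + v *: E n.

Fixpoint winding (l : nat) : A :=
  if l is l'.+1 then T (n - l) * winding l' * T (n - l) else K.
Definition Y i := winding (n - i).

Lemma Yn : Y n = K. Proof. by rewrite /Y subnn. Qed.
Lemma YS i : (0 < i < n)%N -> Y i = T i * Y i.+1 * T i.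
Proof.
move=> /andP[_ lt]; rewrite /Y -(subnSK lt) /= (subnSK lt) subKn //; exact: ltnW.
Qed.

(** The closed string around the strings i, ..., n and the right wall, with its crossings resolved;
    it arises in [E_Y_E] as a partial closure of a winding. *)
Definition Psum i : A := c0 *: 1 + (q ^+ 3 - q) *: \sum_(i <= j < n.+1) Y j.
Lemma Pn1 : Psum n.+1 = c0 *: 1.
Proof. by rewrite /Psum big_geq // scaler0 addr0. Qed.
Lemma PS i : (i <= n)%N -> Psum i = Psum i.+1 + (q ^+ 3 - q) *: Y i.
Proof. by move=> le; rewrite /Psum big_ltn // scalerDr -addrA [X in _ + X]addrC. Qed.

Lemma down_ind (Q : nat -> Prop) : Q n ->
  (forall i, (0 < i < n)%N -> Q i.+1 -> Q i) -> forall i, (0 < i <= n)%N -> Q i.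
Proof.
move=> Qn Qs i /andP[i0 le]; rewrite -(subKn le).
have : (n - i < n)%N by lia.
elim: (n - i)%N => [|l IH] lt; first by rewrite subn0.
by apply: Qs; [lia | rewrite subnSK; [apply: IH; lia | lia]].
Qed.

Lemma comm_T i x : comm (E i) x -> comm (T i) x.
Proof. by move=> c; apply: (commD c); apply/commN/commZ/comm1. Qed.

Lemma Y_E_lt i j : (0 < i <= n)%N -> (j.+1 < i)%N -> comm (Y i) (E j).
Proof.
move=> hi; move: i hi j; apply: down_ind => [j lt|i hi IH j lt].
  rewrite Yn; apply: commD; first exact/commZ/comm1.
  by apply/commZ/commC/EC; rewrite lt leqnn.
have cT : comm (T i) (E j) by apply/comm_T/commC/EC; lia.
by rewrite YS //; apply: (commM _ cT); apply: (commM cT); apply: IH; lia.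
Qed.

Lemma P_E_lt i j : (0 < i <= n.+1)%N -> (j.+1 < i)%N -> comm (Psum i) (E j).
Proof.
move=> hi lt; apply: commD; first exact/commZ/comm1.
apply: commZ; rewrite big_nat_cond.
elim/big_rec: _ => [|l x hl cx]; first by rewrite /comm mul0r mulr0.
by apply: (commD _ cx); apply: Y_E_lt; lia.
Qed.

(** The two arcs close string i + 1 of the winding into a loop around the strings beyond it. In the
    inductive step the expansion of [T] produces q^2 (q + q^-1) - 2 q = q^3 - q, the coefficient in
    [Psum]. *)
Lemma E_Y_E i : (0 < i < n)%N -> E i * Y i.+1 * E i = E i * Psum i.+2.
Proof.
suff : forall j, (0 < j <= n)%N -> (1 < j)%N -> E j.-1 * Y j * E j.-1 = E j.-1 * Psum j.+1.
  by move=> H hi; apply: (H i.+1); lia.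
apply: down_ind => [n1|{}i hi IH i1].
  rewrite Yn Pn1 /K; noncomm.
  rewrite EE; last by lia.
  have e : E n.-1 * (E n * E n.-1) = E n.-1 by rewrite mulrA EnEnEn //; lia.
  by rewrite e; lincomb k A; rewrite /c0; ring.
have cP : comm (Psum i.+2) (E i.-1) by apply: P_E_lt; lia.
have cY : comm (Y i.+1) (E i.-1) by apply: Y_E_lt; lia.
have {}IH : E i * Y i.+1 * E i = E i * Psum i.+2 by apply: IH; lia.
have efe : E i.-1 * E i * E i.-1 = E i.-1 by have := @Eup i.-1; rewrite prednK; last lia; apply; lia.
have ee : E i.-1 * E i.-1 = (q + q^-1) *: E i.-1 by apply: EE; lia.
rewrite YS // PS; last by lia.
have t1 : E i.-1 * (E i * (Y i.+1 * (E i * E i.-1))) = E i.-1 * Psum i.+2.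
  by rewrite (mulrA (Y _)) (mulrA (E i)) (mulrA (E i)) IH -mulrA cP !mulrA efe.
have t2 : E i.-1 * (E i * (Y i.+1 * E i.-1)) = E i.-1 * Y i.+1.
  by rewrite cY !mulrA efe.
have t3 : E i.-1 * (Y i.+1 * (E i * E i.-1)) = E i.-1 * Y i.+1.
  by rewrite mulrA -cY -!mulrA (mulrA (E i.-1)) efe cY.
have t4 : E i.-1 * (Y i.+1 * E i.-1) = (q + q^-1) *: (E i.-1 * Y i.+1).
  by rewrite cY mulrA ee scalerAl.
move: (Psum i.+2) t1 => P2 t1.
rewrite /T; noncomm; rewrite t1 t2 t3 t4.
by lincomb k A; field.
Qed.

(** An arc is carried along through a string that crosses both of its ends. *)
Lemma T_braid i : (0 < i)%N -> (i.+1 < n)%N -> E i.+1 * (T i * T i.+1) = T i * T i.+1 * E i.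
Proof.
move=> i0 lt; rewrite /T; noncomm.
rewrite !EE; try lia.
have e1 : E i.+1 * (E i * E i.+1) = E i.+1 by rewrite mulrA Edown.
have e2 : E i * (E i.+1 * E i) = E i by rewrite mulrA Eup.
by rewrite e1 e2; lincomb k A; field.
Qed.

Lemma T_braid' i : (0 < i)%N -> (i.+1 < n)%N -> E i * (T i.+1 * T i) = T i.+1 * T i * E i.+1.
Proof.
move=> i0 lt; rewrite /T; noncomm.
rewrite !EE; try lia.
have e1 : E i.+1 * (E i * E i.+1) = E i.+1 by rewrite mulrA Edown.
have e2 : E i * (E i.+1 * E i) = E i by rewrite mulrA Eup.
by rewrite e1 e2; lincomb k A; field.
Qed.

(** Three cases: for j > i + 1 the outer crossings commute with [E j]; for j = i + 1 < n the arc
    passes through the crossings by the braid relations and then meets [Y i.+2]; for j = i + 1 = n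
    this is the reflection equation, which rests on the values of u and v. *)
Lemma Y_E_gt i j : (0 < i < j)%N -> (j <= n)%N -> comm (Y i) (E j).
Proof.
move=> /andP[i0 lt_ij] le_jn; have : (0 < i <= n)%N by lia.
move: i i0 lt_ij => {}i i0 lt_ij hi; move: i hi i0 lt_ij.
apply: (down_ind (Q := fun i => (0 < i)%N -> (i < j)%N -> comm (Y i) (E j))) => [|i hi IH i0 lt_ij].
  by lia.
have [lt|] := ltnP i.+1 j.
  have cT : comm (T i) (E j) by apply/comm_T/EC; lia.
  by rewrite YS //; apply: (commM _ cT); apply: (commM cT); apply: IH; lia.
move=> le; have {le lt_ij IH} ej : j = i.+1 by lia.
rewrite {j}ej in le_jn *.
have [lt|ge] := ltnP i.+1 n.
  rewrite YS // YS; last by lia.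
  have cY : comm (Y i.+2) (E i) by apply: Y_E_lt; lia.
  rewrite /comm.
  have -> : T i * (T i.+1 * Y i.+2 * T i.+1) * T i * E i.+1
           = T i * T i.+1 * Y i.+2 * (T i.+1 * T i * E i.+1) by rewrite !mulrA.
  have -> : E i.+1 * (T i * (T i.+1 * Y i.+2 * T i.+1) * T i)
           = E i.+1 * (T i * T i.+1) * Y i.+2 * (T i.+1 * T i) by rewrite !mulrA.
  by rewrite -T_braid' // T_braid // !mulrA -(mulrA _ (Y _) (E i)) cY !mulrA.
have en : i.+1 = n by lia.
rewrite YS // en Yn; have -> : i = n.-1 by lia.
have n1 : (1 < n)%N by lia.
have efe : E n.-1 * (E n * E n.-1) = E n.-1 by rewrite mulrA EnEnEn.
have efe' : E n.-1 * (E n * (E n.-1 * E n)) = E n.-1 * E n by rewrite !mulrA EnEnEn.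
have ee : E n.-1 * E n.-1 = (q + q^-1) *: E n.-1 by apply: EE; lia.
have ee' : E n.-1 * (E n.-1 * E n) = (q + q^-1) *: (E n.-1 * E n) by rewrite mulrA ee scalerAl.
have ff' : E n * (E n * E n.-1) = dR *: (E n * E n.-1) by rewrite mulrA EnEn scalerAl.
have fe : E n * (E n.-1 * (E n * E n.-1)) = E n * E n.-1 by rewrite efe.
rewrite /comm /T /K; noncomm.
rewrite efe efe' ?ee ?ee' EnEn ?ff' -?scalerAr.
by lincomb k A; rewrite /u /v; field.
Qed.

(** As [T i] has the eigenvalues -q and q^-1, its square is 1 - (q - q^-1) [T i]; hence T y T + y
    commutes with T for every y. *)
Lemma YY_E i : (0 < i < n)%N -> comm (Y i + Y i.+1) (E i).
Proof.
move=> hi; have ee := EE hi; rewrite YS //.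
have ee' x : E i * (E i * x) = (q + q^-1) *: (E i * x) by rewrite mulrA ee scalerAl.
rewrite /comm /T; move: (Y _) => Y'; noncomm.
by rewrite !ee' !ee -!scalerAr; lincomb k A; field.
Qed.

(** For j < n the terms of the sum commute with [E j] one by one, except [Y j] and [Y j.+1], which
    do so together. *)
Lemma P_E_ge i j : (0 < i <= j)%N -> (j <= n)%N -> comm (Psum i) (E j).
Proof.
move=> /andP[i0 le_ij] le_jn; have hi : (0 < i <= n)%N by lia.
move: i hi {i0} j le_ij le_jn; apply: down_ind => [|i hi IH] j le_ij le_jn.
  have -> : j = n by lia.
  rewrite PS // Pn1 Yn /K; apply: commD; first exact/commZ/comm1.
  by apply/commZ/commD; apply: commZ => //; apply: comm1.
have [lt|ge] := ltnP i j.
  by rewrite PS; [apply: commD; [apply: IH; lia | apply: commZ; apply: Y_E_gt; lia] | lia].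
have -> : j = i by lia.
rewrite (PS (i := i)); last lia.
rewrite (PS (i := i.+1)); last lia.
rewrite -addrA -scalerDr; apply: commD; first by apply: P_E_lt; lia.
by apply: commZ; rewrite addrC; apply: YY_E.
Qed.

(* The closed string which encircles the whole diagram and both walls, with its
   crossings resolved. *)
Definition central : A :=
  (q ^+ 3 - q)^-1 *: (((dL - q) *: 1 + (q ^+ 2 - 1) *: E 0%N) * Psum 2)
  + dL *: Y 1 - E 0%N * Y 1 - Y 1 * E 0%N.

Let q3 : q ^+ 3 - q != 0.
Proof. by rewrite (_ : _ - _ = q * (q ^+ 2 - 1)) ?mulf_neq0 ?subr_eq0 //; ring. Qed.

(** For every y, dL y - E 0 y - y E 0 commutes with [E 0], because the square of [E 0] is dL times
    [E 0]. *)
Lemma central_E0 : comm central (E 0%N).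
Proof.
have cP : comm (Psum 2) (E 0%N) by apply: P_E_lt; lia.
have ck : comm ((dL - q) *: 1 + (q ^+ 2 - 1) *: E 0%N) (E 0%N).
  by apply: commD; apply: commZ => //; apply: comm1.
rewrite /central -!addrA; apply: commD; first exact/commZ/(commM ck).
have aa x : E 0%N * (E 0%N * x) = dL *: (E 0%N * x) by rewrite mulrA E0E0 scalerAl.
rewrite /comm; noncomm; rewrite E0E0 aa -scalerAr.
by lincomb k A; ring.
Qed.

(** Here the two parts of [central] compensate each other: in terms of [E 0], [E 1], [Y 2] and
    [Psum 3], with [Y 1] and [Psum 2] expanded, the listed relations bring both sides to a normal
    form with equal coefficients. *)
Lemma central_E1 : (1 < n)%N -> comm central (E 1%N).
Proof.
move=> n1.
have cYa : Y 2 * E 0%N = E 0%N * Y 2 by apply: Y_E_lt; lia.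
have cPa : Psum 3 * E 0%N = E 0%N * Psum 3 by apply: P_E_lt; lia.
have cPe : Psum 3 * E 1%N = E 1%N * Psum 3 by apply: P_E_lt; lia.
have eYe : E 1%N * Y 2 * E 1%N = E 1%N * Psum 3 by apply: E_Y_E; lia.
have ee : E 1%N * E 1%N = (q + q^-1) *: E 1%N by apply: EE; lia.
have eae : E 1%N * E 0%N * E 1%N = E 1%N by exact: E101.
rewrite /central PS // (YS (i := 1)) // /T.
move: (E 0%N) (E 1%N) (Y 2) (Psum 3) cYa cPa cPe eYe ee eae => a e y p cYa cPa cPe eYe ee eae.
have Y1E : (e - q *: 1) * y * (e - q *: 1) = e * p - q *: (e * y) - q *: (y * e) + q ^+ 2 *: y.
  by noncomm; rewrite (mulrA e y) eYe; lincomb k A; ring.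
have ee' x : e * (e * x) = (q + q^-1) *: (e * x) by rewrite mulrA ee scalerAl.
have eae' x : e * (a * (e * x)) = e * x by rewrite !mulrA eae.
have eYe' x : e * (y * (e * x)) = e * (p * x) by rewrite !mulrA eYe.
have cYa' x : y * (a * x) = a * (y * x) by rewrite !mulrA cYa.
have cPa' x : p * (a * x) = a * (p * x) by rewrite !mulrA cPa.
have cPe' x : p * (e * x) = e * (p * x) by rewrite !mulrA cPe.
have eae2 : e * (a * e) = e by rewrite mulrA.
have eYe2 : e * (y * e) = e * p by rewrite mulrA.
rewrite Y1E /comm; noncomm.
rewrite ?(ee', eae', eYe', cYa', cPa', cPe', ee, eae2, eYe2, cYa, cPa, cPe) -?scalerAr.
rewrite ?(ee', eae', eYe', cYa', cPa', cPe', ee, eae2, eYe2, cYa, cPa, cPe) -?scalerAr.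
by lincomb k A; field; rewrite ?q0 ?q3.
Qed.

Lemma central_E_ge j : (1 < j <= n)%N -> comm central (E j).
Proof.
move=> hj.
have cE : comm (E 0%N) (E j) by apply: EC; lia.
have cY : comm (Y 1) (E j) by apply: Y_E_gt; lia.
rewrite /central -!addrA; apply: commD.
  apply/commZ/commM; last by apply: P_E_ge; lia.
  by apply: commD; apply: commZ; [apply: comm1|].
apply: commD; first exact: commZ.
by apply: commD; apply/commN/commM.
Qed.

(** With one string [E 1] is the right blob, and only the two blobs occur; the mixed terms cancel by
    the same equation between u and v as in the reflection equation. *)
Lemma central_E1_1 : n = 1%N -> comm central (E 1%N).
Proof.
move=> n1.
have P2 : Psum 2 = c0 *: 1 by rewrite -Pn1 n1.
have Y1 : Y 1 = K by rewrite -Yn n1.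
have E1 : E 1%N = E n by rewrite n1.
rewrite /central P2 Y1 E1 /K.
have ff x : E n * (E n * x) = dR *: (E n * x) by rewrite mulrA EnEn scalerAl.
rewrite /comm; noncomm; rewrite ?ff ?EnEn -?scalerAr.
by lincomb k A; rewrite /c0 /u /v; field; rewrite ?q0 ?q3.
Qed.

Lemma central_E j : (j <= n)%N -> comm central (E j).
Proof.
case: j => [_|[le|j le]]; [exact: central_E0 | | exact: central_E_ge].
have [lt|ge] := ltnP 1 n; first exact: central_E1.
by apply: central_E1_1; lia.
Qed.

Lemma TTE i : (0 < i)%N -> (i.+1 < n)%N ->
  T i.+1 * (T i * E i.+1) = - q *: (E i * E i.+1).
Proof.
move=> i0 lt; have e1 := Edown i0 lt.
have ee : E i.+1 * E i.+1 = (q + q^-1) *: E i.+1 by apply: EE; lia.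
rewrite /T; noncomm; rewrite (mulrA (E i.+1)) e1 ee.
by lincomb k A; field.
Qed.

Lemma TTE' i : (0 < i)%N -> (i.+1 < n)%N ->
  T i * (T i.+1 * E i) = - q *: (E i.+1 * E i).
Proof.
move=> i0 lt; have e1 := Eup i0 lt.
have ee : E i * E i = (q + q^-1) *: E i by apply: EE; lia.
rewrite /T; noncomm; rewrite (mulrA (E i)) e1 ee.
by lincomb k A; field.
Qed.

(** String i passes the arc twice, on its way to the wall and back; each time two crossings are
    traded for a factor -q. *)
Lemma Y_E_up i : (0 < i)%N -> (i.+1 < n)%N ->
  Y i * E i.+1 = q ^+ 2 *: (E i.+1 * (Y i.+2 * (E i * E i.+1))).
Proof.
move=> i0 lt; have cY : Y i.+2 * E i = E i * Y i.+2 by apply: Y_E_lt; lia.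
rewrite YS; last lia.
rewrite YS; last lia.
have h x : T i * (T i.+1 * (E i * x)) = - q *: (E i.+1 * (E i * x)).
  by have := congr1 (fun z => z * x) (TTE' i0 lt); rewrite -scalerAl -!mulrA.
rewrite -!mulrA TTE // -!scalerAr (mulrA (Y _) (E i)) cY -mulrA h.
by rewrite scalerA mulrNN.
Qed.

(** Pulling the closed string off an arc costs a factor q^2. *)
Lemma P_E_up i : (0 < i < n)%N -> Psum i * E i = q ^+ 2 *: (E i * Psum i.+2).
Proof.
move=> hi; have ee := EE hi; have eYe := E_Y_E hi.
have cP : Psum i.+2 * E i = E i * Psum i.+2 by apply: P_E_lt; lia.
rewrite (PS (i := i)); last lia.
rewrite (PS (i := i.+1)); last lia.
rewrite (YS (i := i)) // /T.
move: (E i) (Y i.+1) (Psum i.+2) ee eYe cP => e y p ee eYe cP.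
noncomm; rewrite !ee -?scalerAr (mulrA e y e) eYe cP.
by lincomb k A; field; rewrite ?q0.
Qed.

(** * Evaluation of the central element on a chain of vectors *)

Section Eigenvalue.
Variables (N : A -> Prop) (V : nat -> A) (m p : nat) (rho lam : k).
Hypothesis n_mp : n = (m + p.*2).+1.
Hypotheses (N0 : N 0) (ND : forall x y, N x -> N y -> N (x + y))
  (NZ : forall a x, N x -> N (a *: x))
  (NE : forall j x, (j <= n)%N -> N x -> N (E j * x)).
Hypothesis V_next : forall l, (l < p)%N -> V l.+1 = E (n.-1 - l.*2) * V l.
Hypothesis V_prev : forall l, (l < p)%N -> V l = E (n.-2 - l.*2) * V l.+1.
Hypothesis En_V : N (E n * V 0%N - rho *: V 0%N).
Hypothesis E0_V : N (E 0%N * V p - lam *: V p).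
Hypothesis Ei_V : forall i, (0 < i <= m)%N -> N (E i * V p).

(** Congruence modulo [N], the counterpart of the degenerate diagrams. [V l] stands for the
    half-diagram whose last line is at string n - 2 l, with l arcs to its right. *)
Let cg x y := N (x - y).
Let cg_refl x : cg x x. Proof. by rewrite /cg subrr. Qed.
Let cg_trans x y z : cg x y -> cg y z -> cg x z.
Proof. by move=> xy /(ND xy); rewrite addrA subrK. Qed.
Let cgD x y x' y' : cg x y -> cg x' y' -> cg (x + x') (y + y').
Proof. by move=> h h'; rewrite /cg opprD addrACA; apply: ND. Qed.
Let cgZ a x y : cg x y -> cg (a *: x) (a *: y).
Proof. by move=> h; rewrite /cg -scalerBr; apply: NZ. Qed.
Let cgN x y : cg x y -> cg (- x) (- y).
Proof. by rewrite -!scaleN1r; apply: cgZ. Qed.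
Let cgE j x y : (j <= n)%N -> cg x y -> cg (E j * x) (E j * y).
Proof. by move=> hj h; rewrite /cg -mulrBr; apply: NE. Qed.
Let cgT j x y : (j <= n)%N -> cg x y -> cg (T j * x) (T j * y).
Proof.
move=> hj h; rewrite /T !mulrBl -!scalerAl !mul1r.
by apply: cgD (cgE hj h) (cgN (cgZ _ h)).
Qed.
Let cgY i x y : (0 < i <= n)%N -> cg x y -> cg (Y i * x) (Y i * y).
Proof.
move=> hi; move: i hi x y; apply: down_ind => [x y h|i hi IH x y h].
  rewrite Yn /K !mulrDl -!scalerAl !mul1r.
  by apply: cgD (cgZ _ h) (cgZ _ (cgE _ h)).
have le : (i <= n)%N by lia.
by rewrite YS // -!mulrA; apply: (cgT le); apply: IH; apply: cgT.
Qed.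

Let kR := u + v * rho.

(** The last line reaches the right wall after passing the l arcs on its right, each of which
    contributes q^2 by [Y_E_up]; [kR] is the value of [K] on it. *)
Lemma Y_V l : (l <= p)%N -> cg (Y (n - l.*2) * V l) ((q ^+ l.*2 * kR) *: V l).
Proof.
elim: l => [_|l IH lt].
  rewrite subn0 Yn /K mulrDl -!scalerAl mul1r expr0 mul1r /kR scalerDl -scalerA.
  by apply: cgD (cg_refl _) (cgZ _ En_V).
set i := (n - l.+1.*2)%N.
have i0 : (0 < i)%N by rewrite /i; lia.
have in_ : (i.+1 < n)%N by rewrite /i; lia.
have e2 : (n - l.*2 = i.+2)%N by rewrite /i; lia.
have e1 : (n.-1 - l.*2 = i.+1)%N by rewrite /i; lia.
have e0 : (n.-2 - l.*2 = i)%N by rewrite /i; lia.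
have Vn := V_next lt; have Vp := V_prev lt; rewrite e1 in Vn; rewrite e0 in Vp.
have -> : Y i * V l.+1 = q ^+ 2 *: (E i.+1 * (Y i.+2 * V l)).
  by rewrite Vn mulrA Y_E_up // -scalerAl -!mulrA -Vn -Vp.
have {}IH := IH (ltnW lt); rewrite e2 in IH.
have -> : (q ^+ l.+1.*2 * kR) *: V l.+1 = q ^+ 2 *: (E i.+1 * ((q ^+ l.*2 * kR) *: V l)).
  by rewrite Vn -scalerAr scalerA doubleS !exprS expr0; congr (_ *: _); ring.
by apply: cgZ; apply: cgE IH; lia.
Qed.

(** This closed string surrounds only arcs and the wall, so it is pulled off exactly and not just
    modulo [N]. *)
Lemma P_V l : (l <= p)%N -> Psum (n.+1 - l.*2) * V l = (q ^+ l.*2 * c0) *: V l.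
Proof.
elim: l => [_|l IH lt].
  by rewrite subn0 Pn1 -scalerAl mul1r expr0 mul1r.
have e1 : (n.-1 - l.*2 = n.+1 - l.+1.*2)%N by lia.
have e2 : ((n.+1 - l.+1.*2).+2 = n.+1 - l.*2)%N by lia.
rewrite V_next // mulrA e1 P_E_up; last by lia.
rewrite -scalerAl -mulrA e2 IH; last by lia.
by rewrite -scalerAr scalerA doubleS !exprS expr0 mulr1 !mulrA.
Qed.

(** Between two lines [E i] vanishes modulo [N], so that [T i] acts as -q; each of the r lines on
    the way is crossed twice. *)
Lemma Y_Vp r : (r <= m)%N -> cg (Y (m.+1 - r) * V p) ((q ^+ r.*2 * (q ^+ p.*2 * kR)) *: V p).
Proof.
elim: r => [_|r IH lt].
  rewrite subn0 expr0 mul1r; have -> : m.+1 = (n - p.*2)%N by lia.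
  exact: Y_V.
have TV : cg (T (m - r) * V p) (- q *: V p).
  rewrite /T mulrBl -scalerAl mul1r /cg scaleNr opprK subrK; apply: Ei_V; lia.
have e : (m.+1 - r = (m - r).+1)%N by lia.
have {}IH := IH (ltnW lt); rewrite e in IH.
have -> : q ^+ r.+1.*2 * (q ^+ p.*2 * kR) = q * q * (q ^+ r.*2 * (q ^+ p.*2 * kR)).
  by rewrite doubleS !exprS; ring.
move: (q ^+ r.*2 * _) IH => z IH.
rewrite subSS YS; last by lia.
rewrite -!mulrA.
have le1 : (m - r <= n)%N by lia.
have le2 : (0 < (m - r).+1 <= n)%N by lia.
apply: cg_trans (cgT le1 (cgY le2 TV)) _.
rewrite -!scalerAr; apply: cg_trans (cgZ _ (cgT le1 IH)) _.
rewrite -scalerAr; apply: cg_trans (cgZ _ (cgZ _ TV)) _.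
rewrite !scalerA (_ : - q * z * - q = q * q * z); last by ring.
by rewrite mulrA; apply: cg_refl.
Qed.

(** The windings of the r last lines contribute a geometric progression of ratio q^2; as q^3 - q = q
    (q^2 - 1), it sums to the factor q (q^2r - 1). *)
Lemma P_Vp r : (r <= m)%N ->
  cg (Psum (m.+2 - r) * V p) ((q ^+ p.*2 * (c0 + q * kR * (q ^+ r.*2 - 1))) *: V p).
Proof.
elim: r => [_|r IH lt].
  rewrite subn0 expr0 subrr mulr0 addr0; have -> : m.+2 = (n.+1 - p.*2)%N by lia.
  by rewrite P_V.
rewrite subSS PS; last by lia.
have e : ((m.+1 - r).+1 = m.+2 - r)%N by lia.
have -> : q ^+ p.*2 * (c0 + q * kR * (q ^+ r.+1.*2 - 1)) =
  q ^+ p.*2 * (c0 + q * kR * (q ^+ r.*2 - 1)) + (q ^+ 3 - q) * (q ^+ r.*2 * (q ^+ p.*2 * kR)).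
  by rewrite doubleS !exprS; ring.
rewrite mulrDl -scalerAl e.
apply: cg_trans (cgD (IH (ltnW lt)) (cgZ _ (Y_Vp (ltnW lt)))) _.
by rewrite scalerA -scalerDl.
Qed.

Definition eigenvalue_formula : k :=
  (q ^+ 3 - q)^-1 * (dL - q + (q ^+ 2 - 1) * lam) *
    (q ^+ p.*2 * (c0 + q * kR * (q ^+ m.*2 - 1)))
  + (dL - lam *+ 2) * (q ^+ m.*2 * (q ^+ p.*2 * kR)).

Lemma central_V : N (central * V p - eigenvalue_formula *: V p).
Proof.
have P2 := P_Vp (leqnn m); have Y1 := Y_Vp (leqnn m).
rewrite subSnn in Y1; rewrite (_ : m.+2 - m = 2)%N in P2; last by lia.
set g := q ^+ _ * _ in P2; set y := q ^+ _ * _ in Y1.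
have E0' : cg (E 0%N * V p) (lam *: V p) by [].
apply: (@cg_trans _ ((q ^+ 3 - q)^-1 *: (g *: ((dL - q) *: V p + (q ^+ 2 - 1) *: (lam *: V p)))
   + dL *: (y *: V p) - y *: (lam *: V p) - lam *: (y *: V p))); last first.
  rewrite (_ : eigenvalue_formula *: V p = (q ^+ 3 - q)^-1 *: (g *: ((dL - q) *: V p + (q ^+ 2 - 1) *: (lam *: V p)))
   + dL *: (y *: V p) - y *: (lam *: V p) - lam *: (y *: V p)) //.
  by lincomb k A; rewrite /eigenvalue_formula -/g -/y; ring.
rewrite /central !mulrDl !mulNr -!scalerAl; apply: cgD; last first.
  apply: cgN; rewrite -mulrA; apply: cg_trans (cgY _ E0') _; first by lia.
  by rewrite -scalerAr; apply: cgZ.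
apply: cgD; last first.
  apply: cgN; rewrite -mulrA; apply: cg_trans (cgE _ Y1) _ => //.
  by rewrite -scalerAr; apply: cgZ.
apply: cgD; last exact: cgZ.
apply: cgZ; rewrite mulrDl -!scalerAl !mul1r -mulrA.
apply: cg_trans (cgD (cgZ _ P2) (cgZ _ (cgE _ P2))) _ => //.
rewrite -scalerAr scalerDr; apply: cgD.
  by rewrite !scalerA [_ * g]mulrC.
rewrite (_ : g *: _ = (q ^+ 2 - 1) *: (g *: (lam *: V p))); first exact/cgZ/cgZ.
by rewrite !scalerA; congr (_ *: _); ring.
Qed.
End Eigenvalue.
End CentralElement.

(** * Cell modules as subquotients of the algebra *)

(** Serves to transport the circuits, and with them the closed strings and their words, from a stack
    to its completion. *)
Lemma orbit_semiconj (T T' : finType) (h : T -> T') (f : T -> T) (f' : T' -> T') x :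
  injective h -> (forall y, f' (h y) = h (f y)) ->
  orbit f' (h x) = [seq h y | y <- orbit f x].
Proof.
move=> injh hf; have it l y : iter l f' (h y) = h (iter l f y) by elim: l => //= l ->.
have tr l y : traject f' (h y) l = map h (traject f y l).
  by elim: l y => //= l IH y; rewrite hf IH.
suff e : order f' (h x) = order f x by rewrite /orbit e tr.
have -> : order f x = #|[set h y | y in fconnect f x]| by rewrite card_imset.
rewrite /order; apply: eq_card => y; rewrite inE; apply/idP/imsetP => [|[z zx ->]].
  by case/iter_findex/esym => ->; rewrite it; exists (iter (findex f' (h x) y) f x); rewrite ?inE ?fconnect_iter.
by rewrite -(iter_findex zx) -it fconnect_iter.
Qed.

Section Lift.
Variables (n m : nat).
Hypotheses (lt_mn : (m.+1 <= n)%N) (par : ~~ odd (n - m.+1)).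

Definition line_node (j : 'I_m.+1) : 'I_n := widen_ord lt_mn j.
Definition widen_node (x : node n m.+1) : node n n :=
  match x with inl i => inl i | inr j => inr (line_node j) end.
Definition narrow_node (y : node n n) : option (node n m.+1) :=
  match y with inl i => Some (inl i) | inr a => omap inr (insub (val a)) end.

Lemma widen_nodeK : pcancel widen_node narrow_node.
Proof. by case=> //= j; rewrite insubT // => lt; congr (Some (inr _)); apply: val_inj. Qed.
Lemma narrow_nodeK y x : narrow_node y = Some x -> y = widen_node x.
Proof.
case: y => [i [<-]|a] //=; case: insubP => // j _ ej [<-].
by congr inr; apply: val_inj.
Qed.
Lemma widen_node_inj : injective widen_node. Proof. exact: pcan_inj widen_nodeK. Qed.

(** Exchanges s with s + 1, s + 2 with s + 3, and so on; the parity of n - m - 1 keeps the partner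
    of a node beyond m below n. *)
Definition flip (s a : nat) : nat := if odd (a - s) then a.-1 else a.+1.
Definition partner (a : 'I_n) : 'I_n := insubd a (flip m.+1 a).
Lemma val_partner (a : 'I_n) : (m < a)%N -> partner a = flip m.+1 a :> nat.
Proof.
move=> lt; rewrite val_insubd /flip; have := ltn_ord a; move: par.
by case: (boolP (odd (a - m.+1))) => o; case: ifP => //; lia.
Qed.

Lemma narrow_None y : narrow_node y = None -> exists2 a : 'I_n, y = inr a & (m < a)%N.
Proof. by case: y => // a /=; case: insubP => // h _; exists a; rewrite // leqNgt. Qed.
Lemma narrow_gt (a : 'I_n) : (m < a)%N -> narrow_node (inr a) = None.
Proof. by move=> lt /=; rewrite insubF //; apply/negbTE; rewrite -leqNgt. Qed.

Definition extra_mate (y : node n n) : node n n := if y is inr a then inr (partner a) else y.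

(* The completion of [D] by a fixed lower half, with bare arcs {m+1, m+2},
   {m+3, m+4}, ...; it turns the cell module into a subquotient of the algebra. *)
Definition lift_diagram (D : diagram n m.+1) : diagram n n :=
  Diagram [ffun y => if narrow_node y is Some x then widen_node (mate D x) else extra_mate y]
          [ffun y => if narrow_node y is Some x then word D x else [::]]
          (loops D).

Lemma mate_lift D x : mate (lift_diagram D) (widen_node x) = widen_node (mate D x).
Proof. by rewrite ffunE widen_nodeK. Qed.
Lemma word_lift D x : word (lift_diagram D) (widen_node x) = word D x.
Proof. by rewrite ffunE widen_nodeK. Qed.

Lemma lift_inj : injective lift_diagram.
Proof.
move=> D D' e; apply: eq_diagram => [x|x|].
- by apply: widen_node_inj; rewrite -!mate_lift e.
- by rewrite -!word_lift e.
- by move/(congr1 (@loops n n)): e.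
Qed.

Lemma valid_lift D : valid D -> valid (lift_diagram D).
Proof.
move=> vD.
have ext y : narrow_node y = None -> [/\ narrow_node (extra_mate y) = None,
    extra_mate (extra_mate y) = y & extra_mate y != y].
  case/narrow_None => a -> lt; have vp := val_partner lt; have la := ltn_ord a.
  have lt' : (m < partner a)%N by rewrite vp /flip; case: ifP => o; lia.
  split; first exact: narrow_gt.
    congr inr; apply: val_inj; rewrite /= val_partner // vp /flip.
    by case: (boolP (odd (a - m.+1))) => o; case: ifP => o'; lia.
  by rewrite /extra_mate (inj_eq inr_inj) -val_eqE /= vp /flip; case: ifP => o; lia.
split=> y.
- rewrite [mate _ y]ffunE; case e: (narrow_node y) => [x|].
    by rewrite mate_lift mateK // (narrow_nodeK e).
  by have [h1 h2 _] := ext y e; rewrite ffunE h1 h2.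
- rewrite ffunE; case e: (narrow_node y) => [x|].
    by rewrite (narrow_nodeK e) (inj_eq widen_node_inj) mate_nofix.
  by have [_ _ h] := ext y e.
- rewrite [mate _ y]ffunE; case e: (narrow_node y) => [x|].
    by rewrite word_lift (narrow_nodeK e) word_lift word_mate.
  by have [h1 h2 _] := ext y e; rewrite !ffunE h1 e.
Qed.

Section StackLift.
Variables (d : diagram n n) (D : diagram n m.+1).

Definition widen_end (e : strand_end n n m.+1) : strand_end n n n :=
  match e with inl x => inl x | inr y => inr (widen_node y) end.
Lemma widen_end_inj : injective widen_end.
Proof. by case=> x [] y //= [] => [->|/widen_node_inj ->]. Qed.
Lemma across_widen e :
  across d (lift_diagram D) (widen_end e) = widen_end (across d D e).
Proof. by case: e => //= y; rewrite ffunE widen_nodeK. Qed.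
Lemma read_widen e : read d (lift_diagram D) (widen_end e) = read d D e.
Proof. by case: e => //= y; rewrite ffunE widen_nodeK. Qed.
Lemma glue_widen e : glue (widen_end e) = widen_end (glue e).
Proof. by case: e => [[]|[]]. Qed.

Let W (p : strand_end n n m.+1 * seq blob) := (widen_end p.1, p.2).

Lemma walk_widen x : walk d (lift_diagram D) (widen_node x) = W (walk d D x).
Proof.
have ox : @outer_end n n n (widen_node x) = widen_end (@outer_end n n m.+1 x) by case: x.
have st p : walk_step d (lift_diagram D) (W p) = W (walk_step d D p).
  rewrite /walk_step /= glue_widen (inj_eq widen_end_inj).
  by case: ifP => //= _; rewrite across_widen read_widen.
have it l p : iter l (walk_step d (lift_diagram D)) (W p) = W (iter l (walk_step d D) p).
  by elim: l => //= l ->.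
by rewrite /walk ox across_widen read_widen -it.
Qed.

Lemma walk_extra y : narrow_node y = None ->
  walk d (lift_diagram D) y =
  (match extra_mate y with inl i => inl (inl i) | inr j => inr (inr j) end, [::]).
Proof.
move=> ny; have [a ey _] := narrow_None ny; rewrite ey in ny *.
apply: (@iter_stop _ _ 0) => //; last exact: walk_out.
have em : mate (lift_diagram D) (inr a) = extra_mate (inr a) by rewrite ffunE ny.
have ew : word (lift_diagram D) (inr a) = [::] by rewrite ffunE ny.
by rewrite -[LHS]/(inr (mate (lift_diagram D) (inr a)), word (lift_diagram D) (inr a)) em ew.
Qed.

(** The added arcs lie on the bottom row and never reach the middle one, so that stacking on top
    does not meet them. *)
Lemma stack_lift : stack d (lift_diagram D) = lift_diagram (stack d D).
Proof.
apply: eq_diagram => [y|y|] /=.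
- rewrite !ffunE /stack_mate; case e: (narrow_node y) => [x|]; last first.
    by rewrite walk_extra //; have [a -> _] := narrow_None e.
  rewrite (narrow_nodeK e) walk_widen ffunE /stack_mate /=.
  by case: (walk d D x).1 => [[]|[]].
- rewrite !ffunE; case e: (narrow_node y) => [x|]; last by rewrite walk_extra.
  by rewrite (narrow_nodeK e) walk_widen ffunE.
- congr (_ ++ (_ ++ _)).
  have cc j : circuit d (lift_diagram D) j = map widen_end (circuit d D j).
    rewrite /circuit -[inl (inr j)]/(widen_end (inl (inr j))).
    apply: orbit_semiconj => [|e]; first exact: widen_end_inj.
    by rewrite across_widen glue_widen.
  rewrite /new_loops (eq_filter (a2 := starts_loop d D)) => [|j].
    apply: eq_map => j; rewrite cc -map_comp; congr flatten.
    by apply: eq_map => e; apply: read_widen.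
  rewrite /starts_loop cc all_map; apply: eq_all => -[[]|[]] //.
Qed.
End StackLift.

Section StraightenLift.
Variables (k : fieldType) (P : blob_scalars k).

Lemma pos_widen x y : (pos (widen_node x) < pos (widen_node y))%N = (pos x < pos y)%N.
Proof.
case: x y => [x|x] [y|y] //=; have := ltn_ord x; have := ltn_ord y; lia.
Qed.

Lemma straighten_strings_lift S : straighten_strings P (lift_diagram S) =
  ((straighten_strings P S).1, lift_diagram (straighten_strings P S).2).
Proof.
rewrite /straighten_strings; congr pair.
  congr (_ * _); rewrite [LHS](bigID (fun y => narrow_node y != None)) /=.
  rewrite [X in _ * X]big1 ?mulr1 => [|y /andP[_]]; last first.
    by rewrite negbK ffunE => /eqP ->.
  rewrite (reindex_omap widen_node narrow_node) /=; last first.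
    by move=> y /andP[_]; case e: (narrow_node y) => [x|] //= _; rewrite -(narrow_nodeK e).
  apply: eq_big => [x|x _]; last by rewrite word_lift.
  by rewrite mate_lift pos_widen widen_nodeK eqxx !andbT.
apply: eq_diagram => [y|y|] //=; rewrite !ffunE //.
by case: (narrow_node y) => [x|] //; rewrite ffunE.
Qed.

Lemma no_propagating_lift S : no_propagating (lift_diagram S) = no_propagating S.
Proof.
apply/idP/idP => /andP[/forallP h1 /forallP h2]; apply/andP; split; apply/forallP => i.
- by have := h1 i; rewrite ffunE /=; case: (mate S _).
- by have := h2 (line_node i); rewrite -[inr _]/(widen_node (inr i)) mate_lift; case: (mate S _).
- by have := h1 i; rewrite ffunE /=; case: (mate S _).
rewrite ffunE; case e: (narrow_node _) => [[x|x]|] //.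
  by have := narrow_nodeK e.
by have := h2 x; case: (mate S _).
Qed.

Variables (e1 e2 : int).
Hypothesis lab : label n m e1 e2.

(** These two lines would be the only ones, and their decorations would give the excluded label (1,
    -1, -1). *)
Lemma no_LR_lines (w : diagram n m.+1) (j j' : 'I_m.+1) : half_diagram e1 e2 w ->
  (j < j')%N -> (forall b, b != j -> b != j' -> if mate w (inr b) is inl _ then false else true) ->
  word w (inr j) = [:: L] -> word w (inr j') = [:: R] -> False.
Proof.
case/and5P=> _ /forallP ap _ _ /andP[/forallP lw _] lt H wj wj'.
have only b : (b == j) || (b == j').
  rewrite -[_ || _]negbK negb_or; apply/negP => /andP[h1 h2].
  by have := H b h1 h2; have := ap b; case: (mate _ _).
have m1 : m = 1%N.
  have h0 := only ord0; have hm := only ord_max.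
  have : (m <= 1)%N.
    rewrite leqNgt; apply/negP => m2.
    have := only (Ordinal (leqW m2)).
    move: h0 hm; rewrite -!val_eqE /=; lia.
  by have := ltn_ord j'; lia.
have j0 : j = 0%N :> nat by have := ltn_ord j'; lia.
have j1 : j' = 1%N :> nat by have := ltn_ord j'; lia.
have := lw j; have := lw j'; rewrite wj wj' /line_word j0 j1 m1 /= cats0.
have := lab; rewrite /label m1.
case: (e1 == -1) => //=; case: (e2 == -1) => //=.
by rewrite !andbF.
Qed.

Lemma LR_arcs_Some n' t (S : diagram n' t) p : LR_arcs S = Some p ->
  [/\ no_propagating S, (p.2.1 < p.2.2)%N, mate S (inr p.2.1) = inr p.2.2 &
      perm_eq (word S (inr p.2.1)) [:: L; R]].
Proof.
rewrite /LR_arcs; case: ifP => // np; rewrite /top_LR /bottom_LR.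
case: pickP => // q _; case: pickP => // q' /and3P[h1 /eqP h2 h3] [<-].
by [].
Qed.

Lemma LR_arcs_None n' t (S : diagram n' t) : ~~ no_propagating S -> LR_arcs S = None.
Proof. by rewrite /LR_arcs => /negbTE ->. Qed.

Lemma half_propagates (w : diagram n m.+1) : half_diagram e1 e2 w -> ~~ no_propagating w.
Proof.
case/and5P=> _ /forallP ap _ _ _; apply/negP => /andP[_ /forallP /(_ ord0)].
by have := ap ord0; case: (mate _ _).
Qed.

(** The topological relation concerns only diagrams without lines. If it applies, the new lines
    carry L and R, and by [no_LR_lines] the result is no half-diagram of the cell module, before or
    after completion; both sides are then 0. With a line present, straightening commutes with
    completion. *)
Lemma straighten_lift_eq (S w : diagram n m.+1) : half_diagram e1 e2 w ->
  (if w == (straighten P S).2 then (straighten P S).1 else 0) =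
  (if lift_diagram w == (straighten P (lift_diagram S)).2
   then (straighten P (lift_diagram S)).1 else 0).
Proof.
move=> hw; rewrite /straighten straighten_strings_lift.
case: (straighten_strings P S) => c S1 /=.
have [np|np] := boolP (no_propagating S1); last first.
  by rewrite !LR_arcs_None ?no_propagating_lift // (inj_eq lift_inj).
have npw D : no_propagating D -> w != D.
  by move=> npD; apply: contraTneq npD => <-; apply: half_propagates.
rewrite !ifN //.
  case e: (LR_arcs (lift_diagram S1)) => [[[i i'] [a a']]|]; last first.
    by rewrite (inj_eq lift_inj) npw.
  have [_ /= lt ma wa] := LR_arcs_Some e.
  apply/eqP => ew.
  have [j ej] : exists j, a = line_node j.
    move: wa; rewrite ffunE; case ea: (narrow_node _) => [x|]; last by move/perm_size.
    by have := narrow_nodeK ea; case: x {ea} => // j [->]; exists j.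
  have [j' ej'] : exists j', a' = line_node j'.
    move: ma; rewrite ej -[inr _]/(widen_node (inr j)) mate_lift.
    by case: (mate S1 _) => // j' [<-]; exists j'.
  have nbj b : (inr (line_node b) == inr a :> node n n) = (b == j).
    by rewrite ej (inj_eq inr_inj) -val_eqE.
  have nbj' b : (inr (line_node b) == inr a' :> node n n) = (b == j').
    by rewrite ej' (inj_eq inr_inj) -val_eqE.
  have jj' : (j < j')%N by move: lt; rewrite ej ej'.
  apply: (@no_LR_lines w j j') => // [b bj bj'||].
  - have : mate (lift_diagram w) (widen_node (inr b)) = mate (lift_diagram S1) (widen_node (inr b)).
      by rewrite ew /= [LHS]ffunE (nbj b) (nbj' b) (negPf bj) (negPf bj').
    rewrite !mate_lift => /widen_node_inj ->.
    by case/andP: np => _ /forallP /(_ b); case: (mate _ _).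
  - rewrite -word_lift ew /= ffunE (nbj j) eqxx orbT //.
  - rewrite -word_lift ew /= ffunE (nbj j') (nbj' j') eqxx orbT /=.
    by rewrite -[j' == j]val_eqE (gtn_eqF jj').
case e: (LR_arcs S1) => [[[i i'] [a a']]|]; last exact: npw.
have [_ /= lt ma wa] := LR_arcs_Some e.
apply/eqP => ew.
apply: (@no_LR_lines w a a') => // [b ba ba'||].
- rewrite ew /= ffunE !(inj_eq inr_inj) (negPf ba) (negPf ba').
  by case/andP: np => _ /forallP /(_ b); case: (mate _ _).
- by rewrite ew /= ffunE eqxx orbT.
- rewrite ew /= ffunE !(inj_eq inr_inj) eqxx orbT /=.
  by rewrite -[a' == a]val_eqE (gtn_eqF lt).
Qed.
End StraightenLift.
End Lift.

(** * Degenerate diagrams persist under stacking and straightening *)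

Section Degenerate.
Variables (n m : nat) (e1 e2 : int).
Hypotheses (lt_mn : (m.+1 <= n)%N) (lab : label n m e1 e2).

Definition bad_word (w v : seq blob) : bool := (w != [::]) && (ohead w != ohead v).

(* At the bottom node of the j-th line, [D] either has an arc or starts with a
   blob which a line of the cell module does not carry; no stacking on top of
   [D] repairs this. *)
Definition degenerate_at (D : diagram n n) (j : 'I_m.+1) : bool :=
  (if mate D (inr (line_node lt_mn j)) is inr _ then true else false) ||
  bad_word (word D (inr (line_node lt_mn j))) (line_word e1 e2 j).
Definition degenerate (D : diagram n n) : bool := [exists j, degenerate_at D j].

Lemma bad_word_cat w w' v : bad_word w v -> bad_word (w ++ w') v.
Proof. by case: w. Qed.

Lemma degenerate_stack g D : generator g -> valid D -> degenerate D ->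
  degenerate (stack g D).
Proof.
move=> gg vD /existsP[j hj]; apply/existsP; exists j.
set y := inr (line_node lt_mn j) : node n n.
have vert_case p x : degenerate_at (stack (vert (@at_node n p x)) D) j.
  rewrite stack_vert // /degenerate_at /= ffunE /=.
  by case/orP: hj => [->//|h]; rewrite bad_word_cat ?orbT.
case: g / gg => [|h l hl|]; [by rewrite left_vert; apply: vert_case | | by rewrite right_vert; apply: vert_case].
have lt_hl : (h < l)%N by rewrite hl.
have nhl : h != l by rewrite neq_ltn lt_hl.
have [cl|nl] := eqVneq (mate D (inl h)) (inl l).
  by rewrite stack_hook_closed // /degenerate_at /= ffunE.
rewrite stack_hook_open // /degenerate_at /= !ffunE -/y.
rewrite /hook_mates /hook_words /=.
move: hj; rewrite /degenerate_at -/y; case: eqVneq => [ea|_].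
  rewrite ea mateK //= => h1; rewrite bad_word_cat ?orbT //.
case: eqVneq => [ec|_] //.
by rewrite ec mateK //= => h1; rewrite bad_word_cat ?orbT.
Qed.

(** A line node other than the two reconnected ones keeps its bottom arc. If there is no other, then
    m = 0, where the line should be bare, or m = 1, where one of the blobs L and R contradicts the
    label because (1, -1, -1) is excluded. *)
Lemma degenerate_reconnect (D : diagram n n) p : LR_arcs D = Some p ->
  degenerate (reconnect D p).
Proof.
move=> e; have [np lt ma wa] := LR_arcs_Some e; case: p lt ma wa {e} => [[i i'] [a a']] lt ma wa; rewrite /= in lt ma wa.
have [/existsP[j /andP[ja ja']]|] := boolP [exists j, (line_node lt_mn j != a) && (line_node lt_mn j != a')].
  apply/existsP; exists j; rewrite /degenerate_at /= ffunE !(inj_eq inr_inj) (negPf ja) (negPf ja') /=.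
  by case/andP: np => _ /forallP /(_ (line_node lt_mn j)); case: (mate _ _).
rewrite negb_exists => /forallP all_in.
have {}all_in j : line_node lt_mn j = a \/ line_node lt_mn j = a'.
  by have := all_in j; rewrite negb_and !negbK => /orP[] /eqP; [left | right].
have wL j : line_node lt_mn j = a -> word (reconnect D (i, i', (a, a'))) (inr (line_node lt_mn j)) = [:: L].
  by move=> ->; rewrite /= ffunE eqxx orbT.
have wR j : line_node lt_mn j = a' -> word (reconnect D (i, i', (a, a'))) (inr (line_node lt_mn j)) = [:: R].
  move=> ->; rewrite /= ffunE /= !(inj_eq inr_inj) eqxx -val_eqE /=.
  by rewrite (gtn_eqF lt).
have [m0|m0] := posnP m.
  apply/existsP; exists ord0; rewrite /degenerate_at /bad_word.
  have -> : line_word e1 e2 (ord0 : 'I_m.+1) = [::].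
    have := lab; rewrite /label m0 /= /line_word /=.
    by case/and5P=> _ _ _ _ /andP[/andP[/eqP -> /eqP ->] _].
  by case: (all_in ord0) => [/wL ->|/wR ->]; rewrite orbT.
have in01 (j j' : 'I_m.+1) : (j < j')%N -> line_node lt_mn j = a /\ line_node lt_mn j' = a'.
  move=> jj'; case: (all_in j) (all_in j') => h [] h'; split => //;
  move/(congr1 val): h; move/(congr1 val): h' => /=; lia.
have [h0 hm] := in01 ord0 ord_max m0.
have m1 : m = 1%N.
  apply/eqP; rewrite eqn_leq m0 andbT leqNgt; apply/negP => m2.
  have [/(congr1 val) /= h _] := in01 (Ordinal (leqW m2)) ord_max m2.
  by move/(congr1 val): h0 h => /= <-.
have := lab; rewrite /label m1 /= => /and5P[_ _ _ _]; rewrite negb_and => /orP[ne|ne].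
  apply/existsP; exists ord0; rewrite /degenerate_at wL // /bad_word /line_word /=.
  by rewrite (negPf ne) [_ == m](_ : _ = false) ?orbT //; apply/negbTE; rewrite m1.
apply/existsP; exists ord_max; rewrite /degenerate_at wR // /bad_word /line_word /=.
by rewrite (negPf ne) andbF cats0 [m == 0%N](_ : _ = false) ?orbT //; apply/negbTE; rewrite m1.
Qed.

Lemma degenerate_straighten (k : fieldType) (P : blob_scalars k) (D : diagram n n) :
  degenerate D -> degenerate (straighten P D).2.
Proof.
move=> bD; rewrite /straighten.
have : degenerate (straighten_strings P D).2.
  case/existsP: bD => j hj; apply/existsP; exists j; move: hj.
  rewrite /degenerate_at /= ffunE => /orP[->//|].
  rewrite /bad_word => /andP[w0 hw]; apply/orP; right; rewrite straighten_head hw andbT.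
  by have := straighten_head P (word D (inr (line_node lt_mn j))); case: (straighten_word _ _).2; case: (word D _) w0.
case: (straighten_strings P D) => c S /= bS; case e: (LR_arcs S) => [p|] //=.
exact: degenerate_reconnect.
Qed.

Lemma lift_not_degenerate (w : diagram n m.+1) : half_diagram e1 e2 w ->
  ~~ degenerate (lift_diagram lt_mn w).
Proof.
case/and5P=> _ /forallP ap _ _ /andP[/forallP lw _]; rewrite negb_exists; apply/forallP => j.
rewrite /degenerate_at -[inr _]/(widen_node lt_mn (inr j)) mate_lift word_lift (eqP (lw j)).
by have := ap j; case: (mate _ _) => //= i _; rewrite /bad_word eqxx andbF.
Qed.
End Degenerate.

(** * The cell action as a product in the algebra *)

Section CellModule.
Variables (k : fieldType) (P : blob_scalars k) (n : nat) (A : falgType k)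
  (b : basis_diagram n -> A).
Hypothesis A_blob : symplectic_blob_algebra P b.
Variables (m : nat) (e1 e2 : int).
Hypotheses (lt_mn : (m.+1 <= n)%N) (par : ~~ odd (n - m.+1)) (lab : label n m e1 e2).
Hypothesis basic_half : forall w : half_basis n m e1 e2, basic (lift_diagram lt_mn (hdia w)).

Local Notation W := (cell_module k n m e1 e2).
Local Notation lift w := (lift_diagram lt_mn (hdia w)).
Local Notation elt := (elt b).
Local Notation cf := (cf b).

Definition embed (f : W) : A := \sum_(w : half_basis n m e1 e2) f w *: elt (lift w).
(** All other basis elements are dropped: diagrams with fewer lines, or with lines decorated
    otherwise, go to 0 as the cell action demands. *)
Definition project (a : A) : W :=
  [ffun w : half_basis n m e1 e2 => \sum_(x | bdia x == lift w) cf x a].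

Lemma cf_elt x D : cf x (elt D) = (bdia x == D)%:R.
Proof.
rewrite /elt /cf linear_sum /= (eq_bigr (fun y => (x == y)%:R)) => [|y _]; last first.
  exact: (cf_b A_blob).
have [<-|ne] := eqVneq (bdia x) D.
  by rewrite (eq_bigl (pred1 x)) ?big_pred1_eq ?eqxx // => y; rewrite (inj_eq (@bdia_inj n)).
by rewrite big1 // => y /eqP ey; case: eqVneq => // exy; rewrite exy ey eqxx in ne.
Qed.

Lemma project_is_linear : linear project.
Proof.
move=> c x y; apply/ffunP => w; rewrite !ffunE scaler_sumr -big_split.
by apply: eq_bigr => z _; rewrite /cf linearP.
Qed.
HB.instance Definition _ := GRing.isLinear.Build k A W _ project project_is_linear.

Lemma project_elt D w : project (elt D) w = (lift w == D)%:R.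
Proof.
have [x ex] := basic_exists (basic_half w).
rewrite ffunE (eq_bigl (pred1 x)) ?big_pred1_eq ?cf_elt ?ex // => y.
by rewrite -ex (inj_eq (@bdia_inj n)).
Qed.

Lemma half_basisP (w : half_basis n m e1 e2) : half_diagram e1 e2 (hdia w).
Proof. exact: (valP w). Qed.

Lemma stack_actionE d v : stack_action P d v = project (b d * elt (lift v)).
Proof.
have bv := basic_half v.
rewrite -elt_bdia (elt_mul A_blob) ?bdia_basic // linearZ /=.
rewrite stack_lift //; apply/ffunP => w; rewrite [RHS]ffunE project_elt.
transitivity (if hdia w == (straighten P (stack (bdia d) (hdia v))).2
              then (straighten P (stack (bdia d) (hdia v))).1 else 0).
  by rewrite /stack_action; case: (straighten _ _) => c e; rewrite ffunE.
rewrite (straighten_lift_eq lt_mn par P lab) ?half_basisP //.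
by case: ifP => _; [exact: esym (mulr1 _) | exact: esym (mulr0 _)].
Qed.

(** Trades the action for multiplication in [A], whose associativity and centre become available. *)
Lemma cell_actionE a (f : W) : cell_action P b a f = project (a * embed f).
Proof.
rewrite [in RHS](cf_sum A_blob a) mulr_suml linear_sum; apply: eq_bigr => d _.
rewrite /embed mulr_sumr linear_sum; apply: eq_bigr => v _.
by rewrite stack_actionE -linearZ /= -scalerAl -scalerAr scalerA.
Qed.

(** The span of the degenerate basis elements: a left ideal by [negligibleMl], on which [project]
    vanishes. *)
Definition negligible (a : A) : Prop :=
  forall x, cf x a != 0 -> degenerate e1 e2 lt_mn (bdia x).

Lemma negligible0 : negligible 0.
Proof. by move=> x; rewrite /cf linear0 eqxx. Qed.
Lemma negligibleD a c : negligible a -> negligible c -> negligible (a + c).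
Proof.
move=> na nc x; rewrite /cf linearD /=.
have [e0|/na//] := eqVneq (cf x a) 0; have [e0'|/nc//] := eqVneq (cf x c) 0.
by rewrite [coord _ _ a]e0 [coord _ _ c]e0' addr0 eqxx.
Qed.
Lemma negligibleZ c a : negligible a -> negligible (c *: a).
Proof.
move=> na x; rewrite /cf linearZ /=; have [e0|/na//] := eqVneq (cf x a) 0.
by rewrite [coord _ _ a]e0 mulr0 eqxx.
Qed.
Lemma negligible_elt D : degenerate e1 e2 lt_mn D -> negligible (elt D).
Proof. by move=> bD x; rewrite cf_elt; have [->|_] := eqVneq (bdia x) D; rewrite ?eqxx. Qed.
Lemma negligible_mul_elt g D : generator g -> basic D -> 
  degenerate e1 e2 lt_mn (stack g D) -> negligible (elt g * elt D).
Proof.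
move=> gg bD dS; rewrite (elt_mul A_blob) ?(generator_basic gg) //.
apply/negligibleZ/negligible_elt; exact: degenerate_straighten.
Qed.

Lemma negligible_sum (I : finType) (F : I -> A) :
  (forall i, negligible (F i)) -> negligible (\sum_i F i).
Proof.
by move=> nF; elim/big_rec: _ => [|i x _ nx]; [apply: negligible0 | apply: negligibleD].
Qed.

Lemma negligibleM g a : generator g -> negligible a -> negligible (elt g * a).
Proof.
move=> gg na; rewrite (cf_sum A_blob a) mulr_sumr; apply: negligible_sum => x.
rewrite -scalerAr; have [->|/na bx] := eqVneq (cf x a) 0; first by rewrite scale0r; apply: negligible0.
apply: negligibleZ; rewrite -elt_bdia; apply: negligible_mul_elt; rewrite ?bdia_basic //.
by apply: degenerate_stack => //; apply/basic_valid/bdia_basic.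
Qed.

Lemma negligibleMl c a : negligible a -> negligible (c * a).
Proof.
move=> na; rewrite (cf_sum A_blob c) mulr_suml; apply: negligible_sum => d.
rewrite -scalerAl; apply: negligibleZ; rewrite -elt_bdia.
apply: (basis_ind A_blob (Q := fun c => negligible (c * a))) (bdia_basic d) => [|g x gg IH].
  by rewrite mul1r.
by rewrite -mulrA; apply: negligibleM.
Qed.

Lemma project_negligible a : negligible a -> project a = 0.
Proof.
move=> na; apply/ffunP => w; rewrite !ffunE big1 // => x /eqP ex.
have [//|/na] := eqVneq (cf x a) 0.
by rewrite ex (negPf (lift_not_degenerate _ (half_basisP w))).
Qed.

(** Centrality moves z next to the embedded vector, where it is al up to a negligible element;
    multiplication by a keeps the error negligible and [project] kills it. Stating this for z * a
    avoids composing two actions. *)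
Lemma cell_action_central (z : A) (al : k) : (forall a, z * a = a * z) ->
  (forall w : half_basis n m e1 e2, negligible (z * elt (lift w) - al *: elt (lift w))) ->
  forall a (f : W), cell_action P b (z * a) f = al *: cell_action P b a f.
Proof.
move=> cz zw a f; rewrite !cell_actionE cz -mulrA.
have : negligible (z * embed f - al *: embed f).
  rewrite /embed mulr_sumr scaler_sumr -sumrB; apply: negligible_sum => w.
  by rewrite -scalerAr scalerA mulrC -scalerA -scalerBr; apply: negligibleZ.
move=> nz; have /eqP := project_negligible (negligibleMl (c := a) nz); rewrite mulrBr linearB /= subr_eq0 => /eqP ->.
by rewrite -scalerAr linearZ.
Qed.

Lemma cell_actionB a c (f : W) : cell_action P b (a - c) f = cell_action P b a f - cell_action P b c f.
Proof. by rewrite !cell_actionE mulrBl linearB. Qed.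
Lemma cell_actionZ al a (f : W) : cell_action P b (al *: a) f = al *: cell_action P b a f.
Proof. by rewrite !cell_actionE -scalerAl linearZ. Qed.
Lemma cell_action0 a : cell_action P b a (0 : W) = 0.
Proof. by rewrite cell_actionE /embed big1 ?mulr0 ?linear0 // => w _; rewrite ffunE scale0r. Qed.
End CellModule.

(** * Half-diagrams are generated by one of them *)

Section Half.
Variables (n m : nat) (e1 e2 : int).
Implicit Types D : diagram n m.+1.
Local Notation half D := (half_diagram e1 e2 D).

Definition planar D : Prop := forall x y,
  ~~ [&& (pos x < pos y)%N, (pos y < pos (mate D x))%N & (pos (mate D x) < pos (mate D y))%N].

Lemma half_intro D :
  valid D -> planar D -> (forall j, exists a, mate D (inr j) = inl a) ->
  loops D = [::] -> (forall j, word D (inr j) = line_word e1 e2 j) -> arc_words D -> half D.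
Proof.
move=> vD pD ap l0 lw aw; rewrite /half_diagram l0 eqxx aw /= andbT.
apply/and4P; split.
- apply/andP; split; apply/forallP => x; first by rewrite mate_nofix //= mateK.
  by apply/forallP => y; apply: pD.
- by apply/forallP => j; have [a ->] := ap j.
- by apply/forallP => x; rewrite word_mate.
- by apply/forallP => j; apply/eqP.
Qed.

Section Given.
Variable D : diagram n m.+1.
Hypothesis hD : half D.

Lemma half_valid : valid D.
Proof.
case/and5P: hD => /andP[/forallP h _] _ _ /forallP rv _.
split=> x; last exact/eqP.
  by have /andP[_ /eqP] := h x.
by have /andP[] := h x.
Qed.
Let vD := half_valid.

Lemma half_planar : planar D.
Proof. by case/and5P: hD => /andP[_ /forallP h] _ _ _ _ x y; have /forallP := h x; apply. Qed.

Lemma half_line j : exists a, mate D (inr j) = inl a.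
Proof. by case/and5P: hD => _ /forallP /(_ j) + _ _ _; case: (mate _ _) => // a _; exists a. Qed.

Lemma half_loops : loops D = [::].
Proof. by case/and5P: hD => _ _ /eqP. Qed.

Lemma half_line_word j : word D (inr j) = line_word e1 e2 j.
Proof. by case/and5P: hD => _ _ _ _ /andP[/forallP /(_ j) /eqP]. Qed.

Lemma half_arc_words : arc_words D.
Proof. by case/and5P: hD => _ _ _ _ /andP[]. Qed.

(** [planar] forbids one order of four ends only; applied to (x, y) and to (mate y, x), with
    distinct positions for distinct nodes, it yields strict nesting. *)
Lemma half_nested x y : (pos x < pos y)%N -> (pos y < pos (mate D x))%N ->
  (pos x < pos (mate D y))%N && (pos (mate D y) < pos (mate D x))%N.
Proof.
move=> xy ym.
have pinj (u w : node n m.+1) : pos u = pos w -> u = w.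
  case: u w => [u|u] [w|w] /=; have := ltn_ord u; have := ltn_ord w => h1 h2 e.
  - by congr inl; apply: val_inj.
  - by exfalso; lia.
  - by exfalso; lia.
  - by congr inr; apply: val_inj => /=; lia.
have h1 := half_planar x y; rewrite xy ym /= -leqNgt in h1.
rewrite (ltn_neqAle (pos (mate D y))) h1 andbT.
have ne : pos (mate D y) != pos (mate D x).
  by apply/eqP => /pinj /(inv_inj (mateK vD)) e; rewrite e ltnn in xy.
rewrite ne andbT ltnNge; apply/negP => le.
have ne2 : pos (mate D y) != pos x.
  by apply/eqP => /pinj e; rewrite -e mateK // ltnn in ym.
have := half_planar (mate D y) x; rewrite mateK // xy ym andbT /= andbT.
by rewrite ltn_neqAle ne2 le.
Qed.

Lemma half_top_nested (a b c : 'I_n) : mate D (inl a) = inl b -> (a < c)%N -> (c < b)%N ->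
  exists d : 'I_n, [/\ mate D (inl c) = inl d, (a < d)%N & (d < b)%N].
Proof.
move=> ab ac cb; have := @half_nested (inl a) (inl c); rewrite ab /= => /(_ ac cb).
case: (mate D (inl c)) => [d|d] /= /andP[h1 h2]; first by exists d.
by have := ltn_ord b; lia.
Qed.

Lemma half_lines_mono (a a' : 'I_n) (j j' : 'I_m.+1) :
  mate D (inl a) = inr j -> mate D (inl a') = inr j' -> (a < a')%N -> (j < j')%N.
Proof.
move=> h h' lt; have := half_planar (inl a) (inl a'); rewrite h h' /= lt /=.
have : j != j'.
  apply/eqP => e; have : inl a = inl a' :> node n m.+1.
    by apply: (inv_inj (mateK vD)); rewrite h h' e.
  by case=> ea; rewrite ea ltnn in lt.
rewrite -val_eqE /=; have := ltn_ord a'; have := ltn_ord j; have := ltn_ord j'; lia.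
Qed.

Lemma half_arc_word (a b : 'I_n) : mate D (inl a) = inl b -> (a < b)%N ->
  [\/ word D (inl a) = [::], word D (inl a) = [:: L] /\ left_exposed D a |
      word D (inl a) = [:: R] /\ right_exposed D b].
Proof.
move=> ab lt; have /forallP /(_ a) /forallP /(_ b) := half_arc_words.
rewrite ab eqxx lt /= => /or3P[/eqP|/andP[/eqP]|/andP[/eqP]]; first by constructor 1.
  by constructor 2.
by constructor 3.
Qed.

(** Two blobs could meet only on a line that is both leftmost and rightmost, which means m = 0;
    there the signs forbid them. *)
Lemma half_word_size x : (m == 0%N) ==> ((e1 == 1) && (e2 == 1)) -> (size (word D x) <= 1)%N.
Proof.
move=> lab; have lw j : (size (line_word e1 e2 (j : 'I_m.+1)) <= 1)%N.
  rewrite /line_word; have [m0|m0] := posnP m.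
    have /andP[/eqP -> /eqP ->] : (e1 == 1) && (e2 == 1) by move: lab; rewrite m0.
    by rewrite !andbF.
  have [->|_] := eqVneq (j : nat) 0%N; last by rewrite /=; case: ifP.
  by rewrite (ltn_eqF m0) /=; case: ifP.
have rw y : (size (word D (mate D y)) <= 1)%N -> (size (word D y) <= 1)%N.
  by rewrite word_mate // size_rev.
have bot j : (size (word D (inr j)) <= 1)%N by rewrite half_line_word.
case: x => [a|j] //; case ea: (mate D (inl a)) => [b|j]; last first.
  by apply: rw; rewrite ea.
have : a != b by apply/eqP => e; have := mate_nofix (inl a) vD; rewrite ea e eqxx.
rewrite neq_ltn => /orP[lt|lt].
  by have [->|[-> _]|[-> _]] := half_arc_word ea lt.
have eb : mate D (inl b) = inl a by rewrite -ea mateK.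
by apply: rw; rewrite ea; have [->|[-> _]|[-> _]] := half_arc_word eb lt.
Qed.

End Given.

(** * A slide turns half-diagrams into half-diagrams *)

Section SlideHalf.
Variables (D : diagram n m.+1) (i j l : 'I_n).
Hypothesis hD : half D.
Hypotheses (Dij : mate D (inl i) = inl j) (wi : word D (inl i) = [::]).
Hypothesis consecutive : (j = i.+1 :> nat /\ l = j.+1 :> nat) \/ (i = j.+1 :> nat /\ j = l.+1 :> nat).

Let vD := half_valid hD.
Let li : l != i. Proof. by rewrite -val_eqE /=; lia. Qed.
Let lj : l != j. Proof. by rewrite -val_eqE /=; lia. Qed.
Let ij : i != j. Proof. by rewrite -val_eqE /=; lia. Qed.
Let Dji : mate D (inl j) = inl i. Proof. by rewrite -Dij mateK. Qed.
Let wj : word D (inl j) = [::]. Proof. by rewrite (word_eq_mate vD Dij) wi. Qed.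
Let D' := stack (hook_diagram j l) D.

(** A slide renumbers the top nodes by the cycle i, j, l, which is increasing off the pair {i, j}.
    So planarity and exposure carry over for the other strings, and the pair itself stays
    adjacent. *)
Let shift (x : 'I_n) := if x == i then j else if x == j then l else if x == l then i else x.
Let unshift (x : 'I_n) := if x == j then i else if x == l then j else if x == i then l else x.
Let on_top (f : 'I_n -> 'I_n) (x : node n m.+1) : node n m.+1 :=
  match x with inl a => inl (f a) | inr b => inr b end.

Let nji : (j == i) = false. Proof. by rewrite eq_sym (negPf ij). Qed.
Let nil : (i == l) = false. Proof. by rewrite eq_sym (negPf li). Qed.
Let njl : (j == l) = false. Proof. by rewrite eq_sym (negPf lj). Qed.

Let mate' x : mate D' x = on_top shift (mate D (on_top unshift x)).
Proof.
rewrite (slide_mate vD Dij) //.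
have e1' : (inl j == inl l :> node n m.+1) = false by rewrite (inj_eq inl_inj) njl.
case: x => [x|b]; rewrite ?(inj_eq inl_inj) /= /unshift.
  have [_|xj] := eqVneq x j; first by rewrite Dij /= /shift nji eqxx.
  have [_|xl] := eqVneq x l; first by rewrite Dji /= /shift eqxx.
  have mo (z : 'I_n) : z != i -> z != j -> z != l -> shift z = z.
    by rewrite /shift => /negPf -> /negPf -> /negPf ->.
  have [_|xi] := eqVneq x i.
    case el: (mate D (inl l)) => [z|//] /=; rewrite mo //.
    - by apply/eqP => ez; move: el; rewrite ez -Dji => /(inv_inj (mateK vD)) [] e; move: lj; rewrite e eqxx.
    - by apply/eqP => ez; move: el; rewrite ez -Dij => /(inv_inj (mateK vD)) [] e; move: li; rewrite e eqxx.
    - by apply/eqP => ez; move: (mate_nofix (inl l) vD); rewrite el ez eqxx.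
  rewrite -mate_swap //.
  have [ex|nx] := eqVneq (mate D (inl x)) (inl l).
    by rewrite ex /= /shift (negPf lj) (negPf li) eqxx.
  case ex: (mate D (inl x)) => [z|//] /=; rewrite mo //.
  - by apply/eqP => ez; move: ex; rewrite ez -Dji => /(inv_inj (mateK vD)) [] e; move: xj; rewrite e eqxx.
  - by apply/eqP => ez; move: ex; rewrite ez -Dij => /(inv_inj (mateK vD)) [] e; move: xi; rewrite e eqxx.
  - by apply: contraNneq nx => <-; rewrite ex.
have mo (z : 'I_n) : z != i -> z != j -> z != l -> shift z = z.
  by rewrite /shift => /negPf -> /negPf -> /negPf ->.
rewrite /= -mate_swap //.
have [ex|nx] := eqVneq (mate D (inr b)) (inl l).
  by rewrite ex /= /shift (negPf lj) (negPf li) eqxx.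
case ex: (mate D (inr b)) => [z|//] /=; rewrite mo //.
- by apply/eqP => ez; move: ex; rewrite ez -Dji => /(inv_inj (mateK vD)).
- by apply/eqP => ez; move: ex; rewrite ez -Dij => /(inv_inj (mateK vD)).
- by apply: contraNneq nx => <-; rewrite ex.
Qed.

Let word' x : word D' x = word D (on_top unshift x).
Proof.
rewrite (slide_word vD Dij wi) //; case: x => [x|b] //; rewrite ?(inj_eq inl_inj) /= /unshift.
have [_|xj] := eqVneq x j; first by rewrite wi.
have [_|xl] := eqVneq x l; first by rewrite wj.
by rewrite /=; case: ifP.
Qed.

Let shiftK x : shift (unshift x) = x.
Proof.
rewrite /unshift; have [->|xj] := eqVneq x j; first by rewrite /shift eqxx.
have [->|xl] := eqVneq x l; first by rewrite /shift nji eqxx.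
have [->|xi] := eqVneq x i; first by rewrite /shift (negPf li) (negPf lj) eqxx.
by rewrite /shift (negPf xi) (negPf xj) (negPf xl).
Qed.

Let unshiftK x : unshift (shift x) = x.
Proof.
rewrite /shift; have [->|xi] := eqVneq x i; first by rewrite /unshift eqxx.
have [->|xj] := eqVneq x j; first by rewrite /unshift (negPf lj) eqxx.
have [->|xl] := eqVneq x l; first by rewrite /unshift (negPf ij) nil eqxx.
by rewrite /unshift (negPf xi) (negPf xj) (negPf xl).
Qed.

Let shift_lt x y : x != i -> x != j -> y != i -> y != j ->
  (shift x < shift y)%N = (x < y)%N.
Proof.
move=> xi xj yi yj; rewrite /shift (negPf xi) (negPf xj) (negPf yi) (negPf yj).
move: xi xj yi yj; rewrite -!val_eqE /=.
by case: (nat_of_ord x == l) / eqP => [ex|ex]; case: (nat_of_ord y == l) / eqP => [ey|ey]; rewrite ?ex ?ey; lia.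
Qed.

Let in_pair (x : node n m.+1) := (x == inl i) || (x == inl j).
Let in_pairN x : in_pair (inl x) = false -> (x != i) * (x != j).
Proof. by rewrite /in_pair !(inj_eq inl_inj) => /negbT; rewrite negb_or => /andP[-> ->]. Qed.
Let in_pair_mate x : in_pair (mate D x) = in_pair x.
Proof. by rewrite /in_pair !mate_swap // Dij Dji orbC. Qed.

Let pos_shift x y : in_pair x = false -> in_pair y = false ->
  (pos (on_top shift x) < pos (on_top shift y))%N = (pos x < pos y)%N.
Proof.
case: x y => [x|x] [y|y] //=.
- by move=> /in_pairN[h1 h2] /in_pairN[h3 h4]; rewrite shift_lt.
- by move=> _ _; have := ltn_ord (shift x); have := ltn_ord x; lia.
- by move=> _ _; have := ltn_ord (shift y); have := ltn_ord y; lia.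
Qed.

Let on_topK x : on_top shift (on_top unshift x) = x.
Proof. by case: x => //= x; rewrite shiftK. Qed.

Let pair_near x : in_pair (on_top unshift x) ->
  (pos (mate D' x) = (pos x).+1 :> nat) \/ (pos x = (pos (mate D' x)).+1 :> nat).
Proof.
move=> h; rewrite -{2 3}[x]on_topK mate'; move: h; rewrite /in_pair => /orP[] /eqP ->.
  by rewrite Dij /= /shift eqxx nji eqxx; lia.
by rewrite Dji /= /shift eqxx nji eqxx; lia.
Qed.

Let pair_in z : in_pair (inl (unshift z)) ->
  (z = j /\ mate D' (inl z) = inl l) \/ (z = l /\ mate D' (inl z) = inl j).
Proof.
move=> h; move: (h); rewrite /in_pair /unshift.
have [-> _|zj] := eqVneq z j; first by left; rewrite (slide_mate vD Dij) // eqxx.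
have [-> _|zl] := eqVneq z l.
  by right; rewrite (slide_mate vD Dij) // (inj_eq inl_inj) (negPf lj) eqxx.
have [_|zi] := eqVneq z i; first by rewrite !(inj_eq inl_inj) (negPf li) (negPf lj).
by rewrite !(inj_eq inl_inj) (negPf zi) (negPf zj).
Qed.

Let pair_out z : in_pair (inl (unshift z)) = false -> (z != j) * (z != l).
Proof.
rewrite /in_pair /unshift.
have [_|zj] := eqVneq z j; first by rewrite eqxx.
by have [_|zl] := eqVneq z l; first by rewrite eqxx orbT.
Qed.

Lemma slide_half : half D'.
Proof.
have vD' : valid D' by apply: (valid_slide vD Dij).
apply: half_intro => //.
- move=> x y; apply/negP => /and3P[h1 h2 h3].
  (* The ends of the pair are adjacent, so no node lies between them and nothing crosses the
     pair. *)
  have [px|px] := boolP (in_pair (on_top unshift x)).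
    by move: (pair_near px) h1 h2 h3; clear; lia.
  have [py|py] := boolP (in_pair (on_top unshift y)).
    by move: (pair_near py) h1 h2 h3; clear; lia.
  have {}px := negbTE px; have {}py := negbTE py.
  have := half_planar hD (on_top unshift x) (on_top unshift y).
  have pmx := etrans (in_pair_mate _) px; have pmy := etrans (in_pair_mate _) py.
  have c1 := pos_shift px py; have c2 := pos_shift py pmx; have c3 := pos_shift pmx pmy.
  rewrite !on_topK -?mate' in c1 c2 c3.
  by rewrite -c1 -c2 -c3 h1 h2 h3.
- by move=> b; have [a ea] := half_line hD b; exists (shift a); rewrite mate' /= ea.
- by rewrite (slide_loops vD Dij) // half_loops.
- by move=> b; rewrite word' half_line_word.
apply/forallP => a; apply/forallP => a'; apply/implyP => /andP[/eqP ma lt].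
have [pa|pa] := boolP (in_pair (inl (unshift a))).
  rewrite word' /=; move: pa; rewrite /in_pair => /orP[] /eqP ->; by rewrite ?wi ?wj eqxx.
have {}pa := negbTE pa.
move: ma; rewrite mate' word' /=.
case eb: (mate D (inl (unshift a))) => [b|//] /= [ea'].
have pb : in_pair (inl b) = false by rewrite -eb in_pair_mate.
have pa' : in_pair (inl (unshift a')) = false.
  by rewrite -ea'; move: pb; rewrite -{1}[b]unshiftK.
have lt_sh x y : in_pair (inl x) = false -> in_pair (inl y) = false ->
    (shift x < shift y)%N = (x < y)%N.
  by move=> /in_pairN[h1 h2] /in_pairN[h3 h4]; apply: shift_lt.
have lt' : (unshift a < b)%N by rewrite -lt_sh // shiftK ea'.
have [aj al] := pair_out pa; have [a'j a'l] := pair_out pa'.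
rewrite -!val_eqE /= in aj al a'j a'l.
have [->|[-> /forallP ex]|[-> /forallP ex]] := half_arc_word hD eb lt'; first by rewrite eqxx.
- apply/orP; right; apply/orP; left; rewrite eqxx /=.
  apply/forallP => z; apply/implyP => za.
  have [/pair_in[[ez ->]|[ez ->]]|/negbTE pz] := boolP (in_pair (inl (unshift z))).
  - by move: za aj al a'j a'l consecutive; rewrite ez; clear; lia.
  - by move: za aj al a'j a'l consecutive; rewrite ez; clear; lia.
  rewrite mate' /=; have := ex (unshift z); rewrite -lt_sh // !shiftK za /=.
  case ew: (mate D (inl (unshift z))) => [w|//] /= wa.
  have pw : in_pair (inl w) = false by rewrite -ew in_pair_mate.
  by have := lt_sh w (unshift a) pw pa; rewrite shiftK => ->.
- apply/orP; right; apply/orP; right; rewrite eqxx /=.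
  apply/forallP => z; apply/implyP => za.
  have [/pair_in[[ez ->]|[ez ->]]|/negbTE pz] := boolP (in_pair (inl (unshift z))).
  - by move: za aj al a'j a'l consecutive; rewrite ez; clear; lia.
  - by move: za aj al a'j a'l consecutive; rewrite ez; clear; lia.
  rewrite mate' /=; have := ex (unshift z).
  have -> : (b < unshift z)%N by rewrite -lt_sh // shiftK ea'.
  case ew: (mate D (inl (unshift z))) => [w|//] /= wa.
  have pw : in_pair (inl w) = false by rewrite -ew in_pair_mate.
  by have := lt_sh b w pb pw; rewrite ea' => ->.
Qed.
End SlideHalf.
End Half.

(** * A weight that decreases under suitable slides *)

Section Generation.
Local Open Scope nat_scope.
Variables (n m : nat) (e1 e2 : int).
Implicit Types D : diagram n m.+1.
Local Notation half D := (half_diagram e1 e2 D).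

Definition node_weight D (a : 'I_n) : nat :=
  match mate D (inl a) with
  | inr _ => 0
  | inl b => if (a < b)%N
             then if word D (inl a) == [::] then n - a
                  else if word D (inl a) == [:: L] then a + n.+1 else 0
             else if word D (inl a) == [:: R] then n - a + n.+1 else 0
  end.

(* Measures the distance to the half-diagram without arc blobs whose lines come
   first: it decreases when a bare pair slides to the right of a line, of a bare closing
   end or of an L-opening end, when it slides to the left of a bare opening end or
   of an R-closing end, and when a blob is removed. *)
Definition weight D : nat := \sum_(a : 'I_n) node_weight D a.

Lemma half_top_mate D (hD : half D) (a b : 'I_n) : mate D (inl a) = inl b -> mate D (inl b) = inl a.
Proof. by move=> <-; rewrite mateK //; apply: half_valid hD. Qed.

Lemma half_top_neq D (hD : half D) (a b : 'I_n) : mate D (inl a) = inl b -> (a : nat) != b.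
Proof.
move=> ab; apply/eqP => /val_inj e; have := mate_nofix (inl a) (half_valid hD).
by rewrite ab e eqxx.
Qed.

Section Slide.
Variables (D : diagram n m.+1) (i j l : 'I_n).
Hypothesis hD : half D.
Hypotheses (Dij : mate D (inl i) = inl j) (wi : word D (inl i) = [::]).
Hypothesis consecutive : (j = i.+1 :> nat /\ l = j.+1 :> nat) \/ (i = j.+1 :> nat /\ j = l.+1 :> nat).
Let vD := half_valid hD.
Let li : l != i. Proof. by rewrite -val_eqE /=; lia. Qed.
Let lj : l != j. Proof. by rewrite -val_eqE /=; lia. Qed.
Let ij : i != j. Proof. by rewrite -val_eqE /=; lia. Qed.
Let D' := stack (hook_diagram j l) D.
Let Dji : mate D (inl j) = inl i := half_top_mate hD Dij.
Let wj : word D (inl j) = [::]. Proof. by rewrite (word_eq_mate vD Dij) wi. Qed.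
Let ninl (x y : 'I_n) : x != y -> (inl x == inl y :> node n m.+1) = false.
Proof. by rewrite (inj_eq inl_inj) => /negPf. Qed.

(** Only i, j and l change weight, and the bare pair weighs n minus its left end. An equality of
    sums is used because the weight may move either way. *)
Lemma weight_slide :
  (weight D' + node_weight D l + (n - minn i j) =
   weight D + node_weight D' i + (n - minn j l))%N.
Proof.
have big3 (F : 'I_n -> nat) : (\sum_a F a = F i + (F j + (F l +
    \sum_(a | [&& a != i, a != j & a != l]) F a)))%N.
  rewrite (bigD1 i) //= (bigD1 j) ?[j == i]eq_sym //= (bigD1 l) ?li ?lj //=.
  by congr (_ + (_ + (_ + _)))%N; apply: eq_bigl => a; rewrite -!andbA.
rewrite /weight !big3.
have -> : (\sum_(a | [&& a != i, a != j & a != l]) node_weight D' a =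
           \sum_(a | [&& a != i, a != j & a != l]) node_weight D a)%N.
  apply: eq_bigr => a /and3P[ai aj al]; rewrite /node_weight (slide_mate vD Dij) //.
  rewrite (slide_word vD Dij wi) // !ninl //=.
  case: eqVneq => [eml|nml].
    have el : mate D (inl a) = inl l by rewrite eml mateK.
    rewrite el; rewrite -!val_eqE /= in ai aj al.
    by have -> : (a < i)%N = (a < l)%N by lia.
  by [].
have wmin (B : diagram n m.+1) x y : mate B (inl x) = inl y -> mate B (inl y) = inl x ->
   word B (inl x) = [::] -> word B (inl y) = [::] -> x != y ->
   (node_weight B x + node_weight B y = n - minn x y)%N.
  move=> h1 h2 h3 h4; rewrite -val_eqE /node_weight h1 h2 h3 h4 /= => xy.
  by case: ifP => h; case: ifP => h' //=; lia.
have s1 : (node_weight D i + node_weight D j = n - minn i j)%N by apply: wmin.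
have nlj : (inl l == inl j :> node n m.+1) = false by apply: ninl.
have s2 : (node_weight D' j + node_weight D' l = n - minn j l)%N.
  apply: wmin; rewrite ?(slide_mate vD Dij) ?(slide_word vD Dij wi) // ?eqxx ?nlj ?orbT //.
  by rewrite eq_sym.
lia.
Qed.

Lemma slide_weight_i : node_weight D' i =
  match mate D (inl l) with
  | inr _ => 0
  | inl b => if (l < b)%N
             then if word D (inl l) == [::] then n - i
                  else if word D (inl l) == [:: L] then i + n.+1 else 0
             else if word D (inl l) == [:: R] then n - i + n.+1 else 0
  end.
Proof.
rewrite /node_weight (slide_mate vD Dij) // (slide_word vD Dij wi) //.
rewrite (ninl ij) [inl i == inl l]eq_sym (ninl li) eqxx /=.
case e: (mate D (inl l)) => [z|//].
have ez := half_top_mate hD e.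
have zi : (z : nat) != i by apply/eqP => /val_inj h; move: ez; rewrite h Dij => -[h']; move: lj; rewrite h' eqxx.
have zj : (z : nat) != j by apply/eqP => /val_inj h; move: ez; rewrite h Dji => -[h']; move: li; rewrite h' eqxx.
have zl := half_top_neq hD e.
by have -> : (i < z)%N = (l < z)%N by lia.
Qed.
End Slide.

Definition reducible D : Prop := exists g D',
  [/\ generator g, half D', stack g D' = D & (weight D' < weight D)%N].

Lemma slide_reducible D (i j l : 'I_n) : half D -> mate D (inl i) = inl j -> word D (inl i) = [::] ->
  (j = i.+1 :> nat /\ l = j.+1 :> nat) \/ (i = j.+1 :> nat /\ j = l.+1 :> nat) ->
  (node_weight (stack (hook_diagram j l) D) i + (n - minn j l) <
   node_weight D l + (n - minn i j))%N -> reducible D.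
Proof.
move=> hD Dij wi cons lt; exists (hook_diagram i j), (stack (hook_diagram j l) D).
have vD := half_valid hD.
have li : l != i by rewrite -val_eqE /=; lia.
have lj : l != j by rewrite -val_eqE /=; lia.
split.
- by case: cons => -[h _]; [|rewrite hook_diagramC]; apply: gen_hook.
- exact: (slide_half hD Dij wi cons).
- exact: (slide_back vD Dij wi).
- have := weight_slide hD Dij wi cons; lia.
Qed.

Definition strip (D : diagram n m.+1) (p : 'I_n) : diagram n m.+1 :=
  Diagram (mate D)
    [ffun x => if (x == inl p) || (x == mate D (inl p)) then [::] else word D x] (loops D).

Section Strip.
Variables (D : diagram n m.+1) (p p' : 'I_n) (x : blob).
Hypotheses (hD : half D) (mp : mate D (inl p) = inl p') (wp : word D (inl p) = [:: x]).

Lemma strip_half : half (strip D p).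
Proof.
have vD := half_valid hD; have vS : valid (strip D p).
  split=> y /=; [exact: mateK | exact: mate_nofix |].
  rewrite !ffunE mate_swap // (inj_eq (inv_inj (mateK vD))) orbC word_mate //.
  by case: ifP.
apply: half_intro => //=; [exact: half_planar hD | exact: half_line hD | exact: half_loops hD | |].
  by move=> j; rewrite ffunE mp /=; apply: half_line_word hD j.
apply/forallP => a; apply/forallP => a'; apply/implyP => /= h; rewrite ffunE.
case: ifP => // _; have /forallP /(_ a) /forallP /(_ a') := half_arc_words hD.
by rewrite h.
Qed.

Lemma stack_strip : stack (vert (@at_node n p x)) (strip D p) = D.
Proof.
have vD := half_valid hD; rewrite stack_vert; last exact: half_valid strip_half.
have mp' := half_top_mate hD mp.
have wp' : word D (inl p') = [:: x] by rewrite (word_eq_mate vD mp) wp.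
have pp' : p' != p by have := half_top_neq hD mp; rewrite eq_sym.
apply: eq_diagram => //= y; rewrite !ffunE mp.
have td z : top_deco (@at_node n p x) z = if z == inl p then [:: x] else [::].
  by case: z => [z|//]; rewrite (inj_eq inl_inj) /= /at_node -val_eqE.
rewrite !td mate_swap // mp.
have [->|y1] := eqVneq y (inl p); first by rewrite (inj_eq inl_inj) eq_sym (negPf pp') wp.
have [->|y2] := eqVneq y (inl p'); first by rewrite wp'.
by rewrite cats0.
Qed.
End Strip.

(** At an extreme node, restoring the blob is the action of e_0 or e_n. The term [n.+1] in
    [node_weight] makes a blob heavier than the bare arc left behind. *)
Lemma strip_reducible D (p p' : 'I_n) x : half D -> mate D (inl p) = inl p' ->
  word D (inl p) = [:: x] ->
  (x = L /\ p = 0%N :> nat) \/ (x = R /\ p = n.-1 :> nat) -> reducible D.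
Proof.
move=> hD mp wp hx; have vD := half_valid hD.
exists (vert (@at_node n p x)), (strip D p); split.
- by case: hx => -[-> ->]; rewrite -?left_vert -?right_vert; constructor.
- exact: strip_half hD mp.
- exact: stack_strip hD mp wp.
have mp' := half_top_mate hD mp.
have wp' : word D (inl p') = [:: x] by rewrite (word_eq_mate vD mp) wp.
have pp' : p' != p by have := half_top_neq hD mp; rewrite eq_sym.
rewrite /weight (bigD1 p) //= (bigD1 p') //= [X in (_ < X)%N](bigD1 p) //= [X in (_ < _ + X)%N](bigD1 p') //=.
have -> : (\sum_(a | (a != p) && (a != p')) node_weight (strip D p) a =
           \sum_(a | (a != p) && (a != p')) node_weight D a)%N.
  apply: eq_bigr => a /andP[h1 h2]; rewrite /node_weight /= ffunE mp !(inj_eq inl_inj).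
  by rewrite (negPf h1) (negPf h2).
rewrite /node_weight /= !ffunE mp mp' wp wp' !eqxx ?orbT /=.
have lp := ltn_ord p; have lp' := ltn_ord p'; rewrite -val_eqE /= in pp'.
by case: hx => -[-> ep] /=; case: ifP => h; case: ifP => h' //=; lia.
Qed.

Section Moves.
Variable D : diagram n m.+1.
Hypothesis hD : half D.
Let vD := half_valid hD.

Definition opening (a : 'I_n) := if mate D (inl a) is inl b then (a < b)%N else false.
Definition closing (a : 'I_n) := if mate D (inl a) is inl b then (b < a)%N else false.

Lemma openingP a : reflect (exists2 b, mate D (inl a) = inl b & (a < b)%N) (opening a).
Proof.
rewrite /opening; case e: (mate D (inl a)) => [b|b]; last by constructor=> -[].
by apply: (iffP idP) => [h|[c [<-]]]; [exists b|].
Qed.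
Lemma closingP a : reflect (exists2 b, mate D (inl a) = inl b & (b < a)%N) (closing a).
Proof.
rewrite /closing; case e: (mate D (inl a)) => [b|b]; last by constructor=> -[].
by apply: (iffP idP) => [h|[c [<-]]]; [exists b|].
Qed.

Lemma arc_dichotomy a b : mate D (inl a) = inl b -> ~~ opening a -> closing a.
Proof.
by move=> ab; rewrite /opening /closing ab; have := half_top_neq hD ab; lia.
Qed.

(** A node inside the arc would belong to an arc inside it; the node right after o would then be an
    opening end. *)
Lemma last_opening (o c : 'I_n) : mate D (inl o) = inl c -> (o < c)%N ->
  (forall x : 'I_n, opening x -> (o < x)%N -> (x < c)%N -> False) -> c = o.+1 :> nat.
Proof.
move=> oc lt H; have lc := ltn_ord c; apply/eqP; rewrite eqn_leq lt andbT leqNgt; apply/negP => gt.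
have lt' : (o.+1 < n)%N by lia.
have [d [/= md h1 h2]] := half_top_nested hD oc (c := Ordinal lt') (ltnSn o) gt.
apply: (H (Ordinal lt')) => //=; apply/openingP; exists d => //=.
by have /= := half_top_neq hD md; lia.
Qed.

Lemma first_closing (o c : 'I_n) : mate D (inl o) = inl c -> (c < o)%N ->
  (forall x : 'I_n, closing x -> (c < x)%N -> (x < o)%N -> False) -> o = c.+1 :> nat.
Proof.
move=> oc lt H; have lo := ltn_ord o; apply/eqP; rewrite eqn_leq lt andbT leqNgt; apply/negP => gt.
have lt' : (o.-1 < n)%N by lia.
have [||d [/= md h1 h2]] := half_top_nested hD (half_top_mate hD oc) (c := Ordinal lt') => /=; try lia.
apply: (H (Ordinal lt')) => /=; try lia; apply/closingP; exists d => //=.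
by have /= := half_top_neq hD md; lia.
Qed.

Variable z : 'I_n.
Hypothesis line_z : mate D (inl z) = inr ord0.

Lemma L_left (a b : 'I_n) : mate D (inl a) = inl b -> (a < b)%N -> word D (inl a) = [:: L] ->
  (forall x : 'I_n, (x < a)%N -> exists2 y : 'I_n, mate D (inl x) = inl y & (y < a)%N) /\ (a < z)%N.
Proof.
move=> ab lt wa; case: (half_arc_word hD ab lt) => [|[_ /forallP ex]|[]]; rewrite ?wa //.
have H (x : 'I_n) : (x < a)%N -> exists2 y : 'I_n, mate D (inl x) = inl y & (y < a)%N.
  by move=> xa; have := ex x; rewrite xa /=; case: (mate _ _) => // y ya; exists y.
split=> //; rewrite ltnNge leq_eqVlt; apply/negP => /orP[/eqP/val_inj e|/H[y]]; last by rewrite line_z.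
by move: ab; rewrite -e line_z.
Qed.

Lemma R_right (a b : 'I_n) : mate D (inl a) = inl b -> (a < b)%N -> word D (inl a) = [:: R] ->
  (forall x : 'I_n, (b < x)%N -> exists2 y : 'I_n, mate D (inl x) = inl y & (b < y)%N) /\ (z < b)%N.
Proof.
move=> ab lt wa; case: (half_arc_word hD ab lt) => [|[]|[_ /forallP ex]]; rewrite ?wa //.
have H (x : 'I_n) : (b < x)%N -> exists2 y : 'I_n, mate D (inl x) = inl y & (b < y)%N.
  by move=> xa; have := ex x; rewrite xa /=; case: (mate _ _) => // y ya; exists y.
split=> //; rewrite ltnNge leq_eqVlt; apply/negP => /orP[/eqP/val_inj e|/H[y]]; last by rewrite line_z.
by move: line_z; rewrite -e (half_top_mate hD ab).
Qed.

Lemma opening_word a : opening a ->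
  [\/ word D (inl a) = [::], word D (inl a) = [:: L] | word D (inl a) = [:: R]].
Proof.
by case/openingP => b ab lt; have [->|[-> _]|[-> _]] := half_arc_word hD ab lt; constructor.
Qed.

(** Take the leftmost opening end a with an L; by exposure only complete arcs lie to its left. If a
    = 0, the blob is stripped. Otherwise the last arc to open before a is an adjacent pair, bare
    because an L would contradict the choice of a and an R would have to lie beyond the first line;
    it is slid to the right, towards a. *)
Lemma L_reducible a : opening a -> word D (inl a) = [:: L] -> reducible D.
Proof.
move=> oa wa.
case: (arg_minnP (P := fun x => opening x && (word D (inl x) == [:: L])) (fun x : 'I_n => nat_of_ord x) (i0 := a)).
  by rewrite oa wa eqxx.
move=> {oa wa} {}a /andP[oa /eqP wa] amin.
have [b ab lt] := openingP _ oa.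
have [exL az] := L_left ab lt wa.
have [a0|a0] := posnP a; first by apply: (strip_reducible hD ab wa); left.
have o0 : opening (Ordinal (ltn_trans a0 (ltn_ord a))).
  have [y my ya] := exL (Ordinal (ltn_trans a0 (ltn_ord a))) a0.
  by apply/openingP; exists y => //=; have /= := half_top_neq hD my; lia.
case: (arg_maxnP (P := fun x => opening x && (x < a)%N) (fun x : 'I_n => nat_of_ord x) (i0 := Ordinal (ltn_trans a0 (ltn_ord a)))).
  by rewrite o0.
move=> o /andP[oo oa'] omax.
have [c oc ltoc] := openingP _ oo.
have ca : (c < a)%N by have [y my ya] := exL _ oa'; move: my ya; rewrite oc => -[->].
have ec : c = o.+1 :> nat.
  apply: last_opening => // x ox h1 h2; have /= := omax x; rewrite ox (ltn_trans h2 ca) => /(_ isT); lia.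
have wo : word D (inl o) = [::].
  have [//|h|h] := opening_word oo.
    by exfalso; have /= := amin o; rewrite oo h eqxx => /(_ isT); lia.
  by have [_ h'] := R_right oc ltoc h; exfalso; lia.
have la := ltn_ord a.
have lt' : (o.+2 < n)%N by lia.
apply: (@slide_reducible D o c (Ordinal lt')) => //=; first by left; lia.
rewrite (slide_weight_i hD oc wo) /=; last by left; lia.
have [ea|ne] := eqVneq (o.+2) a.
  have -> : Ordinal lt' = a by apply: val_inj.
  by rewrite /node_weight ab lt wa /=; case: ifP => _; lia.
have [y my ya] : exists2 y : 'I_n, mate D (inl (Ordinal lt')) = inl y & (y < a)%N by apply: exL => /=; lia.
have nl := half_top_neq hD my; rewrite /= in nl.
have ny : (o.+2 < y)%N = false.
  apply/negP => h; have /= := omax (Ordinal lt').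
  have -> : opening (Ordinal lt') by apply/openingP; exists y.
  by move=> /(_ _); have -> : (o.+2 < a)%N by [lia]; move=> /(_ isT); lia.
rewrite /node_weight my /= ny.
have wy : word D (inl (Ordinal lt')) != [:: R].
  apply/eqP => w; have my' := half_top_mate hD my.
  have [] := R_right my' _ _; rewrite /=; try lia.
  by rewrite (word_eq_mate vD my) w.
rewrite (negPf wy); lia.
Qed.

(** Mirror image of [L_reducible], with R seen from closing ends: the first arc to close beyond the
    rightmost such end is a bare adjacent pair, slid to the left. *)
Lemma R_reducible d : closing d -> word D (inl d) = [:: R] -> reducible D.
Proof.
move=> cd wd.
case: (arg_maxnP (P := fun x => closing x && (word D (inl x) == [:: R])) (fun x : 'I_n => nat_of_ord x) (i0 := d)).
  by rewrite cd wd eqxx.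
move=> {cd wd} {}d /andP[cd /eqP wd] dmax.
have [c dc lt] := closingP _ cd.
have cdm := half_top_mate hD dc.
have wc : word D (inl c) = [:: R] by rewrite (word_eq_mate vD dc) wd.
have [exR dz] := R_right cdm lt wc.
have ld := ltn_ord d.
have [dn|dn] := eqVneq (d : nat) n.-1; first by apply: (strip_reducible hD dc wd); right.
have ln : (n.-1 < n)%N by lia.
have o0 : closing (Ordinal ln).
  have [|y my ya] := exR (Ordinal ln) _; first by rewrite /=; lia.
  by apply/closingP; exists y => //=; have /= := half_top_neq hD my; have := ltn_ord y; lia.
case: (arg_minnP (P := fun x => closing x && (d < x)%N) (fun x : 'I_n => nat_of_ord x) (i0 := Ordinal ln)).
  by rewrite o0 /=; lia.
move=> o /andP[oo od] omin.
have [e oe lteo] := closingP _ oo.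
have de : (d < e)%N by have [y my ya] := exR _ od; move: my ya; rewrite oe => -[->].
have eo := half_top_mate hD oe.
have ee : o = e.+1 :> nat.
  apply: first_closing => // x cx h1 h2; have /= := omin x; rewrite cx (ltn_trans de h1) => /(_ isT); lia.
have wo : word D (inl o) = [::].
  have oe' : opening e by apply/openingP; exists o.
  rewrite (word_eq_mate vD eo); have [->|h|h] := opening_word oe' => //.
    by have [_ h'] := L_left eo lteo h; exfalso; lia.
  exfalso; have /= := dmax o; rewrite oo (word_eq_mate vD eo) h eqxx => /(_ isT); lia.
have lo := ltn_ord o.
have lt' : (o.-2 < n)%N by lia.
apply: (@slide_reducible D o e (Ordinal lt')) => //=; first by right; lia.
rewrite (slide_weight_i hD oe wo) /=; last by right; lia.
have [ed|ne] := eqVneq (o.-2) d.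
  have -> : Ordinal lt' = d by apply: val_inj.
  rewrite /node_weight dc wd /=.
  have -> : (d < c) = false by lia.
  have -> : (o.-2 < c) = false by lia.
  lia.
have [y my ya] : exists2 y : 'I_n, mate D (inl (Ordinal lt')) = inl y & (d < y)%N by apply: exR => /=; lia.
have nl := half_top_neq hD my; rewrite /= in nl.
have ny : (o.-2 < y)%N.
  rewrite ltnNge; apply/negP => h; have /= := omin (Ordinal lt').
  have -> : closing (Ordinal lt') by apply/closingP; exists y => //=; lia.
  by have -> : (d < o.-2)%N by [lia]; move=> /(_ isT); lia.
have wy : word D (inl (Ordinal lt')) = [::].
  have oy : opening (Ordinal lt') by apply/openingP; exists y.
  have [//|h|h] := opening_word oy.
    by have [_ /= h'] := L_left my ny h; exfalso; lia.
  have my' := half_top_mate hD my.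
  have cy : closing y by apply/closingP; exists (Ordinal lt').
  exfalso; have /= := dmax y; rewrite cy (word_eq_mate vD my) h eqxx => /(_ isT); lia.
rewrite /node_weight my /= ny wy /=; lia.
Qed.

(** Lines and bare closing ends weigh nothing, so a pair sliding one place to the right past them
    lowers the weight by one. *)
Lemma bare_reducible (i j l : 'I_n) : (forall a, opening a -> word D (inl a) = [::]) ->
  mate D (inl i) = inl j -> j = i.+1 :> nat -> l = j.+1 :> nat -> ~~ opening l -> reducible D.
Proof.
move=> bare ij ej el nl.
have oi : opening i by apply/openingP; exists j; rewrite ?ej.
have wi := bare i oi.
apply: (@slide_reducible D i j l) => //; first by left.
rewrite (slide_weight_i hD ij wi); last by left.
rewrite /node_weight; have := ltn_ord l.
case e: (mate D (inl l)) => [b|b]; last by lia.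
have := nl; rewrite /opening e => /negPf ->.
have cl : closing l by apply: arc_dichotomy e nl.
have [b' lb' lt] := closingP _ cl.
have bl := half_top_mate hD lb'.
have -> : word D (inl l) = [::].
  by rewrite (word_eq_mate vD bl) bare //; apply/openingP; exists l.
by rewrite /=; lia.
Qed.
End Moves.
End Generation.

Section Bare.
Variables (n m : nat) (e1 e2 : int).
Implicit Types D : diagram n m.+1.
Local Notation half D := (half_diagram e1 e2 D).

Definition bare D : Prop :=
  forall a b : 'I_n, mate D (inl a) = inl b -> word D (inl a) = [::].

Lemma bare_word D x : half D -> bare D -> word D x =
  match x with
  | inr j => line_word e1 e2 j
  | inl a => if mate D (inl a) is inr j then rev (line_word e1 e2 j) else [::]
  end.
Proof.
move=> hD bD; case: x => [a|j]; last exact: half_line_word.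
case e: (mate D (inl a)) => [b|j]; first exact: bD e.
rewrite -(half_line_word hD j) -(word_mate _ (half_valid hD)) -e mateK //.
exact: half_valid hD.
Qed.

Lemma bare_eq D D' : half D -> half D' -> bare D -> bare D' ->
  (forall a, mate D (inl a) = mate D' (inl a)) -> D = D'.
Proof.
move=> hD hD' bD bD' em; apply: eq_diagram => [[a|j]|x|] //; last by rewrite !(half_loops (e1 := e1) (e2 := e2)).
  have [a ea] := half_line hD j; rewrite ea -(mateK (half_valid hD') (inl a)) -em -ea mateK //.
  exact: half_valid hD.
by rewrite !bare_word //; case: x => // a; rewrite em.
Qed.
End Bare.

(** * The standard half-diagram is the only irreducible one *)

Section Standard.
Variables (n m : nat) (e1 e2 : int).
Hypotheses (lt_mn : (m.+1 <= n)%N) (par : ~~ odd (n - m.+1)).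
Implicit Types D : diagram n m.+1.
Local Notation half D := (half_diagram e1 e2 D).

Definition std_mate (a : 'I_n) : node n m.+1 :=
  if insub (val a) is Some j then inr j else inl (partner m a).

(* The lines come first; they are followed by the pairs (m+1, m+2), (m+3, m+4), ... *)
Definition standard : diagram n m.+1 :=
  Diagram [ffun x => match x with inl a => std_mate a | inr j => inl (line_node lt_mn j) end]
    [ffun x => match x with
       | inl a => if std_mate a is inr j then rev (line_word e1 e2 j) else [::]
       | inr j => line_word e1 e2 j end] [::].

Lemma std_mate_line (a : 'I_n) (j : 'I_m.+1) : a = j :> nat -> std_mate a = inr j.
Proof.
move=> e; rewrite /std_mate insubT /= ?e // => lt.
by congr inr; apply: val_inj.
Qed.
Lemma std_mate_arc (a : 'I_n) : (m < a)%N -> std_mate a = inl (partner m a).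
Proof. by move=> lt; rewrite /std_mate insubF //; apply/negbTE; rewrite -leqNgt. Qed.

Lemma std_lineP (a : 'I_n) : (a <= m)%N -> exists2 j : 'I_m.+1, a = j :> nat & std_mate a = inr j.
Proof. by move=> le; exists (Ordinal (le : (a < m.+1)%N)) => //; apply: std_mate_line. Qed.

Lemma partner_gt (a : 'I_n) : (m < a)%N -> (m < partner m a)%N.
Proof. by move=> lt; rewrite val_partner // /flip; case: ifP => o; lia. Qed.
Lemma partnerK (a : 'I_n) : (m < a)%N -> partner m (partner m a) = a.
Proof.
move=> lt; apply: val_inj; have lt' := partner_gt lt.
rewrite /= val_partner // val_partner // /flip.
by case: (boolP (odd (a - m.+1))) => o; case: ifP => o'; lia.
Qed.

Lemma standard_valid : valid standard.
Proof.
split=> [[a|j]|[a|j]|[a|j]].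
- rewrite [mate _ (inl a)]ffunE; have [le|lt] := leqP a m.
    have [j ej ->] := std_lineP le; rewrite ffunE; congr inl; exact: val_inj.
  by rewrite std_mate_arc // ffunE std_mate_arc ?partner_gt // partnerK.
- by rewrite [mate _ (inr j)]ffunE ffunE; apply: std_mate_line.
- rewrite ffunE; have [le|lt] := leqP a m; first by have [j ej ->] := std_lineP le.
  rewrite std_mate_arc // (inj_eq inl_inj) -val_eqE /= val_partner // /flip.
  by case: ifP => o; lia.
- by rewrite ffunE.
- rewrite [mate _ (inl a)]ffunE !ffunE; have [le|lt] := leqP a m.
    by have [j ej ->] := std_lineP le; rewrite revK.
  by rewrite !std_mate_arc ?partner_gt.
- by rewrite [mate _ (inr j)]ffunE !ffunE (@std_mate_line _ j).
Qed.

Lemma standard_half : half standard.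
Proof.
apply: half_intro => //; first exact: standard_valid.
- have pm x : pos (mate standard x) =
      match x with
      | inl a => if (a <= m)%N then (n + (m - a))%N else flip m.+1 a
      | inr j => (j : nat)
      end.
    case: x => [a|j]; rewrite ffunE //; case: ifP => le.
      by have [j ej ->] := std_lineP le; rewrite /= -ej.
    have lt : (m < a)%N by rewrite ltnNge le.
    by rewrite std_mate_arc //= val_partner.
  move=> x y; rewrite !pm /flip; apply/negP => /and3P[].
  case: x => [a|j]; case: y => [b|j'] /=; try (have := ltn_ord a); try (have := ltn_ord b);
    try (have := ltn_ord j); try (have := ltn_ord j');
    repeat (case: ifP => ?); lia.
- by move=> j; exists (line_node lt_mn j); rewrite ffunE.
- by move=> j; rewrite ffunE.
apply/forallP => a; apply/forallP => a'; apply/implyP => /andP[/eqP ea _].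
by rewrite ffunE; move: ea; rewrite ffunE => ->.
Qed.

Lemma standard_bare : bare standard.
Proof. by move=> a b; rewrite !ffunE => ->. Qed.

Section Irreducible.
Variable D : diagram n m.+1.
Hypotheses (hD : half D) (irr : ~ reducible e1 e2 D).
Let vD := half_valid hD.

Lemma irreducible_bare_open a : opening D a -> word D (inl a) = [::].
Proof.
have [z ez] := half_line hD ord0.
have lz : mate D (inl z) = inr ord0 by rewrite -ez mateK.
move=> oa; have [//|h|h] := opening_word hD oa.
  by case: irr; apply: (L_reducible hD lz oa h).
have [b ab lt] := openingP _ _ oa; have ba := half_top_mate hD ab.
case: irr; apply: (R_reducible hD lz (d := b)); first by apply/closingP; exists a.
by rewrite (word_eq_mate vD ab) h.
Qed.

Lemma irreducible_bare : bare D.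
Proof.
move=> a b ab; have [oa|na] := boolP (opening D a); first exact: irreducible_bare_open.
have [b' ab' lt] := closingP _ _ (arc_dichotomy hD ab na).
have ba := half_top_mate hD ab'.
by rewrite (word_eq_mate vD ba) irreducible_bare_open //; apply/openingP; exists a.
Qed.

(** The last end o that opens in [a, b) belongs to an adjacent pair. If that pair did not close at
    b, the node after it would not be an opening end and the pair could slide to the right. *)
Lemma irreducible_pair a b : mate D (inl a) = inl b -> (a < b)%N -> b = a.+1 :> nat.
Proof.
move=> ab lt.
have oa : opening D a by apply/openingP; exists b.
case: (arg_maxnP (P := fun x => opening D x && ((a <= x) && (x < b))%N) (fun x : 'I_n => nat_of_ord x) (i0 := a)).
  by rewrite oa leqnn lt.
move=> o /andP[oo /andP[ao ob]] omax; rewrite /geq /= in omax.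
have [c oc ltoc] := openingP _ _ oo.
have cb : (c <= b)%N.
  have [ea|ne] := eqVneq (o : nat) a.
    by move: oc; rewrite (val_inj ea) ab => -[->].
  have [||d [md h1 h2]] := half_top_nested hD ab (c := o); try lia.
  by move: md; rewrite oc => -[->]; lia.
have ec : c = o.+1 :> nat.
  apply: (last_opening hD oc ltoc) => x ox h1 h2; have := omax x; rewrite ox /=.
  have -> : (a <= x)%N by lia.
  by have -> : (x < b)%N by [lia]; move=> /(_ isT); lia.
have [cb'|] := eqVneq (c : nat) b.
  have e : mate D (inl b) = inl o by rewrite -(val_inj cb'); exact: (half_top_mate hD oc).
  by move: (half_top_mate hD ab); rewrite e => -[<-]; rewrite -cb'.
move=> ncb; have lb := ltn_ord b; have lt' : (c.+1 < n)%N by lia.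
case: irr; apply: (bare_reducible (i := o) (j := c) (l := Ordinal lt') hD irreducible_bare_open oc) => //.
apply/negP => ol; have [eb|nb] := eqVneq (c.+1) (b : nat).
  have [d /= bd bd'] := openingP _ _ ol.
  have e : Ordinal lt' = b by apply: val_inj.
  by move: bd; rewrite e (half_top_mate hD ab) => -[ea]; move: bd'; rewrite -ea; lia.
have := omax (Ordinal lt'); rewrite ol /=.
have -> : (a <= c.+1)%N by lia.
by have -> : (c.+1 < b)%N by [lia]; move=> /(_ isT); lia.
Qed.

(** Otherwise the pair at a could slide past c. Hence from any opening end on, adjacent pairs fill
    the row to its end, and no line stands to the right of an arc. *)
Lemma irreducible_next (a c : 'I_n) : opening D a -> c = a.+2 :> nat -> opening D c.
Proof.
move=> oa ec; apply/negPn/negP => nc; have [b ab lt] := openingP _ _ oa.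
have eb := irreducible_pair ab lt.
by case: irr; apply: (bare_reducible (i := a) (j := b) (l := c) hD irreducible_bare_open ab) => //; lia.
Qed.

Lemma irreducible_openings (a : 'I_n) k (c : 'I_n) : opening D a -> c = (a + k.*2)%N :> nat -> opening D c.
Proof.
elim: k c => [|k IH] c oa ec; first by have -> : c = a by apply: val_inj; rewrite /= ec addn0.
have lc := ltn_ord c; have lt : (a + k.*2 < n)%N by lia.
apply: (irreducible_next (a := Ordinal lt)) => /=; last by lia.
exact: IH.
Qed.

Lemma irreducible_mate (a x : 'I_n) : opening D a -> (a <= x)%N ->
  exists2 y : 'I_n, mate D (inl x) = inl y &
    y = (if odd (x - a) then x.-1 else x.+1) :> nat.
Proof.
move=> oa ax; have lx := ltn_ord x; case: ifP => o.
  have lt : (x.-1 < n)%N by lia.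
  have ox : opening D (Ordinal lt).
    by apply: (irreducible_openings (k := (x - a)./2) oa) => /=; lia.
  have [b xb ltb] := openingP _ _ ox; have eb := irreducible_pair xb ltb; rewrite /= in eb.
  have bx : b = x by apply: val_inj => /=; lia.
  by exists (Ordinal lt) => //; have := half_top_mate hD xb; rewrite bx.
have ox : opening D x by apply: (irreducible_openings (k := (x - a)./2) oa) => /=; lia.
by have [b xb ltb] := openingP _ _ ox; exists b => //; apply: irreducible_pair.
Qed.

Lemma irreducible_line_below (x y : 'I_n) j : mate D (inl x) = inr j -> (y < x)%N ->
  exists j', mate D (inl y) = inr j'.
Proof.
move=> xj yx; case ey: (mate D (inl y)) => [w|j']; last by exists j'.
have absurd o : opening D o -> (o <= x)%N -> False.
  by move=> oo ox; have [w' mx _] := irreducible_mate oo ox; move: mx; rewrite xj.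
have [oy|ny] := boolP (opening D y); first by case: (absurd y oy); lia.
have [w' yw lt] := closingP _ _ (arc_dichotomy hD ey ny).
case: (absurd w'); last by lia.
by apply/openingP; exists y => //; exact: (half_top_mate hD yw).
Qed.

(** Every node to the left of a line is on a line, and lines keep their order, so x and j have
    equally many predecessors. *)
Lemma irreducible_line (x : 'I_n) (j : 'I_m.+1) : mate D (inl x) = inr j -> x = j :> nat.
Proof.
move=> xj; apply/eqP; rewrite eqn_leq; apply/andP; split.
  have H k (y : 'I_n) j' : y = k :> nat -> mate D (inl y) = inr j' -> (k <= j')%N.
    elim: k y j' => [//|k IH] y j' yk yj'.
    have ly := ltn_ord y; have lt : (k < n)%N by lia.
    have [|j'' hj''] := irreducible_line_below (y := Ordinal lt) yj'; first by rewrite yk.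
    have h1 := IH _ _ (erefl _ : Ordinal lt = k :> nat) hj''.
    by have /= := half_lines_mono hD hj'' yj'; rewrite yk => /(_ (ltnSn k)); lia.
  exact: (H x x j).
have H k (i : 'I_m.+1) (y : 'I_n) : i = k :> nat -> mate D (inr i) = inl y -> (k <= y)%N.
  elim: k i y => [//|k IH] i y ik iy.
  have li := ltn_ord i; have lt : (k < m.+1)%N by lia.
  have [y' hy'] := half_line hD (Ordinal lt).
  have h1 := IH _ _ (erefl _ : Ordinal lt = k :> nat) hy'.
  have yi : mate D (inl y) = inr i by rewrite -iy mateK.
  have y'i : mate D (inl y') = inr (Ordinal lt) by rewrite -hy' mateK.
  have [lt1|lt1|e1'] := ltngtP y' y; first by lia.
    by have /= := half_lines_mono hD yi y'i lt1; rewrite ik; lia.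
  by move: yi; rewrite -(val_inj e1') y'i => -[/(congr1 val)] /=; rewrite ik; lia.
by apply: (H j j x) => //; rewrite -xj mateK.
Qed.

Lemma irreducible_standard : D = standard.
Proof.
apply: (bare_eq hD standard_half irreducible_bare standard_bare).
have low (a : 'I_n) (j : 'I_m.+1) : a = j :> nat -> mate D (inl a) = inr j.
  move=> e; have [x jx] := half_line hD j; have xj : mate D (inl x) = inr j by rewrite -jx mateK.
  by have ex := irreducible_line xj; have -> : a = x by apply: val_inj; rewrite /= e ex.
move=> a; rewrite [RHS]ffunE; have [le|lt] := leqP a m.
  by have [j ej ->] := std_lineP le; apply: low.
rewrite std_mate_arc //; have la := ltn_ord a; have lt1 : (m.+1 < n)%N.
  by move: par; lia.
have o1 : opening D (Ordinal lt1).
  case e: (mate D (inl (Ordinal lt1))) => [b|j]; last by have /= := irreducible_line e; have := ltn_ord j; lia.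
  apply/negPn/negP => no; have [b' /= eb lb] := closingP _ _ (arc_dichotomy hD e no).
  have [j ej _] := std_lineP (lb : (b' <= m)%N).
  by move: (low _ _ ej); rewrite (half_top_mate hD eb).
have [|y -> ey] := irreducible_mate (x := a) o1; first by rewrite /=.
by congr inl; apply: val_inj; rewrite /= val_partner // ey.
Qed.
End Irreducible.

Inductive reach : diagram n m.+1 -> Prop :=
| reach_standard : reach standard
| reach_step g D : generator g -> reach D -> half (stack g D) -> reach (stack g D).

(** Descent on [weight]: each reduction exhibits [D] as a generator stacked on a lighter
    half-diagram. *)
Lemma half_reach D : half D -> reach D.
Proof.
move: {2}(weight D).+1 (ltnSn (weight D)) => w; elim: w D => // w IH D; rewrite ltnS => le hD.
have [[g [D' [gg hD' eD lt]]]|irr] := pselect (reducible e1 e2 D).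
  by rewrite -eD; apply: reach_step; rewrite ?eD //; apply: IH => //; apply: leq_trans lt le.
by rewrite (irreducible_standard hD irr); apply: reach_standard.
Qed.

Definition top (i : nat) : 'I_n := insubd (Ordinal lt_mn) i.
Lemma val_top i : (i < n)%N -> top i = i :> nat.
Proof. by move=> lt; rewrite val_insubd lt. Qed.

(* The last line crosses the pairs one by one. *)
Fixpoint moved (r : nat) : diagram n m.+1 :=
  if r is r'.+1 then stack (hook_diagram (top (m + r'.*2).+1) (top (m + r'.*2))) (moved r')
  else standard.

Lemma movedP r : (m + r.*2 < n)%N ->
  [/\ half (moved r), bare (moved r), mate (moved r) (inl (top (m + r.*2))) = inr ord_max &
      forall a : 'I_n, (m + r.*2 < a)%N -> mate (moved r) (inl a) = inl (partner m a)].
Proof.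
elim: r => [|r IH] lt.
  split; [exact: standard_half | exact: standard_bare | |].
    by rewrite ffunE addn0 (@std_mate_line _ ord_max) // val_top.
  by move=> a h; rewrite ffunE std_mate_arc //; lia.
have [|hD bD lD aD] := IH; first by lia.
set i := top (m + r.+1.*2); set j := top (m + r.*2).+1; set l := top (m + r.*2).
have vi : i = (m + r.+1.*2)%N :> nat by rewrite val_top.
have vj : j = (m + r.*2).+1 :> nat by rewrite val_top //; lia.
have vl : l = (m + r.*2)%N :> nat by rewrite val_top //; lia.
have Dij : mate (moved r) (inl i) = inl j.
  rewrite aD; last by rewrite vi; lia.
  congr inl; apply: val_inj; rewrite /= val_partner //; last by rewrite vi; lia.
  by rewrite /flip vi vj; case: ifP; lia.
have vD := half_valid hD.
have li : l != i by rewrite -val_eqE /= vi vl; lia.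
have lj : l != j by rewrite -val_eqE /= vj vl; lia.
have ij : i != j by rewrite -val_eqE /= vj vi; lia.
have cons : (j = i.+1 :> nat /\ l = j.+1 :> nat) \/ (i = j.+1 :> nat /\ j = l.+1 :> nat).
  by right; rewrite vi vj vl; lia.
have wi := bD _ _ Dij.
have sm x : mate (moved r.+1) x = _ := slide_mate vD Dij li lj x.
have ninl (x y : 'I_n) : x != y -> (inl x == inl y :> node n m.+1) = false.
  by rewrite (inj_eq inl_inj) => /negPf.
split.
- exact: slide_half hD Dij wi cons.
- move=> a b; rewrite sm [word _ _](slide_word vD Dij wi li lj) lD.
  case: eqVneq => //= _; case: eqVneq => //= _; case: eqVneq => //= _.
  exact: bD.
- by rewrite sm (ninl _ _ ij) [inl i == inl l]eq_sym (ninl _ _ li) eqxx lD.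
move=> a ha; have ai : a != i by rewrite -val_eqE /= vi; lia.
have aj : a != j by rewrite -val_eqE /= vj; lia.
have al : a != l by rewrite -val_eqE /= vl; lia.
by rewrite sm !ninl // lD /= aD //; lia.
Qed.

Lemma moved_back r : (m + r.+1.*2 < n)%N ->
  stack (hook_diagram (top (m + r.*2).+1) (top (m + r.*2).+2)) (moved r.+1) = moved r.
Proof.
move=> lt; have [|hD bD lD aD] := @movedP r; first by lia.
have vi : top (m + r.*2).+2 = (m + r.*2).+2 :> nat by rewrite val_top //; lia.
have vj : top (m + r.*2).+1 = (m + r.*2).+1 :> nat by rewrite val_top //; lia.
have vl : top (m + r.*2) = (m + r.*2)%N :> nat by rewrite val_top //; lia.
rewrite hook_diagramC; apply: slide_back.
- exact: half_valid hD.
- rewrite aD; last by rewrite vi; lia.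
  congr inl; apply: val_inj; rewrite /= val_partner //; last by rewrite vi; lia.
  by rewrite /flip vi vj; case: ifP; lia.
- apply: (bD _ (top (m + r.*2).+1)); rewrite aD; last by rewrite vi; lia.
  congr inl; apply: val_inj; rewrite /= val_partner //; last by rewrite vi; lia.
  by rewrite /flip vi vj; case: ifP; lia.
- by rewrite -val_eqE /= vi vl; lia.
- by rewrite -val_eqE /= vj vl; lia.
Qed.

Hypothesis lab0 : (m == 0%N) ==> ((e1 == 1) && (e2 == 1)).

Lemma reduced_lift D : half D -> reduced (lift_diagram lt_mn D).
Proof.
move=> hD; apply: reduced_short; first exact: half_loops hD.
by move=> y; rewrite ffunE; case: (narrow_node m y) => [x|] //; apply: half_word_size lab0.
Qed.

Lemma basic_lift_stack g D : generator g -> half (stack g D) -> basic (lift_diagram lt_mn D) ->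
  basic (lift_diagram lt_mn (stack g D)).
Proof.
move=> gg hS bD; have rS := reduced_lift hS; rewrite -stack_lift // in rS *.
exact: basic_stack.
Qed.

Lemma reach_basic D : basic (lift_diagram lt_mn standard) -> reach D -> basic (lift_diagram lt_mn D).
Proof. by move=> b0; elim=> // g {}D gg _ bD hS; apply: basic_lift_stack. Qed.

Lemma moved_basic r : (m + r.*2 < n)%N -> basic (lift_diagram lt_mn standard) ->
  basic (lift_diagram lt_mn (moved r)).
Proof. by move=> lt b0; apply: reach_basic => //; apply: half_reach; have [] := movedP lt. Qed.

(** Moving the last line is undone by hooks, so it may be decorated in whatever position is
    convenient. *)
Lemma standard_basic_of_moved r : (m + r.*2 < n)%N -> basic (lift_diagram lt_mn (moved r)) ->
  basic (lift_diagram lt_mn standard).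
Proof.
elim: r => // r IH lt br; apply: IH; first by lia.
rewrite -moved_back //; apply: basic_lift_stack => //; last first.
  by rewrite moved_back //; have [|] := @movedP r; first by lia.
by apply: gen_hook; rewrite !val_top //; lia.
Qed.
End Standard.

(** * The completed standard half-diagram is obtained from generators *)

Section StandardBasic.
Variables (n m : nat).
Hypotheses (lt_mn : (m.+1 <= n)%N) (par : ~~ odd (n - m.+1)).
Local Notation standard e1 e2 := (standard e1 e2 lt_mn).
Local Notation moved e1 e2 := (moved e1 e2 lt_mn).
Local Notation top := (top lt_mn).

Lemma line_word_plain (j : 'I_m.+1) : line_word 1 1 j = [::].
Proof. by rewrite /line_word !andbF. Qed.

Definition hooks (r : nat) : diagram n n :=
  Diagram [ffun y : node n n => match y with
     | inl a => if (m < a < m.+1 + r.*2)%N then inl (partner m a) else inr a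
     | inr a => if (m < a < m.+1 + r.*2)%N then inr (partner m a) else inl a end]
   [ffun => [::]] [::].

Lemma hooks_stack r : (m.+1 + r.*2 < n)%N -> valid (hooks r) ->
  stack (hook_diagram (top (m.+1 + r.*2)) (top (m.+1 + r.*2).+1)) (hooks r) = hooks r.+1.
Proof.
move=> lt vU; have lt' : ((m.+1 + r.*2).+1 < n)%N by move: par; lia.
have vi := val_top lt_mn lt; have vj := val_top lt_mn lt'.
set i := top (m.+1 + r.*2) in vi *; set j := top _.+1 in vj *.
have ij : i != j by rewrite -val_eqE /= vi vj; lia.
have pi_ : partner m i = j.
  by apply: val_inj; rewrite /= val_partner ?vi ?vj // /flip; [case: ifP|]; lia.
have pj : partner m j = i.
  by apply: val_inj; rewrite /= val_partner ?vi ?vj // /flip; [case: ifP|]; lia.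
have mi : mate (hooks r) (inl i) = inr i.
  by rewrite ffunE vi ltnn andbF.
have mj : mate (hooks r) (inl j) = inr j.
  by rewrite ffunE vj [((m.+1 + r.*2).+1 < _)%N](_ : _ = false) ?andbF //; lia.
rewrite stack_hook_open ?mi //; apply: eq_diagram => // y; rewrite !ffunE; last first.
  by rewrite /hook_words !ffunE; do !case: ifP.
rewrite /hook_mates mi mj.
have range (a : 'I_n) : a != i -> a != j -> (m < a < m.+1 + r.+1.*2)%N = (m < a < m.+1 + r.*2)%N.
  by rewrite -!val_eqE /= vi vj; lia.
case: y => a; rewrite ?(inj_eq inl_inj) ?(inj_eq inr_inj) /=.
  have [->|ai] := eqVneq a i; first by rewrite vi pi_ ifT //; lia.
  have [->|aj] := eqVneq a j; first by rewrite vj pj ifT //; lia.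
  by rewrite ffunE range.
have [->|ai] := eqVneq a i; first by rewrite vi pi_ ifT //; lia.
have [->|aj] := eqVneq a j; first by rewrite vj pj ifT //; lia.
by rewrite ffunE range.
Qed.

Lemma hooks_obtained r : (m + r.*2 < n)%N -> obtained (hooks r).
Proof.
elim: r => [|r IH] lt.
  suff -> : hooks 0 = id_diagram n by constructor.
  apply: eq_diagram => // y; rewrite !ffunE //.
  by case: y => a /=; rewrite ifF //; lia.
have oU : obtained (hooks r) by apply: IH; lia.
have lt1 : (m.+1 + r.*2 < n)%N by lia.
rewrite -(hooks_stack lt1 (obtained_valid oU)); apply: obtained_stack => //.
by apply: gen_hook; rewrite !val_top //; lia.
Qed.

Lemma lift_standard_plain : lift_diagram lt_mn (standard 1 1) = hooks (n - m.+1)./2.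
Proof.
have rg (a : 'I_n) : (m < a < m.+1 + (n - m.+1)./2.*2)%N = (m < a)%N.
  by have := ltn_ord a; move: par; lia.
apply: eq_diagram => // y; last first.
  rewrite !ffunE; case: (narrow_node m y) => [x|] //; rewrite ffunE; case: x => [a|j]; last exact: line_word_plain.
  by case: (std_mate m a) => // j; rewrite line_word_plain.
case: y => a; rewrite !ffunE rg; have [le|lt] := leqP a m.
- rewrite /= ?ffunE.
  have [j ej ->] := std_lineP le.
  by congr inr; apply: val_inj.
- by rewrite /= ffunE std_mate_arc.
- have [j ej _] := std_lineP le.
  have -> : narrow_node m (inr a) = Some (inr j).
    by rewrite /= insubT; congr (Some (inr _)); apply: val_inj.
  by rewrite ffunE /=; congr inl; apply: val_inj.
- by rewrite narrow_gt.
Qed.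

Lemma standard_basic_plain : basic (lift_diagram lt_mn (standard 1 1)).
Proof.
apply/andP; split; first apply: (reduced_lift (e1 := 1) (e2 := 1)).
- exact/implyP.
- exact: standard_half.
by apply/asboolP; rewrite lift_standard_plain; apply: hooks_obtained; move: par lt_mn; lia.
Qed.

Lemma moved_mate e1 e2 r a : (m + r.*2 < n)%N ->
  mate (moved e1 e2 r) a = mate (moved 1 1 r) a.
Proof.
elim: r a => [|r IH] a lt; first by rewrite !ffunE.
have {}IH b : mate (moved e1 e2 r) b = mate (moved 1 1 r) b by apply: IH; lia.
have [|h1 b1 l1 a1] := @movedP n m e1 e2 lt_mn par r; first by lia.
have [|h2 b2 l2 a2] := @movedP n m 1 1 lt_mn par r; first by lia.
have vj : top (m + r.*2).+1 = (m + r.*2).+1 :> nat by rewrite val_top //; lia.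
have vl : top (m + r.*2) = (m + r.*2)%N :> nat by rewrite val_top //; lia.
have jl : top (m + r.*2).+1 != top (m + r.*2) by rewrite -val_eqE /= vj vl; lia.
have mS f1 f2 : moved f1 f2 r.+1 =
  stack (hook_diagram (top (m + r.*2).+1) (top (m + r.*2))) (moved f1 f2 r) by [].
have v1 := half_valid h1; have v2 := half_valid h2.
have o1 : mate (moved 1 1 r) (inl (top (m + r.*2).+1)) != inl (top (m + r.*2)).
  by rewrite mate_swap // l2.
rewrite !mS !stack_hook_open ?IH //.
by rewrite !ffunE /hook_mates !IH.
Qed.

Hypothesis m_gt0 : (0 < m)%N.

Lemma line_word_right (j : 'I_m.+1) : line_word 1 (-1) j = if j == ord_max then [:: R] else [::].
Proof. by rewrite /line_word andbF /= andbT. Qed.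

(** For this r the last line stands at the last node, where e_n decorates it. *)
Lemma moved_right r : (m + r.*2)%N = n.-1 -> stack (right_diagram n) (moved 1 1 r) = moved 1 (-1) r.
Proof.
move=> er; have lt : (m + r.*2 < n)%N by lia.
have [h1 b1 l1 a1] := @movedP n m 1 1 lt_mn par r lt.
have [h2 b2 l2 a2] := @movedP n m 1 (-1) lt_mn par r lt.
have v1 := half_valid h1.
rewrite right_vert stack_vert //; apply: eq_diagram => [x|x|] /=.
- by rewrite (@moved_mate 1 (-1)).
- rewrite ffunE (bare_word _ h1 b1) (bare_word _ h2 b2).
  have td y : top_deco (@at_node n n.-1 R) y = if y == inl (top n.-1) :> node n m.+1 then [:: R] else [::].
    by case: y => [y|//]; rewrite (inj_eq inl_inj) /= /at_node -val_eqE /= val_top //; lia.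
  rewrite er in l1.
  have ml : inl (top n.-1) = mate (moved 1 1 r) (inr ord_max) by rewrite -l1 mateK.
  rewrite !td ml (inj_eq (inv_inj (mateK v1))) -ml.
  case: x => [a|j].
    rewrite (@moved_mate 1 (-1)) //.
    have [ea|na] := eqVneq (inl a : node n m.+1) (inl (top n.-1)).
      by rewrite ea l1 /= line_word_plain line_word_right eqxx.
    case e: (mate (moved 1 1 r) (inl a)) => [b|j] //.
    rewrite line_word_plain line_word_right (_ : (j == ord_max) = false) //.
    by apply: contraNF na => /eqP ej; rewrite -(mateK v1 (inl a)) e ej -ml.
  by rewrite line_word_plain line_word_right (inj_eq inr_inj).
by rewrite (half_loops h1) (half_loops h2).
Qed.

Lemma standard_left e2 : stack (left_diagram n) (standard 1 e2) = standard (-1) e2.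
Proof.
have v1 := @standard_valid n m 1 e2 lt_mn par.
rewrite left_vert stack_vert //; apply: eq_diagram => //= x.
rewrite ffunE.
have lw (j : 'I_m.+1) : line_word (-1) e2 j = (if j == 0%N :> nat then [:: L] else [::]) ++ line_word 1 e2 j.
  by rewrite /line_word eqxx andbT andbF.
have lw0 (j : 'I_m.+1) : j = 0%N :> nat -> line_word 1 e2 j = [::].
  by move=> e; rewrite /line_word e andbF (ltn_eqF m_gt0).
case: x => [a|j]; rewrite !ffunE /=; last first.
  rewrite lw /at_node /=; have [e|ne] := eqVneq (j : nat) 0%N; first by rewrite lw0.
  by rewrite cats0.
have [le|lt] := leqP a m.
  have [j ej ->] := std_lineP le; rewrite lw /at_node ej /= cats0.
  by have [e|ne] := eqVneq (j : nat) 0%N; [rewrite lw0|].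
rewrite std_mate_arc // /= /at_node.
have a0 : (0 < a)%N by lia.
have pa0 : (0 < partner m a)%N by have := partner_gt lt_mn par lt; lia.
by rewrite (gtn_eqF a0) (gtn_eqF pa0).
Qed.
End StandardBasic.

(** The undecorated case is a product of disjoint hooks. An R is put on the last line while that
    stands at the last node, the line is moved back, and an L is put on the first line, which is at
    node 0 already. *)
Lemma label_basic n m e1 e2 (lt_mn : (m.+1 <= n)%N) (par : ~~ odd (n - m.+1)) :
  label n m e1 e2 -> basic (lift_diagram lt_mn (standard e1 e2 lt_mn)).
Proof.
move=> lab; have b11 := standard_basic_plain lt_mn par.
case/and5P: lab => _ _ h1 h2 /andP[h0 _].
have [m0|m0] := posnP m.
  by have /andP[/eqP -> /eqP ->] : (e1 == 1) && (e2 == 1) by move: h0; rewrite m0.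
have im (x y : int) : (m == 0%N) ==> ((x == 1) && (y == 1)) by rewrite (gtn_eqF m0).
have b1 : basic (lift_diagram lt_mn (standard 1 e2 lt_mn)).
  case/orP: h2 => /eqP -> //.
  pose r := ((n - m.+1)./2).
  have er : (m + r.*2)%N = n.-1 by rewrite /r; move: par; lia.
  have lt : (m + r.*2 < n)%N by lia.
  apply: (standard_basic_of_moved par (im 1 (-1)) lt).
  rewrite -(moved_right lt_mn par m0 er); apply: (basic_lift_stack (im 1 (-1))); first by constructor.
    by rewrite moved_right //; have [] := @movedP n m 1 (-1) lt_mn par r lt.
  exact: (moved_basic par (im 1 1) lt).
case/orP: h1 => /eqP -> //.
rewrite -standard_left //; apply: (basic_lift_stack (im (-1) e2)) => //; first by constructor.
by rewrite standard_left //; apply: standard_half.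
Qed.

Lemma half_basic n m e1 e2 (lt_mn : (m.+1 <= n)%N) (par : ~~ odd (n - m.+1)) D :
  label n m e1 e2 -> half_diagram e1 e2 D -> basic (lift_diagram lt_mn D).
Proof.
move=> lab hD; apply: reach_basic (label_basic lt_mn par lab) _ => //.
  by case/and5P: lab => _ _ _ _ /andP[].
exact: half_reach.
Qed.

(** * Blocks and central elements *)

Section AnnihilatingPolynomial.
Variables (k : fieldType) (A : falgType k) (z : A).

(** The powers of z with exponents 0, ..., d are d + 1 vectors in a space of dimension d. *)
Lemma annihilating_poly : exists2 p : {poly k}, p != 0 & horner_alg z p = 0.
Proof.
pose d := \dim {:A}; pose X : d.+1.-tuple A := [tuple z ^+ i | i < d.+1].
have nf : ~~ free X.
  apply/negP; rewrite /free size_tuple => /eqP h.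
  by have := dimvS (subvf <<X>>%VS); rewrite h -/d ltnn.
have [c sc [i ci]] : exists2 c : 'I_d.+1 -> k, \sum_i c i *: X`_i = 0 & exists i, c i != 0.
  apply: contrapT => H; case/negP: nf; apply/freeP => c sc i.
  by apply/eqP/negPn/negP => ci; apply: H; exists c => //; exists i.
exists (\sum_i c i *: 'X^i).
  apply/eqP => /(congr1 (fun p : {poly k} => p`_i)); rewrite coef0 coef_sum (bigD1 i) //=.
  rewrite coefZ coefXn eqxx mulr1 big1 ?addr0 => [/eqP|j ji]; first by rewrite (negPf ci).
  by rewrite coefZ coefXn [_ == _ :> nat](_ : _ = false) ?mulr0 //; apply/negbTE; rewrite eq_sym.
rewrite linear_sum -[RHS]sc; apply: eq_bigr => j _.
by rewrite linearZ /= rmorphXn /= horner_algX nth_mktuple -scalerAl mul1r.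
Qed.
End AnnihilatingPolynomial.

Section Blocks.
Variables (k : fieldType) (A : falgType k).

(** A nonzero submodule of least dimension is a composition factor over 0, and e acts on it as the
    identity. *)
Lemma in_block_act_neq0 (W : vectType k) (act : A -> W -> W) (e : A) :
  (forall a, act a 0 = 0) -> in_block act e -> {:W}%VS != 0%VS ->
  exists v, act e v != 0.
Proof.
move=> act0 inb W0; apply: contrapT => H.
have He v : act e v = 0 by apply/eqP/negPn/negP => h; apply: H; exists v.
pose Q d := `[< exists U : {vspace W}, [/\ submodule act U, U != 0%VS & \dim U = d] >].
have exQ : exists d, Q d.
  exists (\dim {:W}); apply/asboolP; exists fullv; split=> //.
  by move=> a v _; apply: memvf.
case: (ex_minnP exQ) => d /asboolP [U [sU U0 dU]] dmin.
have s0 : submodule act 0%VS by move=> a v; rewrite memv0 => /eqP ->; rewrite act0 mem0v.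
have cf : composition_factor act 0%VS U.
  split=> //; [exact: sub0v | by rewrite eq_sym |].
  move=> X sX /andP[_ XU]; have [->|X0] := eqVneq X 0%VS; [by left | right].
  apply/eqP; rewrite eqEdim XU dU; apply: dmin; apply/asboolP; by exists X.
have sub : (U <= 0)%VS.
  apply/subvP => v vU; have := inb _ _ cf v vU.
  by rewrite He sub0r memvN.
by case/negP: U0; rewrite -subv0.
Qed.

Variables (W W' : vectType k) (act : A -> W -> W) (act' : A -> W' -> W').
Variables (z : A) (al be : k).
Hypotheses (zC : forall a, z * a = a * z)
  (act0 : forall a, act a 0 = 0) (act0' : forall a, act' a 0 = 0)
  (actB : forall a c f, act (a - c) f = act a f - act c f)
  (actB' : forall a c f, act' (a - c) f = act' a f - act' c f)
  (actZ : forall x a f, act (x *: a) f = x *: act a f)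
  (actZ' : forall x a f, act' (x *: a) f = x *: act' a f)
  (actz : forall a f, act (z * a) f = al *: act a f)
  (actz' : forall a f, act' (z * a) f = be *: act' a f)
  (W0 : {:W}%VS != 0%VS) (W0' : {:W'}%VS != 0%VS).

(* Fitting: the primitive idempotent e kills the part of A on which z - al is
   invertible or the part on which z - al is nilpotent; in the first case z - be
   is invertible on A e unless be = al. *)
Lemma same_block_central : same_block act act' -> al = be.
Proof.
case=> e [[[ee eC] e0 prim] inb inb'].
apply: contrapT => /eqP ne.
pose F := horner_alg z.
have FM p r : F (p * r) = F p * F r by exact: rmorphM.
have FD p r : F (p + r) = F p + F r by exact: rmorphD.
have FC p a : F p * a = a * F p.
  elim/poly_ind: p => [|p c IH]; first by rewrite /F !rmorph0 mul0r mulr0.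
  rewrite /F rmorphD rmorphM /= horner_algX horner_algC -/(F p).
  have h : F p * z * a = a * (F p * z) by rewrite -mulrA zC !mulrA IH.
  by rewrite mulrDl mulrDr h -scalerAl -scalerAr mul1r mulr1.
have FX c : F ('X - c%:P) = z - c%:A by rewrite /F rmorphB /= horner_algX horner_algC.
have [p p0 Fp] := annihilating_poly z.
have [r [g ng ep]] := multiplicity_XsubC p al; rewrite p0 /= in ng.
(* Exponent r + 1 rather than r: even if al is not a root of p, the second idempotent is then a
   multiple of z - al. *)
have cop : coprimep g (('X - al%:P) ^+ r.+1).
  by apply: coprimep_expr; rewrite coprimep_XsubC.
have [[s t] /= st] := Bezout_eq1_coprimepP _ _ cop.
have f12 : F (s * g) + F (t * ('X - al%:P) ^+ r.+1) = 1 by rewrite /F -rmorphD st rmorph1.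
have f0 : F (s * g) * F (t * ('X - al%:P) ^+ r.+1) = 0.
  rewrite -FM.
  have -> : s * g * (t * ('X - al%:P) ^+ r.+1) = s * t * ('X - al%:P) * p.
    by rewrite ep exprS; ring.
  by rewrite FM [X in _ * X]Fp mulr0.
set f1 := F (s * g) in f12 f0; set f2 := F (t * _) in f12 f0.
have id1 : f1 * f1 = f1 by rewrite -[RHS]mulr1 -f12 mulrDr f0 addr0.
have f0' : f2 * f1 = 0 by rewrite FC f0.
have id2 : f2 * f2 = f2 by rewrite -[RHS]mulr1 -f12 mulrDr f0' add0r.
have ci f : f * f = f -> (forall a, f * a = a * f) -> central_idempotent (e * f).
  move=> ff fC; split=> [|a]; first by rewrite -mulrA (mulrA f) fC -!mulrA ff mulrA ee.
  by rewrite -mulrA fC mulrA eC mulrA.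
have kill (V : vectType k) (actV : A -> V -> V) c h :
   (forall a c f, actV (a - c) f = actV a f - actV c f) ->
   (forall x a f, actV (x *: a) f = x *: actV a f) ->
   (forall a f, actV (z * a) f = c *: actV a f) -> e = (z - c%:A) * h ->
   forall v, actV e v = 0.
  by move=> hB hZ hz -> v; rewrite mulrBl hB hz -scalerAl mul1r hZ subrr.
case: (prim (e * f1) (e * f2) (ci _ id1 (FC _)) (ci _ id2 (FC _))).
- by rewrite mulrA -(mulrA e) (FC _ e) mulrA ee -mulrA f0 mulr0.
- by rewrite -mulrDr f12 mulr1.
- move=> ef1; have [v /eqP] := in_block_act_neq0 act0 inb W0; apply.
  apply: (kill _ _ al (F (t * ('X - al%:P) ^+ r) * e)) => //.
  rewrite mulrA -FX -FM mulrCA -exprS FC -[LHS]mulr1 -f12 mulrDr ef1 add0r //.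
move=> ef2; have [v /eqP] := in_block_act_neq0 act0' inb' W0'; apply.
(* Now z - al is nilpotent on e; since be differs from al, e is a multiple of z - be and kills the
   second module. *)
have en : F (('X - al%:P) ^+ r) * e = 0.
  rewrite FC -[e]mulr1 -f12 mulrDr ef2 addr0 -mulrA -FM.
  have -> : s * g * ('X - al%:P) ^+ r = s * p by rewrite ep mulrA.
  by rewrite FM [X in _ * (_ * X)]Fp !mulr0.
have cop' : coprimep (('X - al%:P) ^+ r) ('X - be%:P).
  by rewrite coprimep_sym; apply: coprimep_expr; rewrite coprimep_XsubC root_XsubC.
have [[s' t'] /= st'] := Bezout_eq1_coprimepP _ _ cop'.
apply: (kill _ _ be (F t' * e)) => //.
have F1 : F 1 = 1 by exact: rmorph1.
have fs : F (s' * ('X - al%:P) ^+ r) * e = 0 by rewrite FM -mulrA en mulr0.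
rewrite mulrA -FX -FM -[LHS]mul1r -F1 -st' FD mulrDl fs add0r.
by rewrite [t' * _]mulrC.
Qed.
End Blocks.

(** * Relations between the generators *)

Lemma hook_valid n (i j : 'I_n) : j = i.+1 :> nat -> valid (hook_diagram i j).
Proof. by move=> h; apply: basic_valid; apply: generator_basic; apply: gen_hook. Qed.

Lemma hook_mateE n (i j : 'I_n) : mate (hook_diagram i j) (inl i) = inl j.
Proof. by rewrite ffunE /= eqxx. Qed.

Section StackVertHook.
Variables (n : nat) (i j : 'I_n) (u : 'I_n -> seq blob).
Hypothesis ji : j = i.+1 :> nat.
Let lt_ij : (i < j)%N. Proof. by rewrite ji. Qed.
Let ij : i != j. Proof. by rewrite neq_ltn lt_ij. Qed.
Let vh : valid (hook_diagram i j) := hook_valid ji.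
Let nji : (j == i) = false. Proof. by rewrite eq_sym (negPf ij). Qed.

Section Attached.
Variable x : blob.
Hypotheses (uij : u i ++ u j = [:: x]) (uji : u j ++ u i = [:: x])
  (uN : forall l, l != i -> l != j -> u l = [::]).

Lemma vert_hook_word y : word (stack (vert u) (hook_diagram i j)) y =
  if (y == inl i) || (y == inl j) then [:: x] else [::].
Proof.
rewrite stack_vert //= !ffunE /=; case: y => y; rewrite ?(inj_eq inl_inj) /=.
  have [->|yi] := eqVneq y i; first by rewrite /= uij.
  have [->|yj] := eqVneq y j; first by rewrite /= uji.
  by rewrite /= uN.
by have [_|yi] := eqVneq y i; last have [_|yj] := eqVneq y j; rewrite //= uN.
Qed.

Lemma reduced_vert_hook : reduced (stack (vert u) (hook_diagram i j)).
Proof.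
apply: reduced_short => [|y]; first by rewrite stack_vert.
by rewrite vert_hook_word; case: ifP.
Qed.

Lemma hook_vert_hook : stack (hook_diagram i j) (stack (vert u) (hook_diagram i j)) =
  Diagram (mate (hook_diagram i j)) (word (hook_diagram i j)) [:: [:: x]].
Proof.
have mS y : mate (stack (vert u) (hook_diagram i j)) y = mate (hook_diagram i j) y.
  by rewrite stack_vert.
have vS : valid (stack (vert u) (hook_diagram i j)).
  have mj : mate (hook_diagram i j) (inl j) = inl i by rewrite -(hook_mateE i j) mateK.
  split=> y; rewrite !mS; [exact: mateK | exact: mate_nofix |].
  by rewrite !vert_hook_word !mate_swap // hook_mateE mj orbC; case: ifP.
have lS : loops (stack (vert u) (hook_diagram i j)) = [::] by rewrite stack_vert.
have wS := vert_hook_word.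
move: (stack (vert u) _) vS mS lS wS => S vS mS lS wS.
rewrite stack_hook_closed //; last by rewrite mS hook_mateE.
apply: eq_diagram => [y|y|] /=.
- by rewrite mS.
- by rewrite !ffunE wS; case: (_ || _).
- by rewrite wS eqxx orbT lS.
Qed.
End Attached.

Section Detached.
Hypotheses (ui : u i = [::]) (uj : u j = [::]) (su : forall l, (size (u l) <= 1)%N).

Lemma vert_hookC : stack (vert u) (hook_diagram i j) = stack (hook_diagram i j) (vert u).
Proof.
have vv : valid (vert u) -> stack (vert u) (hook_diagram i j) = stack (hook_diagram i j) (vert u).
  move=> vv; rewrite stack_vert // stack_hook_open ?ffunE //.
  apply: eq_diagram => // y; rewrite !ffunE /=.
    rewrite /hook_mates !ffunE /=; case: y => y; rewrite /= ?(inj_eq inl_inj) ?(inj_eq inr_inj).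
      by case: eqVneq => // _; case: eqVneq.
    by case: eqVneq => // _; case: eqVneq.
  rewrite /hook_words !ffunE /= ui uj.
  case: y => y; rewrite /= ?(inj_eq inl_inj) ?(inj_eq inr_inj).
    have [->|yi] := eqVneq y i; first by rewrite /= ui uj.
    have [->|yj] := eqVneq y j; first by rewrite /= ui uj.
    by rewrite /= cats0.
  have [->|yi] := eqVneq y i; first by rewrite ui.
  have [->|yj] := eqVneq y j; first by rewrite uj.
  by [].
apply: vv; split=> [[y|y]|[y|y]|[y|y]]; rewrite ?ffunE //= ?ffunE //=;
  by case: (u y) (su y) => [|? []].
Qed.

Lemma reduced_vert_hook_detached : reduced (stack (vert u) (hook_diagram i j)).
Proof.
apply: reduced_short => [|y]; rewrite stack_vert //= !ffunE /=.
case: y => y /=.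
  have [->|yi] := eqVneq y i; first by rewrite /= ui uj.
  have [->|yj] := eqVneq y j; first by rewrite /= ui uj.
  by rewrite /= cats0.
by have [_|_] := eqVneq y i; last have [_|_] := eqVneq y j; rewrite /= ?su.
Qed.
End Detached.
End StackVertHook.

Lemma vert_vertC n (u v : 'I_n -> seq blob) : valid (vert u) -> valid (vert v) ->
  (forall l, u l = [::] \/ v l = [::]) ->
  stack (vert u) (vert v) = stack (vert v) (vert u).
Proof.
move=> vu vv uv; rewrite !stack_vert //; apply: eq_diagram => // y; rewrite !ffunE.
by case: y => y /=; rewrite ?cats0; case: (uv y) => ->; rewrite ?cats0.
Qed.

Lemma hook_hookC n (i j p l : 'I_n) : j = i.+1 :> nat -> l = p.+1 :> nat -> (j < p)%N ->
  stack (hook_diagram i j) (hook_diagram p l) = stack (hook_diagram p l) (hook_diagram i j).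
Proof.
move=> ji lp jp; have vh := hook_valid ji; have vk := hook_valid lp.
have ip : (i == p) = false by apply/negbTE; rewrite -val_eqE /=; lia.
have il : (i == l) = false by apply/negbTE; rewrite -val_eqE /=; lia.
have jp' : (j == p) = false by apply/negbTE; rewrite -val_eqE /=; lia.
have jl : (j == l) = false by apply/negbTE; rewrite -val_eqE /=; lia.
have ij : i != j by rewrite -val_eqE /=; lia.
have pl : p != l by rewrite -val_eqE /=; lia.
rewrite !stack_hook_open ?ffunE /= ?ip ?il ?jp' ?jl ?[p == i]eq_sym ?[p == j]eq_sym ?ip ?jp' //.
apply: eq_diagram => // y; rewrite !ffunE; last first.
  by rewrite /hook_words !ffunE; do !case: ifP.
rewrite /hook_mates !ffunE /= ?ip ?il ?jp' ?jl ?[p == i]eq_sym ?[p == j]eq_sym ?[l == i]eq_sym ?[l == j]eq_sym ?ip ?jp' ?il ?jl.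
case: y => y; rewrite ?(inj_eq inl_inj) ?(inj_eq inr_inj) /=.
  have [->|yi] := eqVneq y i; first by rewrite ip il.
  have [->|yj] := eqVneq y j; first by rewrite jp' jl.
  by case: eqVneq => // _; case: eqVneq.
have [->|yi] := eqVneq y i; first by rewrite ip il.
have [->|yj] := eqVneq y j; first by rewrite jp' jl.
by case: eqVneq => // _; case: eqVneq.
Qed.

Lemma hook_stack_blank n (i j : 'I_n) (D : diagram n n) : valid D -> i != j ->
  mate D (inl i) != inl j -> loops D = [::] -> (forall x, word D x = [::]) ->
  loops (stack (hook_diagram i j) D) = [::] /\
  forall x, word (stack (hook_diagram i j) D) x = [::].
Proof.
move=> vD ij nl l0 w0; rewrite stack_hook_open //; split=> //= x.
by rewrite ffunE /hook_words !w0; do !case: ifP.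
Qed.

Section Relations.
Variables (k : fieldType) (P : blob_scalars k) (n : nat) (A : falgType k)
  (b : basis_diagram n -> A).
Hypotheses (A_blob : symplectic_blob_algebra P b) (n_gt0 : (0 < n)%N).
Hypotheses (kL1 : kappa_L P = 1) (kR1 : kappa_R P = 1).

Definition nd (i : nat) : 'I_n := insubd (Ordinal n_gt0) i.
Lemma val_nd i : (i < n)%N -> nd i = i :> nat.
Proof. by move=> lt; rewrite val_insubd lt. Qed.

(** Strings are counted from 1 in the relations and nodes from 0 in diagrams, so that the hook of
    index i sits at the nodes i - 1 and i. *)
Definition gen (i : nat) : diagram n n :=
  if i == 0%N then left_diagram n else if i == n then right_diagram n
  else hook_diagram (nd i.-1) (nd i).
Definition gelt (i : nat) : A := elt b (gen i).
Local Notation E := gelt.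

Lemma gen0 : gen 0 = left_diagram n. Proof. by []. Qed.
Lemma genn : gen n = right_diagram n.
Proof. by rewrite /gen eqxx (gtn_eqF n_gt0). Qed.
Lemma gen_mid i : (0 < i < n)%N -> gen i = hook_diagram (nd i.-1) (nd i).
Proof. by case/andP => i0 lt; rewrite /gen (gtn_eqF i0) (ltn_eqF lt). Qed.
Lemma nd_succ i : (0 < i < n)%N -> nd i = (nd i.-1).+1 :> nat.
Proof. by move=> h; rewrite !val_nd; lia. Qed.

Lemma gen_generator i : (i <= n)%N -> generator (gen i).
Proof.
move=> le; have [->|i0] := posnP i; first exact: gen_left.
have [->|ne] := eqVneq i n; first by rewrite genn; apply: gen_right.
by rewrite gen_mid; [apply: gen_hook; apply: nd_succ|]; lia.
Qed.

Lemma generator_gen g : generator g -> exists2 i, (i <= n)%N & g = gen i.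
Proof.
case=> [|i j ji|]; [by exists 0%N | | by exists n; rewrite ?genn].
have lj := ltn_ord j; exists j; first by lia.
rewrite gen_mid; last by lia.
by congr hook_diagram; apply: val_inj; rewrite /= val_nd // ?ji //=; lia.
Qed.

Lemma gen_basic i : (i <= n)%N -> basic (gen i).
Proof. by move=> le; apply/generator_basic/gen_generator. Qed.

Lemma hook_neq i : (0 < i < n)%N -> nd i.-1 != nd i.
Proof. by move=> h; rewrite -val_eqE /= (nd_succ h); lia. Qed.

Lemma gelt_closed i D ls : (0 < i < n)%N -> basic D ->
  stack (gen i) D = Diagram (mate (gen i)) (word (gen i)) ls ->
  E i * elt b D = (\prod_(w <- ls) loop_value P w) *: E i.
Proof.
move=> hi bD eS; have le : (i <= n)%N by lia.
have /andP[rg _] := gen_basic le.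
by rewrite /gelt (elt_mul A_blob) // ?gen_basic // eS straighten_loops.
Qed.

Lemma gelt_gelt i : (0 < i < n)%N -> E i * E i = delta P *: E i.
Proof.
move=> hi; have le : (i <= n)%N by lia.
rewrite (gelt_closed (ls := [:: [::]]) hi) ?gen_basic //; first by rewrite big_seq1.
rewrite gen_mid //; have h := nd_succ hi; have vh := hook_valid h.
rewrite stack_hook_closed ?hook_mateE ?hook_neq //; last by rewrite h.
by apply: eq_diagram => //= [y|]; rewrite !ffunE //= if_same.
Qed.

Section Decorated.
Variables (D : diagram n n) (p y : 'I_n) (x : blob).
Hypotheses (bD : basic D) (mp : mate D (inl p) = inr y) (wp : word D (inl p) = [:: x]).
Hypothesis gx : generator (vert (@at_node n p x)).

(** The line at p is the only string that straightens, and its scalar is counted once, at its top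
    end. *)
Lemma elt_again : elt b (vert (@at_node n p x)) * elt b D =
  (if x is L then delta_L P else delta_R P) *: elt b D.
Proof.
have vD := basic_valid bD; have /andP[rD _] := bD.
have /and3P[/eqP l0 /forallP rw /eqP lr] := rD.
have my : mate D (inr y) = inl p by rewrite -mp mateK.
have wy : word D (inr y) = [:: x] by rewrite (word_eq_mate vD mp) wp.
set S := stack (vert (@at_node n p x)) D.
have mS z : mate S z = mate D z by rewrite /S stack_vert.
have td z : top_deco (@at_node n p x) z = if z == inl p :> node n n then [:: x] else [::].
  by case: z => [z|//]; rewrite (inj_eq inl_inj) /= /at_node -val_eqE.
have wS z : word S z = if (z == inl p) || (z == inr y) then [:: x; x] else word D z.
  rewrite /S stack_vert //= ffunE !td mate_swap // mp.
  have [->|zp] := eqVneq z (inl p); first by rewrite wp.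
  by have [->|zy] := eqVneq z (inr y); rewrite ?wy ?cats0.
have sxx : straighten_word P [:: x; x] = (if x is L then delta_L P else delta_R P, [:: x]).
  by case: (x) => /=; rewrite /straighten_word /= mulr1.
rewrite (elt_mul A_blob) //; last exact: generator_basic.
have lS : loops S = [::] by rewrite /S stack_vert.
suff -> : straighten P S = (if x is L then delta_L P else delta_R P, D) by [].
move: S lS mS wS => S lS mS wS.
have -> : straighten P S = let: (c, d1) := straighten_strings P S in
    if LR_arcs d1 is Some p then (c * kappa_LR P, reconnect d1 p) else (c, d1) by [].
have -> : straighten_strings P S = (if x is L then delta_L P else delta_R P, D).
  rewrite /straighten_strings; congr pair.
    rewrite lS big_nil mul1r (bigD1 (inl p)) /=; last by rewrite mS mp /=; have := ltn_ord p; lia.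
    rewrite wS eqxx sxx big1 ?mulr1 // => z /andP[lt zp].
    rewrite wS (negPf zp) /=; case: eqVneq => [ez|_]; last by rewrite straighten_reduced.
    by move: lt; rewrite mS ez my /=; have := ltn_ord p; lia.
  apply: eq_diagram => [z|z|]; [exact: mS | | by rewrite l0].
  rewrite ffunE wS; have [->|zp] := eqVneq z (inl p); first by rewrite sxx wp.
  by have [->|zy] := eqVneq z (inr y); rewrite ?sxx ?wy //= straighten_reduced.
by rewrite lr.
Qed.
End Decorated.

Lemma gelt0_gelt0 : E 0 * E 0 = delta_L P *: E 0.
Proof.
rewrite /gelt gen0 {1 2 3}left_vert.
have v0 : nd 0 = 0%N :> nat by rewrite val_nd.
have eu : @at_node n 0 L = @at_node n (nd 0) L by rewrite v0.
have g0 : generator (vert (@at_node n (nd 0) L)) by rewrite -eu -left_vert; apply: gen_left.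
rewrite eu; apply: (elt_again (y := nd 0)) => //; first exact: generator_basic.
  by rewrite ffunE.
by rewrite ffunE /at_node eqxx.
Qed.

Lemma geltn_geltn : E n * E n = delta_R P *: E n.
Proof.
rewrite /gelt genn {1 2 3}right_vert.
have v0 : nd n.-1 = n.-1 :> nat by rewrite val_nd //; lia.
have eu : @at_node n n.-1 R = @at_node n (nd n.-1) R by rewrite v0.
have g0 : generator (vert (@at_node n (nd n.-1) R)) by rewrite -eu -right_vert; apply: gen_right.
rewrite eu; apply: (elt_again (y := nd n.-1)) => //; first exact: generator_basic.
  by rewrite ffunE.
by rewrite ffunE /at_node eqxx.
Qed.

(** The middle hook slides the bare pair of the lower one from {i, j} to {j, l}, and the upper hook
    slides it back. *)
Lemma hook_slide (i j l : 'I_n) : generator (hook_diagram i j) -> generator (hook_diagram j l) ->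
  l != i -> l != j -> i != j ->
  elt b (hook_diagram i j) * elt b (hook_diagram j l) * elt b (hook_diagram i j) =
  elt b (hook_diagram i j).
Proof.
move=> g1 g2 li lj ij; have b1 := generator_basic g1; have v1 := basic_valid b1.
have mD : mate (hook_diagram i j) (inl i) = inl j by rewrite hook_mateE.
have mD' : mate (hook_diagram i j) (inl j) = inl i by rewrite ffunE /= [j == i]eq_sym (negPf ij) eqxx.
have wD : word (hook_diagram i j) (inl i) = [::] by rewrite ffunE.
have back := slide_back v1 mD wD li lj.
have [|||||l0 w0] := @hook_stack_blank n j l (hook_diagram i j) => //.
- by rewrite eq_sym.
- by rewrite mD' (inj_eq inl_inj) eq_sym.
- by move=> x; rewrite ffunE.
have rS : reduced (stack (hook_diagram j l) (hook_diagram i j)).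
  by apply: reduced_short => // x; rewrite w0.
have /andP[r1 _] := b1.
rewrite -mulrA (elt_stack A_blob) // (elt_stack A_blob) ?back //.
exact: basic_stack.
Qed.

Lemma gelt_up i : (0 < i)%N -> (i.+1 < n)%N -> E i * E i.+1 * E i = E i.
Proof.
move=> i0 lt; have h1 : (0 < i < n)%N by lia. have h2 : (0 < i.+1 < n)%N by lia.
have g1 : generator (gen i) by apply: gen_generator; lia.
have g2 : generator (gen i.+1) by apply: gen_generator; lia.
rewrite /gelt (gen_mid h1) (gen_mid h2) in g1 g2 *.
by apply: hook_slide; rewrite // -val_eqE /= !val_nd /=; lia.
Qed.

Lemma gelt_down i : (0 < i)%N -> (i.+1 < n)%N -> E i.+1 * E i * E i.+1 = E i.+1.
Proof.
move=> i0 lt; have h1 : (0 < i < n)%N by lia. have h2 : (0 < i.+1 < n)%N by lia.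
have g1 : generator (gen i) by apply: gen_generator; lia.
have g2 : generator (gen i.+1) by apply: gen_generator; lia.
rewrite /gelt (gen_mid h1) (gen_mid h2) [hook_diagram (nd i.-1) _]hook_diagramC
  [hook_diagram _ (nd i.+1)]hook_diagramC in g1 g2 *.
by apply: hook_slide; rewrite // -val_eqE /= !val_nd /=; lia.
Qed.

(** Exactly one of the two strings carries the blob, so the loop formed by the hooks contains it
    once. *)
Lemma hook_deco i g p x : (0 < i < n)%N -> generator g -> g = vert (@at_node n p x) ->
  @at_node n p x (nd i.-1) ++ @at_node n p x (nd i) = [:: x] ->
  @at_node n p x (nd i) ++ @at_node n p x (nd i.-1) = [:: x] ->
  (forall l, l != nd i.-1 -> l != nd i -> @at_node n p x l = [::]) ->
  E i * elt b g * E i = loop_value P [:: x] *: E i.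
Proof.
move=> hi gg eg h1 h2 h3; have ji := nd_succ hi.
have bi : basic (gen i) by apply: gen_basic; lia.
have rS := reduced_vert_hook ji h1 h2 h3.
rewrite -mulrA [elt b g * _](elt_stack A_blob) //; last by rewrite eg gen_mid.
rewrite (gelt_closed (ls := [:: [:: x]]) hi) ?big_seq1 //.
  by apply: basic_stack => //; rewrite eg gen_mid.
by rewrite eg gen_mid //; apply: hook_vert_hook.
Qed.

Lemma gelt_101 : (1 < n)%N -> E 1 * E 0 * E 1 = E 1.
Proof.
move=> n1; rewrite /gelt gen0 -/(gelt 1).
have v0 : nd 0 = 0%N :> nat by rewrite val_nd.
have v1 : nd 1 = 1%N :> nat by rewrite val_nd.
rewrite (@hook_deco 1 _ 0 L) ?left_vert //.
- by rewrite /loop_value /= kL1 expr0 mul1r scale1r.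
- by rewrite -left_vert; apply: gen_left.
- by rewrite /at_node v0 v1.
- by rewrite /at_node v0 v1.
- by move=> l; rewrite -!val_eqE /= v0 v1 /at_node => /negPf ->.
Qed.

Lemma gelt_nnn : (1 < n)%N -> E n.-1 * E n * E n.-1 = E n.-1.
Proof.
move=> n1; have hn : (0 < n.-1 < n)%N by lia.
rewrite /gelt genn -/(gelt n.-1).
have v0 : nd n.-2 = n.-2 :> nat by rewrite val_nd; lia.
have v1 : nd n.-1 = n.-1 :> nat by rewrite val_nd; lia.
have n21 : (n.-2 == n.-1) = false by lia.
rewrite (@hook_deco n.-1 _ n.-1 R) ?right_vert //.
- by rewrite /loop_value /= kR1 expr0 mul1r scale1r.
- by rewrite -right_vert; apply: gen_right.
- by rewrite /at_node v0 v1 n21 eqxx.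
- by rewrite /at_node v0 v1 n21 eqxx.
- by move=> l; rewrite -!val_eqE /= v0 v1 /at_node => _ /negPf ->.
Qed.

Lemma vert_at_valid p x : valid (vert (@at_node n p x)).
Proof.
split=> [[y|y]|[y|y]|[y|y]]; rewrite ?ffunE //= ?ffunE //=; by rewrite rev_at_node.
Qed.

Lemma gelt_commute i j : (i <= n)%N -> (j <= n)%N ->
  stack (gen i) (gen j) = stack (gen j) (gen i) -> reduced (stack (gen i) (gen j)) ->
  comm (E i) (E j).
Proof.
move=> hi hj eS rS; have gi := gen_generator hi; have gj := gen_generator hj.
have bi := gen_basic hi; have bj := gen_basic hj.
rewrite /comm /gelt (elt_stack A_blob gi bj rS) eS.
by rewrite (elt_stack A_blob gj bi) // -eS.
Qed.

Lemma gelt_comm i j : (i.+1 < j <= n)%N -> comm (E i) (E j).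
Proof.
move=> /andP[lt le]; have hi : (i <= n)%N by lia.
apply: gelt_commute => //.
  have [i0|i0] := posnP i.
    rewrite i0 gen0; have [->|jn] := eqVneq j n.
      rewrite genn left_vert right_vert; apply: vert_vertC; try exact: vert_at_valid.
      by move=> l; rewrite /at_node; have [->|_] := eqVneq (l : nat) 0%N; [right; rewrite ifF //; lia | left].
    have hj : (0 < j < n)%N by lia.
    rewrite gen_mid // left_vert; apply: vert_hookC => //; first exact: nd_succ.
    + by rewrite /at_node val_nd ?ifF //; lia.
    + by rewrite /at_node val_nd ?ifF //; lia.
    + by move=> l; rewrite /at_node; case: ifP.
  have hi' : (0 < i < n)%N by lia.
  rewrite (gen_mid hi'); have [->|jn] := eqVneq j n.
    rewrite genn right_vert; symmetry; apply: vert_hookC => //; first exact: nd_succ.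
    + by rewrite /at_node val_nd ?ifF //; lia.
    + by rewrite /at_node val_nd ?ifF //; lia.
    + by move=> l; rewrite /at_node; case: ifP.
  have hj : (0 < j < n)%N by lia.
  rewrite gen_mid //; apply: hook_hookC; try exact: nd_succ.
  by rewrite !val_nd; lia.
have [i0|i0] := posnP i.
  rewrite i0 gen0 left_vert.
  have [->|jn] := eqVneq j n.
    rewrite genn right_vert; apply: reduced_short => [|y]; rewrite stack_vert //; try exact: vert_at_valid.
    by rewrite /= !ffunE; case: y => y /=; rewrite /at_node; case: ifP => h; case: ifP => h' //=; move: h h'; lia.
  have hj : (0 < j < n)%N by lia.
  rewrite gen_mid //; apply: reduced_vert_hook_detached => //; first exact: nd_succ.
  + by rewrite /at_node val_nd ?ifF //; lia.
  + by rewrite /at_node val_nd ?ifF //; lia.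
  + by move=> l; rewrite /at_node; case: ifP.
have hi' : (0 < i < n)%N by lia.
have [->|jn] := eqVneq j n.
  rewrite (gen_mid hi') genn right_vert -vert_hookC //; try exact: nd_succ.
  + apply: reduced_vert_hook_detached => //; first exact: nd_succ.
    * by rewrite /at_node val_nd ?ifF //; lia.
    * by rewrite /at_node val_nd ?ifF //; lia.
    * by move=> l; rewrite /at_node; case: ifP.
  + by rewrite /at_node val_nd ?ifF //; lia.
  + by rewrite /at_node val_nd ?ifF //; lia.
  + by move=> l; rewrite /at_node; case: ifP.
have hj : (0 < j < n)%N by lia.
rewrite (gen_mid hi') (gen_mid hj).
have [|||||l0 w0] := @hook_stack_blank n (nd i.-1) (nd i) (hook_diagram (nd j.-1) (nd j)) => //.
- by apply: hook_valid; apply: nd_succ.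
- exact: hook_neq.
- by rewrite ffunE /= -!val_eqE /= !val_nd /=; [rewrite !ifF //; lia | lia..].
- by move=> x; rewrite ffunE.
by apply: reduced_short => // x; rewrite w0.
Qed.
End Relations.

(** * The central element on a cell module *)

Section LineWords.
Variables (n m : nat) (e1 e2 : int).
Hypothesis lab : label n m e1 e2.

Lemma label_lt : (m.+1 <= n)%N. Proof. by case/andP: lab. Qed.
Lemma label_par : ~~ odd (n - m.+1).
Proof. by case/and3P: lab => lt /eqP e _; move: e; lia. Qed.
Lemma label_zero : (m == 0%N) ==> ((e1 == 1) && (e2 == 1)).
Proof. by case/and5P: lab => _ _ _ _ /andP[]. Qed.
Lemma label_sign1 : e1 = 1 \/ e1 = -1 /\ (0 < m)%N.
Proof.
case/and5P: lab => _ _ h1 _ /andP[h0 _]; case/orP: h1 => /eqP e; [by left | right].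
by rewrite lt0n; split=> //; apply: contraTneq h0 => ->; rewrite e.
Qed.
Lemma label_sign2 : e2 = 1 \/ e2 = -1 /\ (0 < m)%N.
Proof.
case/and5P: lab => _ _ _ h2 /andP[h0 _]; case/orP: h2 => /eqP e; [by left | right].
by rewrite lt0n; split=> //; apply: contraTneq h0 => ->; rewrite e andbF.
Qed.

Lemma line_word_first : line_word e1 e2 (ord0 : 'I_m.+1) = if e1 == -1 then [:: L] else [::].
Proof.
rewrite /line_word /=; have [m0|m0] := posnP m.
  have /andP[/eqP -> /eqP ->] : (e1 == 1) && (e2 == 1).
    by case/and5P: lab => _ _ _ _ /andP[h0 _]; move: h0; rewrite m0.
  by rewrite andbF.
by rewrite (ltn_eqF m0) cats0.
Qed.

Lemma line_word_last : line_word e1 e2 (ord_max : 'I_m.+1) = if e2 == -1 then [:: R] else [::].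
Proof.
rewrite /line_word /= eqxx; have [m0|m0] := posnP m.
  have /andP[/eqP -> /eqP ->] : (e1 == 1) && (e2 == 1).
    by case/and5P: lab => _ _ _ _ /andP[h0 _]; move: h0; rewrite m0.
  by rewrite andbF.
by [].

Qed.
End LineWords.

Section CellEigenvalue.
Variables (k : fieldType) (P : blob_scalars k) (n : nat) (A : falgType k)
  (b : basis_diagram n -> A) (q : k).
Hypotheses (A_blob : symplectic_blob_algebra P b) (n_gt0 : (0 < n)%N).
Hypotheses (dE : delta P = q + q^-1) (kL1 : kappa_L P = 1) (kR1 : kappa_R P = 1).
Hypotheses (q0 : q != 0) (q2 : q ^+ 2 != 1).

Local Notation E := (gelt b n_gt0).
Definition casimir : A := central E n q (delta_L P) (delta_R P).

Lemma casimir_central a : casimir * a = a * casimir.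
Proof.
apply: (central_gen A_blob) => g /(generator_gen n_gt0) [i le ->].
have EE j : (0 < j < n)%N -> E j * E j = (q + q^-1) *: E j.
  by rewrite -dE; apply: (gelt_gelt A_blob).
exact: (central_E n_gt0 q0 q2 EE (gelt0_gelt0 A_blob n_gt0) (geltn_geltn A_blob n_gt0)
  (gelt_up A_blob n_gt0) (gelt_down A_blob n_gt0) (gelt_101 A_blob n_gt0 kL1)
  (gelt_nnn A_blob n_gt0 kR1) (gelt_comm A_blob n_gt0)).
Qed.

Variables (m : nat) (e1 e2 : int).
Hypothesis lab : label n m e1 e2.
Let lt_mn := label_lt lab.
Let par := label_par lab.
Local Notation lift D := (lift_diagram lt_mn D).
Local Notation N := (negligible b e1 e2 lt_mn).
Let p := (n - m.+1)./2.
Let ltS r : (m + r.+1.*2 < n)%N -> (m + r.*2 < n)%N.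
Proof. by clear; lia. Qed.
Let n_mp : n = (m + p.*2).+1. Proof. by rewrite /p; move: par lt_mn; lia. Qed.
(** Indexed against [moved]: in [V 0] the last line is at the last node, and [V p] is the standard
    half-diagram. *)
Let V (l : nat) : A := elt b (lift (moved e1 e2 lt_mn (p - l))).

Let b0 : basic (lift (standard e1 e2 lt_mn)) := label_basic lt_mn par lab.
Let lab0 := label_zero lab.
Let bV r : (m + r.*2 < n)%N -> basic (lift (moved e1 e2 lt_mn r)).
Proof. by move=> lt; apply: moved_basic. Qed.
Let hV r (lt : (m + r.*2 < n)%N) := @movedP n m e1 e2 lt_mn par r lt.

Lemma top_nd i : (i < n)%N -> top lt_mn i = nd n_gt0 i.
Proof. by move=> lt; apply: val_inj; rewrite /= val_top // val_nd. Qed.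

Lemma V_next l : (l < p)%N -> V l.+1 = E (n.-1 - l.*2) * V l.
Proof.
move=> lt; pose r := (p - l.+1)%N.
have er : (p - l = r.+1)%N by rewrite /r; lia.
have ltr : (m + r.+1.*2 < n)%N by rewrite -er; move: n_mp; lia.
have ei : (n.-1 - l.*2 = (m + r.*2).+2)%N by rewrite /r; move: n_mp; lia.
rewrite /V er -/r ei /gelt; clearbody r; rewrite gen_mid; last by lia.
rewrite -!(top_nd (i := _.+1)) /=; try lia.
have gx : generator (hook_diagram (top lt_mn (m + r.*2).+1) (top lt_mn (m + r.*2).+2)).
  by apply: gen_hook; rewrite !val_top; lia.
have [hD _ _ _] := hV (ltS ltr).
have := elt_stack A_blob gx (bV ltr).
rewrite stack_lift moved_back // => e.
exact: esym (e (reduced_lift lt_mn lab0 hD)).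
Qed.

Lemma V_prev l : (l < p)%N -> V l = E (n.-2 - l.*2) * V l.+1.
Proof.
move=> lt; pose r := (p - l.+1)%N.
have er : (p - l = r.+1)%N by rewrite /r; lia.
have ltr : (m + r.+1.*2 < n)%N by rewrite -er; move: n_mp; lia.
have ei : (n.-2 - l.*2 = (m + r.*2).+1)%N by rewrite /r; move: n_mp; lia.
rewrite /V er -/r ei /gelt; clearbody r; rewrite gen_mid; last by lia.
rewrite -!top_nd /=; try lia.
have gx : generator (hook_diagram (top lt_mn (m + r.*2)) (top lt_mn (m + r.*2).+1)).
  by apply: gen_hook; rewrite !val_top; move: ltr; clear; lia.
have [hD _ _ _] := hV ltr.
have := elt_stack A_blob gx (bV (ltS ltr)).
rewrite stack_lift hook_diagramC => e.
exact: esym (e (reduced_lift lt_mn lab0 hD)).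
Qed.

Lemma degenerate_blob (D : diagram n m.+1) (a : 'I_n) (j : 'I_m.+1) x :
  half_diagram e1 e2 D -> mate D (inl a) = inr j -> line_word e1 e2 j = [::] ->
  degenerate e1 e2 lt_mn (stack (vert (@at_node n a x)) (lift D)).
Proof.
move=> hD aj lj; apply/existsP; exists j; rewrite stack_vert; last exact/valid_lift/half_valid/hD.
have ja : mate D (inr j) = inl a by rewrite -aj mateK //; apply: half_valid hD.
have m_ja : mate (lift D) (inr (line_node lt_mn j)) = inl a.
  by rewrite -[inr _]/(widen_node lt_mn (inr j)) mate_lift ja.
have w_j : word (lift D) (inr (line_node lt_mn j)) = [::].
  by rewrite -[inr _]/(widen_node lt_mn (inr j)) word_lift (half_line_word hD).
rewrite /degenerate_at; apply/orP; right.
by rewrite [word _]/= ffunE w_j m_ja lj /= /at_node eqxx.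
Qed.

Lemma elt_blob (D : diagram n m.+1) (a : 'I_n) (j : 'I_m.+1) x :
  generator (vert (@at_node n a x)) -> half_diagram e1 e2 D -> basic (lift D) ->
  mate D (inl a) = inr j -> line_word e1 e2 j = [:: x] ->
  elt b (vert (@at_node n a x)) * elt b (lift D) =
  (if x is L then delta_L P else delta_R P) *: elt b (lift D).
Proof.
move=> gx hD bD aj lj; apply: (@elt_again _ _ _ _ _ A_blob n_gt0 _ a (line_node lt_mn j) _ bD _ _ gx).
  by rewrite -[inl a]/(widen_node lt_mn (inl a)) mate_lift aj.
rewrite -[inl a]/(widen_node lt_mn (inl a)) word_lift.
have ja : mate D (inr j) = inl a by rewrite -aj mateK //; apply: half_valid hD.
by rewrite (word_eq_mate (half_valid hD) ja) (half_line_word hD) lj.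
Qed.

Let rho := if e2 == -1 then delta_R P else 0.
Let lam := if e1 == -1 then delta_L P else 0.

(** Here e_n meets the last line: a second R is absorbed with the factor delta_R, while an R on a
    line that should not carry one makes the diagram degenerate. *)
Lemma En_V : N (E n * V 0 - rho *: V 0).
Proof.
have lt : (m + p.*2 < n)%N by move: n_mp; lia.
have [hD bD lD _] := hV lt.
have eV : (m + p.*2)%N = n.-1 by move: n_mp; lia.
have vt : top lt_mn n.-1 = n.-1 :> nat by rewrite val_top; lia.
rewrite eV in lD; rewrite /V subn0 /gelt genn right_vert -vt.
have gx : generator (vert (@at_node n (top lt_mn n.-1) R)) by rewrite vt -right_vert; apply: gen_right.
rewrite /rho; case: ifP => e2N.
  have lw : line_word e1 e2 (ord_max : 'I_m.+1) = [:: R] by rewrite (line_word_last lab) e2N.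
  by rewrite (elt_blob gx hD (bV lt) lD lw) subrr; apply: negligible0.
rewrite scale0r subr0; apply: (negligible_mul_elt A_blob lab) => //; first exact: bV.
by apply: (degenerate_blob _ hD lD); rewrite (line_word_last lab) e2N.
Qed.

Lemma E0_V : N (E 0 * V p - lam *: V p).
Proof.
have vt : top lt_mn 0 = 0%N :> nat by rewrite val_top.
have hD := standard_half e1 e2 lt_mn par.
have lD : mate (standard e1 e2 lt_mn) (inl (top lt_mn 0)) = inr ord0.
  by rewrite ffunE; apply: std_mate_line; rewrite vt.
rewrite /V subnn /gelt gen0 left_vert -[X in at_node X]vt.
have gx : generator (vert (@at_node n (top lt_mn 0) L)) by rewrite vt -left_vert; apply: gen_left.
rewrite /lam; case: ifP => e1N.
  have lw : line_word e1 e2 (ord0 : 'I_m.+1) = [:: L] by rewrite (line_word_first lab) e1N.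
  by rewrite (elt_blob gx hD b0 lD lw) subrr; apply: negligible0.
rewrite scale0r subr0; apply: (negligible_mul_elt A_blob lab) => //.
by apply: (degenerate_blob _ hD lD); rewrite (line_word_first lab) e1N.
Qed.

(** The hook joins two neighbouring lines, whose bottom nodes become an arc. *)
Lemma Ei_V i : (0 < i <= m)%N -> N (E i * V p).
Proof.
move=> hi; have hin : (0 < i < n)%N by move: lt_mn; lia.
rewrite /V subnn /gelt; apply: (negligible_mul_elt A_blob lab) => //.
  by apply: gen_generator; lia.
rewrite gen_mid //; set D := standard e1 e2 lt_mn.
have vD : valid (lift D) by apply: valid_lift => //; apply: standard_valid.
have l1 : (i.-1 < m.+1)%N by lia. have l2 : (i < m.+1)%N by lia.
have m1 : mate (lift D) (inl (nd n_gt0 i.-1)) = inr (line_node lt_mn (Ordinal l1)).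
  rewrite -[inl _]/(widen_node lt_mn (inl (nd n_gt0 i.-1))) mate_lift ffunE.
  by rewrite (@std_mate_line _ _ _ (Ordinal l1)) // val_nd //=; lia.
have m2 : mate (lift D) (inl (nd n_gt0 i)) = inr (line_node lt_mn (Ordinal l2)).
  rewrite -[inl _]/(widen_node lt_mn (inl (nd n_gt0 i))) mate_lift ffunE.
  by rewrite (@std_mate_line _ _ _ (Ordinal l2)) // val_nd //=; lia.
apply/existsP; exists (Ordinal l1); rewrite stack_hook_open ?m1 ?hook_neq //.
by rewrite /degenerate_at /= ffunE /hook_mates m1 m2 eqxx.
Qed.

Definition cell_eigenvalue : k :=
  eigenvalue_formula q (delta_L P) (delta_R P) m p rho lam.

(** For the standard half-diagram this is [central_V]; centrality carries it past each generator
    stacked on top, the error staying in the left ideal [N]. *)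
Lemma casimir_half (w : diagram n m.+1) : half_diagram e1 e2 w ->
  N (casimir * elt b (lift w) - cell_eigenvalue *: elt b (lift w)).
Proof.
move=> hw; have := half_reach lt_mn par hw; elim=> [|g D gg rD IH hS].
  have EE j : (0 < j < n)%N -> E j * E j = (q + q^-1) *: E j.
    by rewrite -dE; apply: (gelt_gelt A_blob).
  have NE j x : (j <= n)%N -> N x -> N (E j * x).
    by move=> le; apply: (negligibleM A_blob lab); apply: gen_generator.
  have := central_V (delta_L P) (delta_R P) n_gt0 q0 q2 EE
    (gelt_up A_blob n_gt0) (gelt_down A_blob n_gt0) (gelt_101 A_blob n_gt0 kL1)
    (gelt_nnn A_blob n_gt0 kR1) (gelt_comm A_blob n_gt0) n_mp
    (@negligible0 _ _ _ _ _ _ _ _) (@negligibleD _ _ _ _ _ _ _ _) (@negligibleZ _ _ _ _ _ _ _ _)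
    NE V_next V_prev En_V E0_V Ei_V.
  by rewrite /V subnn.
have bD : basic (lift D) by apply: (reach_basic lab0 b0 rD).
have rS := reduced_lift lt_mn lab0 hS.
rewrite -stack_lift // in rS *.
rewrite -(elt_stack A_blob gg bD rS) mulrA casimir_central -mulrA scalerAr -mulrBr.
exact: (negligibleM A_blob lab).
Qed.
End CellEigenvalue.

(** * The eigenvalue in terms of q, Q1 and Q2 *)

Section Eigenvalues.
Variables (k : fieldType) (q Q1 Q2 kLR : k).
Hypotheses (q0 : q != 0) (Q10 : Q1 != 0) (Q20 : Q2 != 0) (q2 : q ^+ 2 != 1).
Hypotheses (w10 : qnum q Q1 Q2 1 1 0 != 0) (w20 : qnum q Q1 Q2 1 0 1 != 0).
Local Notation P := (blob_parameters q Q1 Q2 kLR).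

Let q21 : q ^+ 2 - 1 != 0. Proof. by rewrite subr_eq0. Qed.
Let q3 : q ^+ 3 - q != 0.
Proof.
have -> : q ^+ 3 - q = q * (q ^+ 2 - 1) by ring.
by rewrite mulf_neq0.
Qed.
Let num (x : k) : x != 0 -> q * x - q^-1 * x^-1 = ((q * x) ^+ 2 - 1) / (q * x).
Proof. by move=> x0; field; rewrite q0 x0. Qed.

Lemma qnum_w1 : qnum q Q1 Q2 1 1 0 = (q * Q1 - q^-1 * Q1^-1) / (q - q^-1).
Proof. by rewrite /qnum oppr0 !expr0z !mulr1. Qed.
Lemma qnum_w2 : qnum q Q1 Q2 1 0 1 = (q * Q2 - q^-1 * Q2^-1) / (q - q^-1).
Proof. by rewrite /qnum oppr0 !expr0z !mulr1. Qed.

Let d1 : (q * Q1) ^+ 2 - 1 != 0.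
Proof. by apply: contraNneq w10 => e; rewrite qnum_w1 num // e !mul0r. Qed.
Let d2 : (q * Q2) ^+ 2 - 1 != 0.
Proof. by apply: contraNneq w20 => e; rewrite qnum_w2 num // e !mul0r. Qed.

Lemma delta_L_blob_parameters : delta_L P = q * (Q1 ^+ 2 - 1) / ((q * Q1) ^+ 2 - 1).
Proof.
rewrite /= qnum_w1 num // /qnum oppr0 !expr0z !mulr1 !mul1r.
rewrite -[Q1 ^ 1]/Q1 -[Q1 ^ -1]/(Q1^-1).
by field; rewrite q0 Q10 d1 q21.
Qed.
Lemma delta_R_blob_parameters : delta_R P = q * (Q2 ^+ 2 - 1) / ((q * Q2) ^+ 2 - 1).
Proof.
rewrite /= qnum_w2 num // /qnum oppr0 !expr0z !mulr1 !mul1r.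
rewrite -[Q2 ^ 1]/Q2 -[Q2 ^ -1]/(Q2^-1).
by field; rewrite q0 Q20 d2 q21.
Qed.

Lemma delta_blob_parameters : delta P = q + q^-1.
Proof.
rewrite /= /qnum !expr0z !mulr1 -[q ^ 2]/(q ^+ 2) -[q ^ (- 2)]/((q ^+ 2)^-1).
by field; rewrite q0 q21.
Qed.

Variables (n m p : nat) (e1 e2 : int).
Hypothesis n_mp : n = (m + p.*2).+1.
Hypotheses (s1 : e1 = 1 \/ e1 = -1) (s2 : e2 = 1 \/ e2 = -1).

(** With n = m + 2 p + 1 the prefactor involves only n and the parameters, which makes the
    eigenvalues on different cell modules comparable. *)
Lemma eigenvalue_formula_blob :
  eigenvalue_formula q (delta_L P) (delta_R P) m p
    (if e2 == -1 then delta_R P else 0) (if e1 == -1 then delta_L P else 0) =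
  q ^+ n.+1 * Q1 * Q2 * (q ^+ 2 - 1) / (((q * Q1) ^+ 2 - 1) * ((q * Q2) ^+ 2 - 1)) *
  (q ^ (- m%:Z) * Q1 ^ e1 * Q2 ^ e2 + q ^ m%:Z * Q1 ^ (- e1) * Q2 ^ (- e2)).
Proof.
rewrite delta_L_blob_parameters delta_R_blob_parameters /eigenvalue_formula.
have -> : q ^+ n.+1 = q ^+ m * q ^+ p.*2 * q ^+ 2 by rewrite n_mp -exprD -exprD addn2.
rewrite -[m.*2]muln2 exprM -exprnN -exprnP.
have : q ^+ m != 0 by rewrite expf_neq0.
move: (q ^+ m) (q ^+ p.*2) => x y x0.
have z1 (z : k) : z ^ 1 = z by []. have z2 (z : k) : z ^ (-1) = z^-1 by [].
by case: s1 => ->; case: s2 => -> /=; rewrite ?opprK ?z1 ?z2; field;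
  rewrite ?q0 ?q3 ?x0 ?Q10 ?Q20 ?d1 ?d2.
Qed.

Lemma cell_factor_neq0 : q ^+ n.+1 * Q1 * Q2 * (q ^+ 2 - 1) /
  (((q * Q1) ^+ 2 - 1) * ((q * Q2) ^+ 2 - 1)) != 0.
Proof. by rewrite !mulf_neq0 ?invr_eq0 ?mulf_neq0 ?expf_neq0. Qed.
End Eigenvalues.

(** On a zero module the block condition would hold vacuously; the standard half-diagram is a basis
    vector. *)
Lemma cell_module_neq0 (k : fieldType) n m e1 e2 : label n m e1 e2 ->
  {:cell_module k n m e1 e2}%VS != 0%VS.
Proof.
move=> lab; have hD := standard_half e1 e2 (label_lt lab) (label_par lab).
have rD : reduced (standard e1 e2 (label_lt lab)).
  have lab0 := label_zero lab.
  by apply: reduced_short => [|y]; [exact: half_loops hD | exact: half_word_size lab0].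
have [d ed] := dia_exists rD.
have hd : half_diagram e1 e2 (dia d) by rewrite ed.
pose w : half_basis n m e1 e2 := Sub d hd.
pose f : cell_module k n m e1 e2 := [ffun v => (v == w)%:R].
apply/eqP => W0; have : f \in {:cell_module k n m e1 e2}%VS by exact: memvf.
rewrite W0 memv0 => /eqP/ffunP/(_ w) /eqP.
by rewrite !ffunE eqxx oner_eq0.
Qed.

Unset Implicit Arguments.

Theorem corollary6p10 (k : fieldType) (n : nat) (n_gt0 : (1 <= n)%N)
    (q Q1 Q2 kLR : k)
    (q_neq0 : q != 0) (Q1_neq0 : Q1 != 0) (Q2_neq0 : Q2 != 0) (q2_neq1 : q ^+ 2 != 1)
    (w1_neq0 : qnum q Q1 Q2 1 1 0 != 0) (w2_neq0 : qnum q Q1 Q2 1 0 1 != 0)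
    (A : falgType k) (b : basis_diagram n -> A)
    (A_blob : symplectic_blob_algebra (blob_parameters q Q1 Q2 kLR) b)
    (m t : nat) (eps1 eps2 eta1 eta2 : int)
    (lab_m : label n m eps1 eps2) (lab_t : label n t eta1 eta2) :
  same_block (@cell_action k (blob_parameters q Q1 Q2 kLR) n A b m eps1 eps2)
             (@cell_action k (blob_parameters q Q1 Q2 kLR) n A b t eta1 eta2) ->
  alpha q Q1 Q2 n m eps1 eps2 = alpha q Q1 Q2 n t eta1 eta2.
Proof.
set P := blob_parameters q Q1 Q2 kLR.
have dE : delta P = q + q^-1 by exact: delta_blob_parameters.
have basic_w r e1 e2 (lab : label n r e1 e2) (w : half_basis n r e1 e2) :
    basic (lift_diagram (label_lt lab) (hdia w)).
  exact: half_basic (label_par lab) _ lab (half_basisP w).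
have casimir_act r e1 e2 (lab : label n r e1 e2) a f :
    @cell_action k P n A b r e1 e2 (casimir P b q n_gt0 * a) f =
    cell_eigenvalue P n q r e1 e2 *: cell_action P b a f.
  apply: (cell_action_central A_blob (label_par lab) lab (basic_w _ _ _ lab)).
    exact: casimir_central.
  by move=> w; apply: casimir_half => //; apply: half_basisP.
have eigenvalueE r e1 e2 (lab : label n r e1 e2) : cell_eigenvalue P n q r e1 e2 =
    q ^+ n.+1 * Q1 * Q2 * (q ^+ 2 - 1) / (((q * Q1) ^+ 2 - 1) * ((q * Q2) ^+ 2 - 1)) *
    (q ^ (- r%:Z) * Q1 ^ e1 * Q2 ^ e2 + q ^ r%:Z * Q1 ^ (- e1) * Q2 ^ (- e2)).
  apply: eigenvalue_formula_blob => //.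
  - by have := label_lt lab; have := label_par lab; lia.
  - by case: (label_sign1 lab) => [|[]]; [left | right].
  - by case: (label_sign2 lab) => [|[]]; [left | right].
have bm := basic_w _ _ _ lab_m; have bt := basic_w _ _ _ lab_t.
have pm := label_par lab_m; have pt := label_par lab_t.
move=> /(same_block_central (casimir_central A_blob n_gt0 dE erefl erefl q_neq0 q2_neq1)
  (cell_action0 A_blob pm lab_m bm) (cell_action0 A_blob pt lab_t bt)
  (cell_actionB A_blob pm lab_m bm) (cell_actionB A_blob pt lab_t bt)
  (cell_actionZ A_blob pm lab_m bm) (cell_actionZ A_blob pt lab_t bt)
  (casimir_act _ _ _ lab_m) (casimir_act _ _ _ lab_t)
  (cell_module_neq0 k lab_m) (cell_module_neq0 k lab_t)).
(* Only the common prefactor is cancelled; [n], which may vanish, is kept as a common factor. *)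
rewrite !eigenvalueE // /alpha => /mulfI e; congr (_ * _); apply: e.
exact: cell_factor_neq0.
Qed.
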